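(* Assume that $E$ is compact. Let $C$ be a narrowly closed convex subset of $M_1(E)$ such that $H(C\mid\alpha)<+\infty$, and let $\alpha^*$ be the $I$-projection of $\alpha$ on $C$. Let $\bar d=d_{FM}$ (resp. $\bar d=d_P$), and let $(\varepsilon_n)$ be any sequence of positive numbers going to $0$ such that $$N(d_{FM},\varepsilon_n/4)\,e^{-n\varepsilon_n^2/8}\to0\qquad\big(\text{resp. }N(d_P,\varepsilon_n/4)\,e^{-n\varepsilon_n^2/2}\to0\big)$$ as $n\to\infty$. Let $C_n=\{\nu\in M_1(E):\bar d(C,\nu)\le\varepsilon_n\}$. Then, for every integer $k\ge1$, $\alpha^n_{C_n,k}\to(\alpha^* )^{\otimes k}$ in total variation distance as $n\to\infty$.
   Context: $(E,d)$ is a Polish (here compact) metric space, $M_1(E)$ is the set of Borel probability measures on $E$ with the narrow topology (convergence in law), $\alpha\in M_1(E)$. For $x\in E^n$, $L_n=L_n^x=\frac1n\sum_{i=1}^n\delta_{x_i}$; for $A\subseteq M_1(E)$ with $\alpha^{\otimes n}(L_n\in A)>0$ and $k\le n$, $\alpha^n_{A,k}(D)=\alpha^{\otimes n}((x_1,\dots,x_k)\in D\mid L_n^x\in A)$. $H(\beta\mid\gamma)=\int\log\frac{d\beta}{d\gamma}\,d\beta$ if $\beta\ll\gamma$ and this is finite, $+\infty$ otherwise; $H(C\mid\alpha)=\inf_{\nu\in C}H(\nu\mid\alpha)$; the $I$-projection of $\alpha$ on $C$ is the unique $\alpha^*\in C$ with $H(\alpha^*\mid\alpha)=H(C\mid\alpha)$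 (it exists here). Prohorov metric: $d_P(\nu_1,\nu_2)=\inf\{r>0:\sup_A(\nu_1(A)-\nu_2(A^r))\le r\}$, where $A$ ranges over Borel sets and $A^r=\{x:d(x,A)\le r\}$. Fortet–Mourier metric: $d_{FM}(\nu_1,\nu_2)=\sup\{\int f\,(d\nu_1-d\nu_2):f\text{ bounded Lipschitz},\ \|f\|_\infty+\|f\|_{Lip}\le1\}$. $N(\bar d,\varepsilon)$ is the minimal number of open $\bar d$-balls of radius $\varepsilon$ needed to cover $M_1(E)$. *)

(* Defs.v *)
From HB Require Import structures.
From mathcomp Require Import all_boot all_order all_algebra.
From mathcomp Require Import all_classical all_reals all_analysis.

Set Implicit Arguments.
Unset Strict Implicit.
Unset Printing Implicit Defensive.

Import Order.TTheory GRing.Theory Num.Theory.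
Import numFieldNormedType.Exports.

Local Open Scope classical_set_scope.
Local Open Scope ring_scope.

(* Measurable types are pointed in the library, hence the base point; a space
   carrying a probability measure is nonempty anyway. *)
#[short(type="pointedMetricType")]
HB.structure Definition PointedMetric (R : numDomainType) :=
  {T of Metric R T & Pointed T}.

Notation borel E := (g_sigma_algebraType (@open E)).

(* As a term of the library, a probability measure is a set function defined on
   all sets, so two terms may represent the same Borel measure. Every notion
   below depends only on the values on Borel sets, and so does membership in a
   narrowly closed set. *)
Definition M1 (R : realType) (E : pointedMetricType R) : Type :=
  probability (borel E) R.

HB.instance Definition _ (R : realType) (E : pointedMetricType R) :=
  Pointed.on (M1 E).

(* Narrow topology: the coarsest one making nu |-> \int f dnu continuous for
   every bounded continuous f. *)
Section narrow_topology.
Context (R : realType) (E : pointedMetricType R).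

Definition narrow_index : set ((E -> R) * set R) :=
  [set fU | [/\ continuous fU.1, bounded_fun fU.1 & open fU.2]].

Definition narrow_subbase (fU : (E -> R) * set R) : set (M1 E) :=
  [set nu : M1 E | fU.2 (\int[nu]_x fU.1 x)].

HB.instance Definition _ :=
  isSubBaseTopological.Build (M1 E) narrow_index narrow_subbase.

End narrow_topology.

Section convex_measures.
Context (R : realType) (E : pointedMetricType R).

Definition is_mixture (t : R) (nu1 nu2 nu : M1 E) :=
  forall A : set (borel E), measurable A ->
    nu A = (t%:E * nu1 A + (1 - t)%:E * nu2 A)%E.

Definition convex_measures (C : set (M1 E)) :=
  forall (t : R) (nu1 nu2 nu : M1 E), 0 <= t <= 1 ->
    C nu1 -> C nu2 -> is_mixture t nu1 nu2 nu -> C nu.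

End convex_measures.

Section relative_entropy.
Context (R : realType) (E : pointedMetricType R).
Local Open Scope ereal_scope.
Local Open Scope charge_scope.

(* The negative part of log (dbeta/dgamma) is beta-integrable, so the integral
   is well-defined in ]-oo, +oo] when beta is dominated by gamma. *)
Definition relative_entropy (beta gamma : M1 E) : \bar R :=
  if pselect (beta `<< gamma) then
    \int[beta]_x lne (('d (charge_of_finite_measure beta) '/d gamma) x)
  else +oo.

Definition set_entropy (C : set (M1 E)) (alpha : M1 E) : \bar R :=
  ereal_inf [set relative_entropy nu alpha | nu in C].

Definition I_projection (alpha : M1 E) (C : set (M1 E)) (nu : M1 E) :=
  C nu /\ relative_entropy nu alpha = set_entropy C alpha.

End relative_entropy.

Definition dist_to (R : realType) (T : Type) (d : T -> T -> R) (A : set T)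
    (x : T) : \bar R :=
  ereal_inf [set (d a x)%:E | a in A].

Definition enlargement (R : realType) (T : Type) (d : T -> T -> R) (A : set T)
    (r : R) : set T :=
  [set x | (dist_to d A x <= r%:E)%E].

Section distances.
Context (R : realType) (E : pointedMetricType R).

Definition prohorov_dist (nu1 nu2 : M1 E) : R :=
  inf [set r : R | 0 < r /\
    (ereal_sup [set nu1 A - nu2 (enlargement (@mdist R E) A r)
               | A in (measurable : set (set (borel E)))] <= r%:E)%E].

Definition sup_norm (f : E -> R) : \bar R :=
  ereal_sup [set `|f x|%:E | x in [set: E]].

(* The diagonal pairs contribute 0 / 0 = 0. *)
Definition lip_norm (f : E -> R) : \bar R :=
  ereal_sup [set (`|f x.1 - f x.2| / mdist x.1 x.2)%:E | x in [set: E * E]].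

Definition fortet_mourier_dist (nu1 nu2 : M1 E) : R :=
  sup [set \int[nu1]_x f x - \int[nu2]_x f x
      | f in [set f : E -> R | (sup_norm f + lip_norm f <= 1)%E]].

End distances.

(* +oo when there is no finite covering *)
Definition covering_number (R : realType) (T : Type) (d : T -> T -> R)
    (e : R) : \bar R :=
  ereal_inf [set m%:R%:E | m in [set m : nat |
    exists c : 'I_m -> T, forall x, exists i, d (c i) x < e]].

Section product_law.
Context d (T : measurableType d) (R : realType).

Definition cons_tuple n (p : T * n.-tuple T) : n.+1.-tuple T :=
  [tuple of p.1 :: p.2].

Lemma measurable_cons_tuple n : measurable_fun [set: T * n.-tuple T]
  (@cons_tuple n).
Proof. exact: measurable_cons. Qed.

HB.instance Definition _ n := isMeasurableFun.Build _ _ _ _ (@cons_tuple n)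
  (@measurable_cons_tuple n).

Fixpoint product_law (P : probability T R) n : probability (n.-tuple T) R :=
  match n with
  | 0 => [the probability (0.-tuple T) R of dirac [tuple]]
  | m.+1 => [the probability (m.+1.-tuple T) R of
      distribution (P \x product_law P m)%E (@cons_tuple m)]
  end.

Lemma product_lawE (P : probability T R) n (A : 'I_n -> set T) :
  (forall i, measurable (A i)) ->
  product_law P n [set x | forall i, A i (tnth x i)] = (\prod_(i < n) P (A i))%E.
Proof.
elim: n A => [|n IH] A mA.
  rewrite big_ord0 /= diracE mem_set//= => -[]//.
rewrite big_ord_recl -IH; last by move=> i; exact: mA.
rewrite /= /distribution /pushforward /=.
have mB : measurable [set t : n.-tuple T |
    forall i, A (lift ord0 i) (tnth t i)].
  rewrite (_ : [set t | _] = \bigcap_(i in [set: 'I_n])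
      ((@tnth n T)^~ i @^-1` A (lift ord0 i))).
    apply: fin_bigcap_measurable => // i _.
    by rewrite -[X in measurable X]setTI; exact: measurable_tnth.
  by apply/seteqP; split => [t At i _|t At i]; exact: At.
rewrite -product_measure1E//.
congr (_ _); apply/seteqP; split => -[x t] /=.
  move=> h; split; first exact: (h ord0).
  by move=> i; have := h (lift ord0 i); rewrite tnthS.
move=> [Ax At] i; case: (unliftP ord0 i) => [j|] ->; last exact: Ax.
by rewrite tnthS; exact: At.
Qed.

End product_law.

Section empirical.
Context d (T : measurableType d) (R : realType).

Definition empirical n (x : n.-tuple T) : probability T R :=
  mnormalize (msum (fun i => \d_(nth point x i)) n) \d_point.

Lemma empiricalE n (x : n.-tuple T) (A : set T) : (0 < n)%N ->
  empirical x A = (n%:R^-1%:E * \sum_(i < n) \d_(tnth x i) A)%E.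
Proof.
move=> n0.
have mE (mu : {measure set T -> \bar R}) (P : probability T R) :
    mu [set: T] = n%:R%:E -> mnormalize mu P A = (n%:R^-1%:E * mu A)%E.
  by move=> mT; rewrite /mnormalize mT eqe pnatr_eq0 -leqn0 leqNgt n0 /= muleC.
rewrite [LHS]mE; first by congr (_ * _)%E; apply: eq_bigr => i _;
  rewrite (tnth_nth point).
transitivity (\sum_(i < n) (1%R%:E : \bar R))%E.
  by apply: eq_bigr => i _; exact: diracT.
by rewrite sumEFin big_const_ord iter_addr_0.
Qed.

(* x_1, ..., x_k; only meaningful for k <= n *)
Definition prefix_tuple n k (x : n.-tuple T) : k.-tuple T :=
  [tuple nth point x i | i < k].

Definition empirical_event n (A : set (probability T R)) : set (n.-tuple T) :=
  [set x | A (empirical x)].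

(* Only meaningful for k <= n and when the conditioning event has positive
   probability. *)
Definition conditional_law (alpha : probability T R) n
    (A : set (probability T R)) k (D : set (k.-tuple T)) : \bar R :=
  (product_law alpha n ([set x | D (prefix_tuple k x)] `&` empirical_event A)
   * (fine (product_law alpha n (empirical_event A)))^-1%:E)%E.

End empirical.

Arguments conditional_law {d T R} alpha n A k D.
Arguments fortet_mourier_dist {R E} nu1 nu2.
Arguments prohorov_dist {R E} nu1 nu2.

Definition tv_distance d (T : measurableType d) (R : realType)
    (mu nu : set T -> \bar R) : \bar R :=
  ereal_sup [set `|mu D - nu D|%E | D in measurable].

(* Main.v *)
Require Import Defs.
From HB Require Import structures.
From mathcomp Require Import all_boot all_order all_algebra.
From mathcomp Require Import all_classical all_reals all_analysis.
From mathcomp Require Import measurable_realfun.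
From mathcomp Require Import ring lra.
Set Implicit Arguments.
Unset Strict Implicit.
Unset Printing Implicit Defensive.
Import Order.TTheory GRing.Theory Num.Theory.
Import numFieldNormedType.Exports.
Local Open Scope classical_set_scope.
Local Open Scope ring_scope.

(** Let Q be the projection of alpha on C, h its density and H its entropy, and
    let S be the event that the empirical measure of the sample lies in the
    eps_n-enlargement of C. The proof compares two estimates of the probability p
    of S under the n-fold product of alpha; both are exact to first order on the
    exponential scale.

    The lower bound. Under the product of Q the event S has probability close to 1.
    Indeed, cover the space of measures by N balls of radius eps_n / 4; a ball
    that leaves the eps_n-ball around Q is separated from Q by the integral of one
    function with values in [0, 1] (good_distance), so Hoeffding's inequality and
    a union bound apply (empirical_event_whp); this is where the covering
    condition is used. Cramer's change of measure then gives
    p >= exp (- n (H + eta)) for every eta > 0 and n large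
    (product_law_lower_bound).

    The upper bound. Condition the sample on S. The conditioned law is
    exchangeable; let nubar be the common law of its coordinates and g the density
    of nubar with respect to alpha. Since nubar is an average of empirical measures
    that are close to the convex set C, it is close to C
    (barycenter_neighborhood). Jensen's inequality for the conditioned law, applied
    to \sum_i ln g (x_i) plus lam times the number of blocks of length k that fall
    in a set D, gives (entropy_block_estimate)

      n Ent(g) + m lam P(D) <= n (H + eta) + m (lam + 2 lam^2) nubar^k(D),

    where m = n %/ k and P is the conditional law of the first k coordinates. For
    lam = 0 this reads Ent(g) <= H + eta. As C is closed, convex and the space is
    compact, entropies close to H near C are attained only close to Q in total
    variation, and no measure near C has entropy much below H
    (near_projection_close, entropy_neighborhood): this is the parallelogram
    argument behind the existence of projections, made robust under small
    enlargements of C. So nubar^k is close to the k-fold product of Q, and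
    Ent(g) >= H - eta. Taking lam small and then eta much smaller than lam, the
    displayed inequality yields P(D) <= nubar^k(D) + small, uniformly in D; the
    complement of D gives the reverse inequality.

    Both metrics dominate the Fortet-Mourier metric, so closeness to C is always
    measured in the latter. *)

(** * Product laws *)

Section product_law_theory.
Context d (T : measurableType d) (R : realType).
Implicit Types P : probability T R.
Local Open Scope ereal_scope.

(** Boxes are stable under intersection and generate the product sigma-algebra. *)
Lemma product_law_unique P n (mu : {measure set (n.-tuple T) -> \bar R}) :
  (forall A : 'I_n -> set T, (forall i, measurable (A i)) ->
    mu [set x | forall i, A i (tnth x i)] = \prod_(i < n) P (A i)) ->
  forall B, measurable B -> mu B = product_law P n B.
Proof.
move=> muE.
pose G := [set B : set (n.-tuple T) | exists A : 'I_n -> set T,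
  (forall i, measurable (A i)) /\ B = [set x | forall i, A i (tnth x i)]].
have GT : G [set: n.-tuple T].
  exists (fun=> setT); split => //; apply/seteqP; split => //.
have GE : measurable = <<s G >> :> set (set (n.-tuple T)).
  apply/seteqP; split; last first.
    apply: smallest_sub; first exact: sigma_algebra_measurable.
    move=> _ [A [mA ->]].
    rewrite (_ : [set x | _] = \bigcap_(i in [set: 'I_n])
        ((@tnth n T)^~ i @^-1` A i)).
      apply: fin_bigcap_measurable => // i _.
      by rewrite -[X in measurable X]setTI; exact: measurable_tnth.
    by apply/seteqP; split => [t At i _|t At i]; exact: At.
  apply: smallest_sub; first exact: smallest_sigma_algebra.
  move=> B; rewrite -bigcup_seq => -[i _ [A mA <-]].
  apply: sub_sigma_algebra.
  exists (fun j => if j == i then A else setT); split.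
    by move=> j; case: ifP.
  apply/seteqP; split => [x [_ /= Ax] j|x /= Ax].
    by case: eqP => [->|].
  by split => //; have := Ax i; rewrite eqxx.
apply: (measure_unique G (fun=> setT) GE) => //.
- move=> _ _ [A [mA ->]] [B [mB ->]].
  exists (fun i => A i `&` B i); split; first by move=> i; exact: measurableI.
  apply/seteqP; split => [x /= [Ax Bx] i|x /= ABx]; first by split.
  by split => i; have [] := ABx i.
- by rewrite bigcup_const//; exists 0%N.
- by move=> A [B [mB ->]]; rewrite muE//; exact/esym/product_lawE.
- move=> _; rewrite (_ : [set: _] = [set x | forall i : 'I_n, setT (tnth x i)]).
    by rewrite (muE (fun=> setT))// big1 ?ltry// => i _; exact: probability_setT.
  by apply/seteqP; split.
Qed.

Lemma integral_product_lawS P n (F : n.+1.-tuple T -> \bar R) :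
  measurable_fun [set: n.+1.-tuple T] F -> (forall x, 0 <= F x) ->
  \int[product_law P n.+1]_x F x =
  \int[P]_x \int[product_law P n]_t F [tuple of x :: t].
Proof.
move=> mF F0.
rewrite /= (ge0_integral_distribution (P := (P \x product_law P n)%E))//.
rewrite fubini_tonelli1//; last by move=> x; exact: F0.
by apply: (measurableT_comp mF); exact: measurable_cons_tuple.
Qed.

Lemma measurable_integral_cons P n (F : n.+1.-tuple T -> \bar R) :
  measurable_fun [set: n.+1.-tuple T] F -> (forall x, 0 <= F x) ->
  measurable_fun [set: T]
    (fun x => \int[product_law P n]_t F [tuple of x :: t]).
Proof.
move=> mF F0.
apply: (measurable_fun_fubini_tonelli_F
  (fun p : T * n.-tuple T => F [tuple of p.1 :: p.2])) => //.
by apply: (measurableT_comp mF); exact: measurable_cons_tuple.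
Qed.

Lemma measurable_nth_tuple n i :
  measurable_fun [set: n.-tuple T] (fun x => nth point x i).
Proof.
have [ni|ni] := leqP n i.
  by under eq_fun do rewrite nth_default ?size_tuple//; exact: measurable_cst.
have -> : (fun x : n.-tuple T => nth point x i) = (@tnth n T)^~ (Ordinal ni).
  by apply/funext => x; rewrite (tnth_nth point).
exact: measurable_tnth.
Qed.

(** The map s selects coordinates; a value out of range yields the base point,
   so that blocks and rotations need no proof argument. *)
Definition subtuple n k (s : nat -> nat) (x : n.-tuple T) : k.-tuple T :=
  [tuple nth point x (s i) | i < k].

Lemma measurable_subtuple n k s :
  measurable_fun [set: n.-tuple T] (@subtuple n k s).
Proof.
apply/measurable_fun_tnthP => i; rewrite /comp.
under eq_fun do rewrite tnth_mktuple.
exact: measurable_nth_tuple.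
Qed.

HB.instance Definition _ n k s := isMeasurableFun.Build _ _ _ _
  (@subtuple n k s) (@measurable_subtuple n k s).

(** Coordinates sitting at distinct positions are again independent with law P:
   this covers blocks, rotations and single coordinates at once. *)
Lemma product_law_subtuple P n k s B :
  (forall i, (i < k)%N -> (s i < n)%N) ->
  (forall i j, (i < k)%N -> (j < k)%N -> s i = s j -> i = j) ->
  measurable B ->
  product_law P n (@subtuple n k s @^-1` B) = product_law P k B.
Proof.
move=> sn sI mB.
rewrite -[LHS]/(distribution (product_law P n) (@subtuple n k s) B).
apply: product_law_unique mB => A mA.
pose s' (i : 'I_k) : 'I_n := Ordinal (sn i (ltn_ord i)).
have s'I : injective s'.
  by move=> i j /(congr1 val)/= /sI sij; apply/val_inj/sij.
pose A' (j : 'I_n) : set T := \bigcap_(i in [set i | s' i = j]) A i.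
rewrite [LHS](_ : _ = product_law P n [set x | forall j, A' j (tnth x j)]); last first.
  congr (product_law P n _).
  apply/seteqP; split => [x /= h j i <-|x /= h i].
    by have := h i; rewrite tnth_mktuple (tnth_nth point).
  have := h (s' i); rewrite /A' => /(_ i erefl).
  by rewrite tnth_mktuple (tnth_nth point).
rewrite product_lawE; last first.
  by move=> j; rewrite /A'; apply: fin_bigcap_measurable.
rewrite (bigID (mem (codom s')))/= [X in _ * X]big1 ?mule1; last first.
  move=> j jN; rewrite (_ : A' j = setT) ?probability_setT//.
  by apply/seteqP; split => // x _ i /= sij; rewrite -sij codom_f in jN.
rewrite -big_uniq; last exact: (introT (injectiveP s') s'I).
rewrite big_image; apply: eq_bigr => i _; congr (P _).
apply/seteqP; split => [x Ax|x Ax]; first exact: Ax.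
by move=> j /= /s'I ->.
Qed.

Lemma integral_subtuple P n k s (F : k.-tuple T -> \bar R) :
  (forall i, (i < k)%N -> (s i < n)%N) ->
  (forall i j, (i < k)%N -> (j < k)%N -> s i = s j -> i = j) ->
  measurable_fun setT F -> (forall x, 0 <= F x) ->
  \int[product_law P n]_x F (subtuple k s x) = \int[product_law P k]_x F x.
Proof.
move=> sn sI mF F0.
rewrite -(ge0_integral_distribution (P := product_law P n) (@subtuple n k s))//.
by apply: eq_measure_integral => B mB _; exact: product_law_subtuple.
Qed.

Lemma integral_nth P n i (F : T -> \bar R) : (i < n)%N ->
  measurable_fun setT F -> (forall x, 0 <= F x) ->
  \int[product_law P n]_x F (nth point x i) = \int[P]_x F x.
Proof.
move=> ni mF F0.
transitivity (\int[product_law P n]_x F (tnth (subtuple 1 (fun=> i) x) ord0)).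
  by apply: eq_integral => x _; rewrite tnth_mktuple.
have mF' : measurable_fun setT (fun x : 1.-tuple T => F (tnth x ord0)).
  by apply: (measurableT_comp mF); exact: measurable_tnth.
rewrite (@integral_subtuple P n 1 (fun=> i) (fun x => F (tnth x ord0)))//; last first.
  by move=> [|//] [|//].
rewrite integral_product_lawS//; apply: eq_integral => x _.
rewrite (eq_integral (cst (F x))); last by move=> t _; rewrite tnth0.
by rewrite integral_cst// [X in _ * X](_ : _ = 1) ?mule1//; exact: probability_setT.
Qed.

Definition cat_pair n m (p : n.-tuple T * m.-tuple T) : (n + m).-tuple T :=
  [tuple of p.1 ++ p.2].

Lemma tnth_cat_pair n m (p : n.-tuple T * m.-tuple T) (i : 'I_(n + m)) :
  tnth (cat_pair p) i = match fintype.split i with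
    inl j => tnth p.1 j | inr j => tnth p.2 j end :> T.
Proof.
rewrite (tnth_nth point)/= nth_cat size_tuple.
case: fintype.splitP => j ->; first by rewrite (tnth_nth point).
by rewrite addKn (tnth_nth point).
Qed.

Lemma measurable_cat_pair n m :
  measurable_fun [set: n.-tuple T * m.-tuple T] (@cat_pair n m).
Proof.
apply/measurable_fun_tnthP => i; rewrite /comp.
under eq_fun do rewrite tnth_cat_pair.
case: (fintype.split i) => j.
- apply: (@measurableT_comp _ _ _ _ _ _ (fun x : n.-tuple T => tnth x j)) => //.
  exact: measurable_tnth.
- apply: (@measurableT_comp _ _ _ _ _ _ (fun x : m.-tuple T => tnth x j)) => //.
  exact: measurable_tnth.
Qed.

HB.instance Definition _ n m := isMeasurableFun.Build _ _ _ _
  (@cat_pair n m) (@measurable_cat_pair n m).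

Lemma integral_cat_pair P n m (F : (n + m).-tuple T -> \bar R) :
  measurable_fun setT F -> (forall x, 0 <= F x) ->
  \int[product_law P (n + m)]_x F x =
  \int[product_law P n]_u \int[product_law P m]_v F (cat_pair (u, v)).
Proof.
move=> mF F0.
transitivity (\int[distribution (product_law P n \x product_law P m)%E
    (@cat_pair n m)]_x F x).
  apply/esym/eq_measure_integral => B mB _.
  apply: product_law_unique mB => A mA.
  rewrite [LHS](_ : _ = (product_law P n \x product_law P m)
    ([set x | forall j, A (lshift m j) (tnth x j)] `*`
     [set x | forall j, A (rshift n j) (tnth x j)])); last first.
    congr ((product_law P n \x product_law P m) _).
    apply/seteqP; split => -[u v] /=.
      move=> h; split => j; have := h (unsplit (_ j)).
        by move=> /(_ inl); rewrite tnth_cat_pair unsplitK.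
      by move=> /(_ inr); rewrite tnth_cat_pair unsplitK.
    move=> [hu hv] i; rewrite tnth_cat_pair -[i in A i]splitK.
    by case: (fintype.split i) => j /=; [exact: hu|exact: hv].
  have mbox k (A' : 'I_k -> set T) : (forall i, measurable (A' i)) ->
      measurable [set x : k.-tuple T | forall j, A' j (tnth x j)].
    move=> mA'; rewrite (_ : [set x | _] = \bigcap_(i in [set: 'I_k])
        ((@tnth k T)^~ i @^-1` A' i)).
      apply: fin_bigcap_measurable => // i _.
      by rewrite -[X in measurable X]setTI; exact: measurable_tnth.
    by apply/seteqP; split => [t At i _|t At i]; exact: At.
  rewrite product_measure1E; last 2 first.
  - exact: (mbox _ (fun j => A (lshift m j))).
  - exact: (mbox _ (fun j => A (rshift n j))).
  by rewrite big_split_ord; congr (_ * _); apply: product_lawE.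
rewrite (ge0_integral_distribution (P := (product_law P n \x product_law P m)%E))//.
rewrite fubini_tonelli1//; last by move=> x; exact: F0.
by apply: (measurableT_comp mF); exact: measurable_cat_pair.
Qed.

(** A one-coordinate bound on a change of measure tensorizes, by Fubini. Only an
   inequality is propagated, which lets g be the inverse of a density that may
   vanish. *)
Lemma le_integral_weight P P' (g : T -> R) :
  measurable_fun setT g -> (forall x, (0 <= g x)%R) ->
  (forall F : T -> \bar R, measurable_fun setT F -> (forall x, 0 <= F x) ->
    \int[P]_x (F x * (g x)%:E) <= \int[P']_x F x) ->
  forall n (F : n.-tuple T -> \bar R), measurable_fun setT F ->
    (forall x, 0 <= F x) ->
  \int[product_law P n]_x (F x * (\prod_(i < n) g (tnth x i))%:E)
    <= \int[product_law P' n]_x F x.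
Proof.
move=> mg g0 gP; elim=> [|n IH] F mF F0.
  by rewrite (eq_integral F)// => x _; rewrite big_ord0 mule1.
have mpr k : measurable_fun [set: k.-tuple T]
    (fun x => (\prod_(i < k) g (tnth x i))%:E).
  apply/measurable_EFinP; apply: measurable_prod => i _.
  by apply: (measurableT_comp mg); exact: measurable_tnth.
have pr0 k (x : k.-tuple T) : 0 <= (\prod_(i < k) g (tnth x i))%:E.
  by rewrite lee_fin; apply: prodr_ge0.
have mcons x : measurable_fun [set: n.-tuple T] (fun t => F [tuple of x :: t]).
  by apply: (measurableT_comp mF); apply: measurable_cons.
rewrite !integral_product_lawS//; last 2 first.
- by apply: emeasurable_funM; [exact: mF|exact: mpr].
- by move=> x; exact: mule_ge0.
apply: le_trans (gP _ _ _); last 2 first.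
- exact: measurable_integral_cons.
- by move=> x; exact: integral_ge0.
have mI : measurable_fun [set: T] (fun x => \int[product_law P n]_t
    (F [tuple of x :: t] * (\prod_(i < n) g (tnth t i))%:E * (g x)%:E)).
  rewrite [X in measurable_fun _ X](_ : _ = (fun x => \int[product_law P n]_t
    (fun y : n.+1.-tuple T => F y * (\prod_(i < n.+1) g (tnth y i))%:E)
      [tuple of x :: t])).
    apply: (@measurable_integral_cons P n
      (fun y => F y * (\prod_(i < n.+1) g (tnth y i))%:E)); first by apply: emeasurable_funM; [exact: mF|exact: mpr].
    by move=> x; exact: mule_ge0.
  apply/funext => x; apply: eq_integral => t _.
  rewrite big_ord_recl EFinM -muleA [X in _ * X]muleC; congr (_ * (_ * _)).
  by congr (_%:E); apply: eq_bigr => i _; rewrite tnthS.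
rewrite (eq_integral (fun x => \int[product_law P n]_t
    (F [tuple of x :: t] * (\prod_(i < n) g (tnth t i))%:E * (g x)%:E))); last first.
  move=> x _; apply: eq_integral => t _.
  rewrite big_ord_recl EFinM -muleA [X in _ * X]muleC; congr (_ * (_ * _)).
  by congr (_%:E); apply: eq_bigr => i _; rewrite tnthS.
apply: ge0_le_integral => //.
- move=> x _; apply: integral_ge0 => t _.
  by rewrite !mule_ge0// lee_fin.
- apply: emeasurable_funM; last exact/measurable_EFinP.
  exact: measurable_integral_cons.
move=> x _; rewrite ge0_integralZr//.
- by rewrite lee_wpmul2r ?lee_fin//; exact: IH.
- by apply: emeasurable_funM; [exact: mcons|exact: mpr].
- by move=> t _; exact: mule_ge0.
- by rewrite lee_fin.
Qed.

(** m * k + r, computed by peeling off one leading block at a time; with this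
   form the type of a tuple splits by conversion in the induction below. *)
Fixpoint blocks_length k r m := if m is m'.+1 then (k + blocks_length k r m')%N else r.

Lemma blocks_lengthE k r m : blocks_length k r m = (m * k + r)%N.
Proof. by elim: m => //= m ->; rewrite mulSn addnA. Qed.

Definition block k n j (x : n.-tuple T) : k.-tuple T :=
  subtuple k (fun i => j * k + i)%N x.

Lemma measurable_block k n j : measurable_fun [set: n.-tuple T] (@block k n j).
Proof. exact: measurable_subtuple. Qed.

(** Functions of disjoint blocks are independent, so the integral of their product
   factorizes. *)
Lemma integral_prod_block P k n m (G : k.-tuple T -> R) (a : R) :
  (m * k <= n)%N ->
  measurable_fun setT G -> (forall x, 0 <= G x)%R ->
  \int[product_law P k]_x (G x)%:E <= a%:E ->
  \int[product_law P n]_x (\prod_(j < m) G (block k j x))%:E <= (a ^+ m)%:E.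
Proof.
move=> mkn mG G0 Ga.
have -> : n = blocks_length k (n - m * k) m by rewrite blocks_lengthE subnKC.
move: (n - m * k)%N => {n mkn} r.
have mpr i l : measurable_fun [set: l.-tuple T]
    (fun x => (\prod_(j < i) G (block k j x))%:E).
  apply/measurable_EFinP; apply: measurable_prod => j _.
  by apply: (measurableT_comp mG); exact: measurable_block.
have pr0 i l (x : l.-tuple T) : (0 <= \prod_(j < i) G (block k j x))%R.
  exact: prodr_ge0.
elim: m => [|m IH].
  rewrite /= (eq_integral (cst 1)); last by move=> x _; rewrite big_ord0.
  by rewrite integral_cst// [X in _ * X](_ : _ = 1) ?mule1//; exact: probability_setT.
rewrite /= integral_cat_pair; last 2 first.
- exact: mpr.
- by move=> x; rewrite lee_fin; exact: pr0.
have a0 : (0 <= a)%R.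
  by rewrite -lee_fin (le_trans _ Ga)//; apply: integral_ge0 => x _; rewrite lee_fin.
apply: (@le_trans _ _ (\int[product_law P k]_u ((a ^+ m)%:E * (G u)%:E))).
  apply: ge0_le_integral => //.
  - by move=> u _; apply: integral_ge0 => v _; rewrite lee_fin; exact: pr0.
  - apply: (measurable_fun_fubini_tonelli_F (fun p => (\prod_(j < m.+1) G (block k j (cat_pair p)))%:E)) => //.
      by apply: (measurableT_comp (mpr _ _)); exact: measurable_cat_pair.
    by move=> p; rewrite lee_fin; exact: pr0.
  - by apply: emeasurable_funM => //; exact/measurable_EFinP.
  move=> u _.
  rewrite (eq_integral (fun v => (\prod_(j < m) G (block k j v))%:E * (G u)%:E)).
    rewrite ge0_integralZr//; last 3 first.
    - exact: mpr.
    - by move=> v _; rewrite lee_fin; exact: pr0.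
    - by rewrite lee_fin.
    by rewrite lee_wpmul2r// lee_fin.
  move=> v _; rewrite -EFinM; congr (_%:E).
  rewrite big_ord_recl mulrC; congr (_ * _)%R.
    apply: eq_bigr => j _; congr (G _); apply: eq_from_tnth => i.
    rewrite !tnth_mktuple nth_cat size_tuple lift0 mulSn -addnA.
    by rewrite ltnNge leq_addr /= addKn.
  congr (G _); apply: eq_from_tnth => i.
  by rewrite !tnth_mktuple nth_cat size_tuple mul0n add0n ltn_ord (tnth_nth point).
rewrite ge0_integralZl//; last 3 first.
- exact/measurable_EFinP.
- by move=> x _; rewrite lee_fin.
- by rewrite lee_fin exprn_ge0.
by rewrite exprSr EFinM lee_wpmul2l// lee_fin exprn_ge0.
Qed.

End product_law_theory.

(** * Elementary inequalities *)

Section real_inequalities.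
Context (R : realType).
Implicit Types x y t p : R.

Lemma ge0_derive_le (f f' : R -> R) t :
  (forall x, 0 <= x -> is_derive x 1 f (f' x)) ->
  (forall x, 0 <= x -> 0 <= f' x) -> 0 <= t -> f 0 <= f t.
Proof.
move=> df f'0 t0.
have itv x : x \in `[0, t] -> 0 <= x by rewrite in_itv/= => /andP[].
have oitv x : x \in `]0, t[ -> 0 <= x by rewrite in_itv/= => /andP[/ltW].
apply: (@ger0_derive1_le _ f 0 t _ _ true false) => //.
- by move=> x /oitv x0; have [] := df _ x0.
- move=> x /oitv x0; rewrite derive1E; have fx := df _ x0.
  by rewrite derive_val; exact: f'0.
- apply: derivable_within_continuous => x /itv x0; by have [] := df _ x0.
- by rewrite in_itv/= lexx.
- by rewrite in_itv/= lexx t0.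
Qed.

(** Hoeffding's lemma for a Bernoulli variable, where t^2 / 8 is a quarter of
   t^2 / 2 because a variance on [0, 1] is at most 1 / 4. *)
Lemma bernoulli_mgf_le p t : 0 <= p <= 1 -> 0 <= t ->
  1 - p + p * expR t <= expR (p * t + t ^+ 2 / 8).
Proof.
move=> /andP[p0 p1] t0.
pose u x : R := 1 - p + p * expR x.
have u_gt0 x : 0 <= x -> 0 < u x.
  move=> x0; rewrite /u.
  have : 1 <= expR x by rewrite -expR0 ler_expR.
  by move=> ?; nra.
have u'0 x : 0 <= x -> u x != 0 by move=> /u_gt0; rewrite lt0r => /andP[].
pose g x : R := p + x / 4 - p * expR x * (u x)^-1.
have du x : is_derive x 1 u (p * expR x).
  rewrite /u; apply: is_derive_eq; rewrite /GRing.scale/=; ring.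
have g_ge0 x : 0 <= x -> 0 <= g x.
  move=> x0; have -> : 0 = g 0.
    by rewrite /g /u expR0 mul0r addr0 !mulr1 addrNK invr1 mulr1 subrr.
  pose g' x := (1 - p - p * expR x) ^+ 2 / (4 * u x ^+ 2).
  have dg y : 0 <= y -> is_derive y 1 g (g' y).
    move=> y0; have uy := u'0 _ y0.
    have duV := @is_deriveV _ u y _ 1 uy (du y).
    rewrite /g /g'; apply: is_derive_eq; rewrite /GRing.scale/= /u.
    by move: uy; rewrite /u => uy; field.
  have g'0 y : 0 <= y -> 0 <= g' y.
    by move=> y0; rewrite /g' divr_ge0 ?sqr_ge0// mulr_ge0// sqr_ge0.
  exact: (ge0_derive_le dg g'0 x0).
have h0 : 0 <= p * t + t ^+ 2 / 8 - ln (u t).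
  have -> : 0 = (fun x => p * x + x ^+ 2 / 8 - ln (u x)) 0.
    by rewrite /= /u expR0 mulr1 addrNK ln1 mulr0 expr0n/= mul0r addr0 subr0.
  apply: (fun H => @ge0_derive_le (fun x => p * x + x ^+ 2 / 8 - ln (u x)) g t H g_ge0 t0).
  move=> y y0; have uy := u_gt0 _ y0.
  have dln := is_derive1_comp (@is_derive1_ln _ _ uy) (du y).
  rewrite (_ : (fun x => _) = (fun x => p * x + x ^+ 2 / 8 - (@ln R \o u) x))//.
  apply: is_derive_eq; rewrite /GRing.scale/= /g.
  by rewrite (mulrC _ (p * expR y)); field; exact: u'0.
by rewrite -ler_ln ?posrE ?expR_gt0 ?u_gt0// expRK -subr_ge0.
Qed.

(** Convexity of exp, read off the tangent line at t * x evaluated at 0 and t. *)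
Lemma expR_chord t x : 0 <= x <= 1 ->
  expR (t * x) <= 1 - x + x * expR t.
Proof.
move=> /andP[x0 x1].
have h1 : expR (t * x) * (1 + - (t * x)) <= 1.
  rewrite -{2}expR0 -(subrr (t * x)) expRD ler_pM2l ?expR_gt0//.
  exact: expR_ge1Dx.
have h2 : expR (t * x) * (1 + (t - t * x)) <= expR t.
  rewrite -[in leRHS](subrKC (t * x) t) expRD ler_pM2l ?expR_gt0//.
  exact: expR_ge1Dx.
have : (1 - x) * (expR (t * x) * (1 + - (t * x))) + x * (expR (t * x) * (1 + (t - t * x))) <= 1 - x + x * expR t.
  by apply: lerD; [rewrite -[leRHS]mulr1; apply: ler_wpM2l => //; rewrite subr_ge0|exact: ler_wpM2l].
apply: le_trans; rewrite le_eqVlt; apply/orP; left; apply/eqP; ring.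
Qed.

Lemma expR_le1DxD2 t : 0 <= t <= 1 / 2 -> expR t <= 1 + (t + 2 * t ^+ 2).
Proof.
move=> /andP[t0 t1].
have h : expR t * (1 - t) <= 1.
  rewrite -{2}expR0 -(subrr t) expRD ler_pM2l ?expR_gt0//; exact: expR_ge1Dx.
have : expR t <= (1 - t)^-1.
  by rewrite -[leRHS]mul1r ler_pdivlMr//; lra.
move=> /le_trans; apply.
rewrite -[leLHS]mul1r ler_pdivrMr; last by lra.
by nra.
Qed.

(** phi >= 0, and phi g integrates to the relative entropy of a probability of
   density g, whose mass cancels the affine part: integrals of phi g can be
   handled as integrals of nonnegative functions. *)
Definition phi x : R := x * ln x - x + 1.

(** Apply 1 - 1 / s <= ln s to s = sqrt x. *)
Lemma phi_ge x : 0 <= x -> (x - 1) ^+ 2 / (2 * (x + 1)) <= phi x.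
Proof.
rewrite le_eqVlt => /orP[/eqP <-|x0].
  rewrite [phi 0](_ : _ = 1); last by rewrite /phi mul0r subr0 add0r.
  by rewrite !add0r mulr1 sqrrN expr1n; lra.
pose s := Num.sqrt x.
have s0 : 0 < s by rewrite sqrtr_gt0.
have xE : x = s ^+ 2 by rewrite sqr_sqrtr// ltW.
have lns : 1 - s^-1 <= ln s.
  have := @le_ln1Dx _ (s^-1 - 1).
  rewrite subrKC lnV ?posrE// => h.
  have : - 1 < s^-1 - 1 by rewrite ltrBDr addNr invr_gt0.
  by move=> /h; lra.
have lnx : ln x = 2 * ln s.
  by rewrite xE lnXn// mulr_natl.
rewrite ler_pdivrMr; last by lra.
rewrite /phi lnx.
have h : s * (s - 1) <= x * ln s.
  have -> : s * (s - 1) = x * (1 - s^-1) by rewrite xE; field; rewrite gt_eqF.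
  by rewrite ler_pM2l.
have h2 : (s - 1) ^+ 2 <= x * (2 * ln s) - x + 1.
  by rewrite mulrCA; move: h; rewrite xE; nra.
apply: (@le_trans _ _ ((s - 1) ^+ 2 * (2 * (x + 1)))); last first.
  by rewrite ler_pM2r//; lra.
have -> : x - 1 = (s - 1) * (s + 1) by rewrite xE; ring.
rewrite exprMn; apply: ler_wpM2l; first exact: sqr_ge0.
rewrite -subr_ge0 (_ : _ - _ = (s - 1) ^+ 2) ?sqr_ge0//.
by rewrite [in LHS]xE; ring.
Qed.

Lemma phi_ge0 x : 0 <= x -> 0 <= phi x.
Proof.
move=> x0; apply: le_trans (phi_ge x0).
by rewrite divr_ge0 ?sqr_ge0//; lra.
Qed.

(** Quantitative convexity of phi: after scaling by the midpoint m, each term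
   m * phi (x / m) is bounded below with phi_ge. *)
Lemma phi_midpoint_gap x y : 0 <= x -> 0 <= y ->
  (x - y) ^+ 2 / (12 * (x + y)) <= (phi x + phi y) / 2 - phi ((x + y) / 2).
Proof.
move=> x0 y0; pose m := (x + y) / 2.
have : 0 <= m by rewrite /m; lra.
rewrite le_eqVlt => /orP[/eqP m0|m0].
  have -> : x = 0 by move: m0; rewrite /m; lra.
  have -> : y = 0 by move: m0; rewrite /m; lra.
  rewrite addr0 subrr mul0r expr0n/= !mul0r.
  by rewrite [phi 0](_ : _ = 1); [lra|rewrite /phi mul0r subr0 add0r].
have xlnx z : 0 <= z -> z * ln z = z * ln m + m * phi (z / m) + z - m.
  move: (m) m0 => {x y x0 y0 m} c c0.
  rewrite le_eqVlt => /orP[/eqP <-|z0]; first by rewrite /phi !mul0r; ring.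
  rewrite /phi ln_div ?posrE//; move: (ln z) (ln c) => a b.
  by field; rewrite gt_eqF.
have -> : (phi x + phi y) / 2 - phi m = m / 2 * (phi (x / m) + phi (y / m)).
  rewrite [phi x]/phi [phi y]/phi [phi m]/phi (xlnx _ x0) (xlnx _ y0).
  have -> : x = 2 * m - y by rewrite /m; lra.
  by field.
have sm : x + y = 2 * m by rewrite /m; lra.
have pz z : 0 <= z <= 2 * m -> (z - m) ^+ 2 / (6 * m) <= m * phi (z / m).
  move=> /andP[z0 zm].
  have := @phi_ge (z / m); rewrite divr_ge0 ?(ltW m0)// => /(_ isT) h.
  apply: le_trans (ler_wpM2l (ltW m0) h).
  have -> : m * ((z / m - 1) ^+ 2 / (2 * (z / m + 1))) = (z - m) ^+ 2 / (2 * (z + m)).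
    by field; rewrite ?gt_eqF//=; lra.
  rewrite ler_wpM2l ?sqr_ge0// lef_pV2 ?posrE; lra.
have hx := pz x; have hy := pz y.
have -> : (x - y) ^+ 2 / (12 * (x + y)) = ((x - m) ^+ 2 / (6 * m) + (y - m) ^+ 2 / (6 * m)) / 2.
  rewrite sm; have -> : x = 2 * m - y by lra.
  by field; rewrite gt_eqF.
have : (x - m) ^+ 2 / (6 * m) <= m * phi (x / m) by apply: hx; lra.
have : (y - m) ^+ 2 / (6 * m) <= m * phi (y / m) by apply: hy; lra.
lra.
Qed.

(** The square root of the convexity gap, linearized by the inequality between
   the arithmetic and geometric means; the parameter s replaces an optimization
   that Cauchy-Schwarz would perform after integration. *)
Lemma dist_le_phi_gap (s x y : R) : 0 < s -> 0 <= x -> 0 <= y ->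
  `|x - y| <= 12 / s * ((phi x + phi y) / 2 - phi ((x + y) / 2)) + s * (x + y) / 4.
Proof.
move=> s0 x0 y0.
have := phi_midpoint_gap x0 y0; set G := _ - phi _ => h.
have : 0 <= x + y by lra.
rewrite le_eqVlt => /orP[/eqP xy0|xy0].
  have -> : x = 0 by lra.
  have -> : y = 0 by lra.
  rewrite subrr normr0 addr0 mulr0 mul0r addr0 mulr_ge0//.
    by rewrite divr_ge0// ltW.
  by apply: le_trans h; rewrite divr_ge0 ?sqr_ge0//; lra.
have G0 : (x - y) ^+ 2 / (x + y) <= 12 * G.
  have -> : (x - y) ^+ 2 / (x + y) = 12 * ((x - y) ^+ 2 / (12 * (x + y))).
    by field; rewrite gt_eqF.
  by rewrite ler_pM2l.
have : (x - y) ^+ 2 / (x + y) / s <= 12 / s * G.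
  by rewrite [leRHS]mulrAC ler_pM2r ?invr_gt0.
have : `|x - y| <= (x - y) ^+ 2 / (x + y) / s + s * (x + y) / 4.
  rewrite -[_ ^+ 2]real_normK ?num_real//; set a := `|x - y|.
  rewrite -subr_ge0.
  have -> : a ^+ 2 / (x + y) / s + s * (x + y) / 4 - a =
     (a - s * (x + y) / 2) ^+ 2 / (s * (x + y)).
    by field; rewrite ?gt_eqF.
  by rewrite divr_ge0 ?sqr_ge0// mulr_ge0// ltW.
lra.
Qed.

End real_inequalities.

(** * Densities and entropy *)

Section densities.
Context d (T : measurableType d) (R : realType).
Variable alpha : probability T R.
Implicit Types (nu : probability T R) (f g : T -> R).
Local Open Scope ereal_scope.

(** A nonnegative real-valued version of the Radon-Nikodym derivative, carried
   explicitly so that pointwise operations on densities make sense. *)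
Definition density nu g :=
  [/\ measurable_fun setT g, (forall x, 0 <= g x)%R &
      forall A, measurable A -> nu A = \int[alpha]_(x in A) (g x)%:E].

Lemma density_dominates nu g : density nu g -> nu `<< alpha.
Proof.
move=> [mg g0 nuE]; apply/null_content_dominatesP => A mA A0.
rewrite nuE//; apply: null_set_integral => //.
by apply/measurable_EFinP; exact: measurable_funTS.
Qed.

Lemma density_mass nu g : density nu g -> \int[alpha]_x (g x)%:E = 1.
Proof. by move=> [_ _ <-] //; rewrite probability_setT. Qed.

Lemma density_integrable_self nu g : density nu g ->
  alpha.-integrable setT (EFin \o g).
Proof.
move=> dg; have [mg g0 nuE] := dg; apply/integrableP; split.
  exact/measurable_EFinP.
rewrite (eq_integral (EFin \o g)); last by move=> x _; rewrite /= ger0_norm.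
by rewrite [X in X < _](density_mass dg) ltry.
Qed.

Lemma density_RN nu g : density nu g ->
  ae_eq alpha setT (Radon_Nikodym_SigmaFinite.f nu alpha) (EFin \o g).
Proof.
move=> dg; have [mg g0 nuE] := dg.
have nua := density_dominates dg.
apply: integral_ae_eq => //.
- exact: Radon_Nikodym_SigmaFinite.f_integrable.
- exact/measurable_EFinP.
- move=> A _ mA; rewrite -Radon_Nikodym_SigmaFinite.f_integral//.
  exact: nuE.
Qed.

Lemma density_integral nu g (F : T -> \bar R) : density nu g ->
  measurable_fun setT F -> (forall x, 0 <= F x) ->
  \int[nu]_x F x = \int[alpha]_x (F x * (g x)%:E).
Proof.
move=> dg mF F0; have [mg g0 nuE] := dg.
have nua := density_dominates dg.
rewrite -(Radon_Nikodym_SigmaFinite.change_of_variables nua F0)//.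
apply: ae_eq_integral => //.
- apply: emeasurable_funM => //.
  exact: measurable_int (Radon_Nikodym_SigmaFinite.f_integrable _).
- by apply: emeasurable_funM => //; exact/measurable_EFinP.
- apply: ae_eqe_mul2l; exact: density_RN.
Qed.

Lemma density_integrable nu g f : density nu g -> measurable_fun setT f ->
  alpha.-integrable setT (fun x => (f x * g x)%:E) ->
  nu.-integrable setT (EFin \o f) /\
  \int[nu]_x (f x)%:E = \int[alpha]_x (f x * g x)%:E.
Proof.
move=> dg mf fgi; have [mg g0 nuE] := dg.
have mF : measurable_fun setT (EFin \o f) by exact/measurable_EFinP.
split.
  apply/integrableP; split => //.
  rewrite (density_integral dg)//; last exact: measurableT_comp.
  have /integrableP[_] := fgi.
  rewrite [X in X < _ -> _](_ : _ = \int[alpha]_x (`|(EFin \o f) x| * (g x)%:E))//.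
  by apply: eq_integral => x _; rewrite EFinM abseM (@gee0_abs _ (g x)%:E)// lee_fin.
rewrite [LHS]integralE [RHS]integralE; congr (_ - _).
  rewrite (density_integral dg)//; last exact: measurable_funepos.
  apply: eq_integral => x _.
  by rewrite !funeposE EFinM maxe_pMl ?lee_fin// mul0e.
rewrite (density_integral dg)//; last exact: measurable_funeneg.
apply: eq_integral => x _.
by rewrite !funenegE EFinM -mulNe maxe_pMl ?lee_fin// mul0e.
Qed.

Lemma density_exists nu :
  (forall A, measurable A -> alpha A = 0 -> nu A = 0) -> exists g, density nu g.
Proof.
move=> h.
have nua : nu `<< alpha by apply/null_content_dominatesP.
pose f := Radon_Nikodym_SigmaFinite.f nu alpha.
have ffin x : f x \is a fin_num by exact: Radon_Nikodym_SigmaFinite.f_fin_num.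
have f0 x : 0 <= f x by exact: Radon_Nikodym_SigmaFinite.f_ge0.
have mf : measurable_fun setT f.
  exact: measurable_int (Radon_Nikodym_SigmaFinite.f_integrable _).
exists (fine \o f); split.
- by apply: measurableT_comp => //; exact: fine_measurable.
- by move=> x; exact: fine_ge0.
- move=> A mA; rewrite (Radon_Nikodym_SigmaFinite.f_integral nua)//.
  by apply: eq_integral => x _; rewrite /= fineK.
Qed.

Lemma probability_of_density g :
  measurable_fun setT g -> (forall x, 0 <= g x)%R ->
  \int[alpha]_x (g x)%:E = 1 -> exists nu, density nu g.
Proof.
move=> mg g0 g1.
pose m A := \int[alpha]_(x in A) (g x)%:E.
have mg' : measurable_fun setT (fun x => (g x)%:E) by exact/measurable_EFinP.
have g0' x : 0 <= (g x)%:E by rewrite lee_fin.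
have m0 : m set0 = 0 by rewrite /m integral_set0.
have mge0 A : 0 <= m A by apply: integral_ge0.
pose mm := isMeasure.Build _ _ _ m m0 mge0 (semi_sigma_additive_nng_induced mg' g0').
pose M : {measure set T -> \bar R} := HB.pack m mm.
exists (mnormalize M alpha); split => // A mA.
have MT : M setT = 1 by exact: g1.
by rewrite /= /mnormalize MT onee_eq0 /= invr1 mule1.
Qed.

Definition entropy g := \int[alpha]_x (phi (g x))%:E.

Lemma measurable_phi g : measurable_fun setT g ->
  measurable_fun setT (fun x => phi (g x)).
Proof.
move=> mg; rewrite /phi; apply: measurable_funD => //.
apply: measurable_funB => //; apply: measurable_funM => //.
by apply: measurableT_comp => //; exact: measurable_ln.
Qed.

Lemma entropy_ge0 nu g : density nu g -> 0 <= entropy g.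
Proof.
by move=> [_ g0 _]; apply: integral_ge0 => x _; rewrite lee_fin phi_ge0.
Qed.

Lemma integrable_phi nu g : density nu g -> entropy g < +oo ->
  alpha.-integrable setT (fun x => (phi (g x))%:E).
Proof.
move=> [mg g0 nuE] eg; apply/integrableP; split.
  by apply/measurable_EFinP; exact: measurable_phi.
rewrite (eq_integral (fun x => (phi (g x))%:E))//.
by move=> x _; rewrite gee0_abs// lee_fin phi_ge0.
Qed.

(** phi g = g * ln g - g + 1 and g has integral 1. *)
Lemma entropy_ln nu g : density nu g -> entropy g < +oo ->
  nu.-integrable setT (fun x => (ln (g x))%:E) /\
  \int[nu]_x (ln (g x))%:E = entropy g.
Proof.
move=> dg eg; have [mg g0 nuE] := dg.
have ig := density_integrable_self dg.
have ip := integrable_phi dg eg.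
have i1 : alpha.-integrable setT (cst 1) by exact: finite_measure_integrable_cst.
have E x : (ln (g x) * g x)%:E = (phi (g x))%:E + ((g x)%:E - 1).
  by rewrite -EFinB -EFinD /phi; congr (_%:E); ring.
have mln : measurable_fun setT (fun x => ln (g x)).
  by apply: measurableT_comp => //; exact: measurable_ln.
have [|ii ->] := density_integrable dg mln.
  rewrite (_ : (fun x => _) = (fun x => (phi (g x))%:E) \+ ((EFin \o g) \- cst 1)).
    by apply: integrableD => //; exact: integrableB.
  by apply/funext => x; rewrite E.
split => //.
under eq_integral do rewrite E.
rewrite integralD//; last exact: integrableB.
rewrite integralB//.
rewrite [X in _ + (X - _)](density_mass dg) integral_cst// [X in 1 * X](_ : _ = 1).
  by rewrite mule1 subee// adde0.
exact: probability_setT.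
Qed.

(** x * ln x >= -1 for x >= 0, so that the negative part of ln g always has a
   finite integral and only the positive part can diverge. *)
Lemma entropy_lty nu g : density nu g ->
  \int[nu]_x (ln (g x))%:E < +oo -> entropy g < +oo.
Proof.
move=> dg; have [mg g0 nuE] := dg.
have mln : measurable_fun setT (fun x => ln (g x)).
  by apply: measurableT_comp => //; exact: measurable_ln.
have meln : measurable_fun setT (fun x => (ln (g x))%:E) by exact/measurable_EFinP.
have ig := density_integrable_self dg.
have xlnx x : (0 <= x)%R -> (-1 <= ln x * x)%R.
  by move=> x0; have := phi_ge0 x0; rewrite /phi; lra.
have neg_le1 : \int[nu]_x (fun x => (ln (g x))%:E)^\- x <= 1.
  rewrite (density_integral dg)//; last exact: measurable_funeneg.
  apply: (@le_trans _ _ (\int[alpha]_x (cst 1 x))); last first.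
    by rewrite integral_cst// [X in _ * X](_ : _ = 1) ?mule1//; exact: probability_setT.
  apply: ge0_le_integral => //.
  - by move=> x _; rewrite mule_ge0// lee_fin.
  - by apply: emeasurable_funM; [exact: measurable_funeneg|exact/measurable_EFinP].
  - move=> x _; rewrite funenegE maxe_pMl ?lee_fin// mul0e -EFinN -EFinM.
    by rewrite ge_max !lee_fin ler01 andbT mulNr lerNl; exact: xlnx.
rewrite integralE => hlt.
have pos_lty : \int[nu]_x (fun x => (ln (g x))%:E)^\+ x < +oo.
  rewrite ltNge leye_eq; apply/negP => /eqP h; move: hlt; rewrite h.
  have : \int[nu]_x (fun x => (ln (g x))%:E)^\- x \is a fin_num.
    rewrite ge0_fin_numE; first by rewrite (le_lt_trans neg_le1)// ltry.
    by apply: integral_ge0.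
  by move=> /fineK <-.
move: pos_lty; rewrite (density_integral dg)//; last exact: measurable_funepos.
move=> pos_lty.
apply: (@le_lt_trans _ _ (\int[alpha]_x ((fun x => (ln (g x))%:E)^\+ x * (g x)%:E + 1))).
  apply: ge0_le_integral => //.
  - by move=> x _; rewrite lee_fin phi_ge0.
  - by apply/measurable_EFinP; exact: measurable_phi.
  - apply: emeasurable_funD => //.
    by apply: emeasurable_funM; [exact: measurable_funepos|exact/measurable_EFinP].
  - move=> x _; rewrite funeposE maxe_pMl ?lee_fin// mul0e -EFinM.
    rewrite /phi; have := g0 x => gx0.
    apply: (@le_trans _ _ ((ln (g x) * g x)%:E + 1)).
      by rewrite -EFinD lee_fin; lra.
    by rewrite leeD2r// le_max lexx.
rewrite ge0_integralD//.
- rewrite integral_cst// [X in 1 * X](_ : _ = 1) ?mule1//; last exact: probability_setT.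
  by rewrite lte_add_pinfty// ltry.
- by move=> x _; rewrite mule_ge0// lee_fin.
- by apply: emeasurable_funM; [exact: measurable_funepos|exact/measurable_EFinP].
Qed.

Lemma density_gt0 nu g : density nu g -> nu [set x | g x = 0%R] = 0.
Proof.
move=> [mg g0 ->]; last by rewrite -[X in measurable X]setTI; exact: (mg measurableT _ (measurable_set1 0)).
rewrite (eq_integral (cst 0)); first by rewrite integral0.
by move=> x; rewrite inE/= => ->.
Qed.

End densities.

(** * L1 geometry of the entropy *)

Section density_geometry.
Context d (T : measurableType d) (R : realType).
Variable alpha : probability T R.
Implicit Types (nu : probability T R) (f g : T -> R).
Local Open Scope ereal_scope.
Local Notation Int f := (\int[alpha]_x (f x)%:E).

Lemma Int_linear (a b : R) f g : (0 <= a)%R -> (0 <= b)%R ->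
  measurable_fun setT f -> measurable_fun setT g ->
  (forall x, 0 <= f x)%R -> (forall x, 0 <= g x)%R ->
  \int[alpha]_x (a * f x + b * g x)%:E = a%:E * Int f + b%:E * Int g.
Proof.
move=> a0 b0 mf mg f0 g0.
under eq_integral do rewrite EFinD !EFinM.
have mf' : measurable_fun setT (EFin \o f) by exact/measurable_EFinP.
have mg' : measurable_fun setT (EFin \o g) by exact/measurable_EFinP.
rewrite ge0_integralD//.
- rewrite !ge0_integralZl_EFin//.
  + by move=> x _; rewrite lee_fin.
  + by move=> x _; rewrite lee_fin.
- by move=> x _; rewrite -EFinM lee_fin mulr_ge0.
- exact: emeasurable_funM.
- by move=> x _; rewrite -EFinM lee_fin mulr_ge0.
- exact: emeasurable_funM.
Qed.

Lemma le_Int f g : measurable_fun setT f -> measurable_fun setT g ->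
  (forall x, 0 <= f x)%R -> (forall x, f x <= g x)%R -> Int f <= Int g.
Proof.
move=> mf mg f0 fg; apply: ge0_le_integral => //.
- by move=> x _; rewrite lee_fin.
- exact/measurable_EFinP.
- exact/measurable_EFinP.
- by move=> x _; rewrite lee_fin.
Qed.

Lemma measurable_dist f g : measurable_fun setT f -> measurable_fun setT g ->
  measurable_fun setT (fun x => `|f x - g x|%R).
Proof.
by move=> mf mg; apply: measurableT_comp => //; exact: measurable_funB.
Qed.

(** Csiszar's parallelogram argument: two densities of entropy close to the
   infimum, whose midpoint cannot do better than the infimum, are close in L1.
   The bound is dist_le_phi_gap integrated against alpha. *)
Lemma entropy_gap nu1 nu2 g1 g2 (a b c s : R) :
  density alpha nu1 g1 -> density alpha nu2 g2 -> (0 < s)%R ->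
  entropy alpha g1 <= a%:E -> entropy alpha g2 <= b%:E ->
  c%:E <= entropy alpha (fun x => (g1 x + g2 x) / 2)%R ->
  \int[alpha]_x `|g1 x - g2 x|%:E <= (12 / s * ((a + b) / 2 - c) + s / 2)%:E.
Proof.
move=> d1 d2 s0 e1 e2 e12.
have [m1 p1 _] := d1; have [m2 p2 _] := d2.
have md := measurable_dist m1 m2.
pose K : R := (12 / s)%R; have K0 : (0 < K)%R by rewrite divr_gt0.
pose m := (fun x => (g1 x + g2 x) / 2)%R.
have m0 x : (0 <= m x)%R by rewrite divr_ge0// addr_ge0.
have mm : measurable_fun setT m.
  by apply: measurable_funM => //; exact: measurable_funD.
have cm : (0 <= s / 4)%R by rewrite divr_ge0// ltW.
have ck : (0 <= K / 2)%R by rewrite divr_ge0// ltW.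
have ineq : \int[alpha]_x (1 * `|g1 x - g2 x| + K * phi (m x))%:E <=
  \int[alpha]_x (1 * (K / 2 * phi (g1 x) + K / 2 * phi (g2 x)) +
    1 * (s / 4 * g1 x + s / 4 * g2 x))%:E.
  apply: le_Int.
  - apply: measurable_funD; apply: measurable_funM => //; exact: measurable_phi.
  - have mp1 := measurable_phi m1; have mp2 := measurable_phi m2.
    by apply: measurable_funD; apply: measurable_funM => //;
      apply: measurable_funD; apply: measurable_funM.
  - move=> x; rewrite mul1r addr_ge0// mulr_ge0 ?(ltW K0)//; exact: phi_ge0.
  - move=> x; have := dist_le_phi_gap s0 (p1 x) (p2 x).
    by rewrite -/K -/(m x) !mul1r; lra.
have mphi1 := measurable_phi m1; have mphi2 := measurable_phi m2.
have mA : measurable_fun setT (fun x => K / 2 * phi (g1 x) + K / 2 * phi (g2 x))%R.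
  by apply: measurable_funD; apply: measurable_funM.
have mB : measurable_fun setT (fun x => s / 4 * g1 x + s / 4 * g2 x)%R.
  by apply: measurable_funD; apply: measurable_funM.
have A0 x : (0 <= K / 2 * phi (g1 x) + K / 2 * phi (g2 x))%R.
  by rewrite addr_ge0// mulr_ge0// phi_ge0.
have B0 x : (0 <= s / 4 * g1 x + s / 4 * g2 x)%R.
  by rewrite addr_ge0// mulr_ge0.
move: ineq; rewrite (Int_linear ler01 (ltW K0) md (measurable_phi mm))//; last first.
  by move=> x; exact: phi_ge0.
rewrite (Int_linear ler01 ler01 mA mB A0 B0).
rewrite (Int_linear ck ck mphi1 mphi2 (fun x => phi_ge0 (p1 x)) (fun x => phi_ge0 (p2 x))).
rewrite (Int_linear cm cm m1 m2 p1 p2).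
rewrite !mul1e (density_mass d1) (density_mass d2) !mule1 -EFinD.
set X := \int[_]_x _ => h.
have : X + K%:E * c%:E <= (K / 2 * a + K / 2 * b + (s / 4 + s / 4))%:E.
  apply: (@le_trans _ _ (X + K%:E * entropy alpha m)).
    by rewrite leeD2l// lee_pmul2l.
  apply: (le_trans h); rewrite !EFinD !EFinM; apply: leeD => //; apply: leeD.
  - by rewrite lee_wpmul2l ?lee_fin.
  - by rewrite lee_wpmul2l ?lee_fin.
rewrite -EFinM -leeBrDr// -EFinB => /le_trans; apply.
by rewrite lee_fin /K; lra.
Qed.

Lemma fatou_cvg (F : nat -> T -> R) f (b : R) :
  (forall n, measurable_fun setT (F n)) -> (forall n x, 0 <= F n x)%R ->
  (forall x, F n x @[n --> \oo] --> f x) ->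
  (forall e, (0 < e)%R -> exists N, forall n, (N <= n)%N -> Int (F n) <= (b + e)%:E) ->
  Int f <= b%:E.
Proof.
move=> mF F0 Ff bF; apply/lee_addgt0Pr => e e0.
have [N hN] := bF _ e0.
rewrite (eq_integral (fun x => limn_einf (fun n => (F (n + N)%N x)%:E))); last first.
  move=> x _; apply/esym; apply: (cvg_limn_einf_sup _).1.
  apply: cvg_EFin; first by near=> n.
  rewrite (_ : fine \o _ = fun n => F (n + N)%N x); last exact/funext.
  by rewrite (cvg_shiftn N (fun n => F n x)).
apply: le_trans (fatou _ _ _ _) _ => //.
- by move=> n; apply/measurable_EFinP.
- by move=> n x _; rewrite lee_fin.
rewrite limn_einf_lim; apply: lime_le; first exact: is_cvg_einfs.
apply: nearW => n; rewrite /einfs /=.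
apply: (@le_trans _ _ (Int (F (n + N)%N))); last by apply: hN; rewrite leq_addl.
by apply: ereal_inf_lbound; exists n => /=.
Unshelve. all: by end_near. Qed.

(** Continuity of phi on [0, +oo[; at 0 the bound
   |x ln x| <= 2 * sqrt x + x^2 is used. *)
Lemma phi_cvg (u : nat -> R) (l : R) : (forall n, 0 <= u n)%R ->
  u n @[n --> \oo] --> l -> phi (u n) @[n --> \oo] --> phi l.
Proof.
move=> u0 ul.
have l0 : (0 <= l)%R.
  by rewrite -(cvg_lim _ ul)//; apply: limr_ge; [apply/cvg_ex; exists l|exact: nearW].
have xlnx : (u n * ln (u n))%R @[n --> \oo] --> (l * ln l)%R.
  move: l0; rewrite le_eqVlt => /orP[/eqP l0|l0]; last first.
    by apply: cvgM => //; apply: continuous_cvg => //; exact: continuous_ln.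
  rewrite -l0 mul0r in ul *; apply/norm_cvg0P.
  have ub n : (`|u n * ln (u n)| <= 2 * Num.sqrt (u n) + u n ^+ 2)%R.
    have := u0 n; rewrite le_eqVlt => /orP[/eqP <-|un0].
      by rewrite mul0r normr0 sqrtr0 mulr0 expr0n/= addr0.
    set x := u n; set s := Num.sqrt x.
    have s0 : (0 < s)%R by rewrite sqrtr_gt0.
    have xE : x = (s ^+ 2)%R by rewrite sqr_sqrtr// ltW.
    have lnx : (ln x = 2 * ln s)%R by rewrite xE lnXn// mulr_natl.
    have h1 : (ln x <= x - 1)%R.
      have := @le_ln1Dx _ (x - 1)%R; rewrite subrKC; apply.
      by rewrite ltrBDr addNr.
    have h2 : (1 - s^-1 <= ln s)%R.
      have := @le_ln1Dx _ (s^-1 - 1)%R; rewrite subrKC lnV ?posrE// => h.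
      have : (- 1 < s^-1 - 1)%R by rewrite ltrBDr addNr invr_gt0.
      by move=> /h; lra.
    have h3 : (x - s <= x * ln s)%R.
      have -> : (x - s = x * (1 - s^-1))%R by rewrite xE; field; rewrite gt_eqF.
      by rewrite ler_pM2l.
    rewrite ler_norml; apply/andP; split.
      by rewrite lnx mulrCA; have : (0 < x)%R by []; have := sqr_ge0 x; lra.
    have : (x * ln x <= x * (x - 1))%R by rewrite ler_pM2l.
    by have : (0 < x)%R by []; lra.
  apply: (@squeeze_cvgr _ _ _ _ (cst 0%R) (fun n => 2 * Num.sqrt (u n) + u n ^+ 2)%R).
  - by apply: nearW => n; rewrite /= normr_ge0 ub.
  - exact: cvg_cst.
  - rewrite [X in _ --> X](_ : _ = 2 * Num.sqrt 0 + 0 ^+ 2 :> R)%R; last first.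
      by rewrite sqrtr0 mulr0 expr0n/= addr0.
    apply: cvgD.
      by apply: cvgMr; apply: continuous_cvg => //; exact: sqrt_continuous.
    by apply: cvgM.
rewrite /phi; apply: cvgD; last exact: cvg_cst.
by apply: cvgB.
Qed.

Lemma density_bounded_integrable nu g f (a : R) : density alpha nu g ->
  measurable_fun setT f -> (forall x, `|f x| <= a)%R ->
  alpha.-integrable setT (fun x => (f x * g x)%:E).
Proof.
move=> dg mf fa; have [mg g0 _] := dg.
apply: (@le_integrable _ _ _ _ _ measurableT _ (fun x => a%:E * (g x)%:E)).
- by apply/measurable_EFinP; exact: measurable_funM.
- move=> x _; rewrite -EFinM !abse_EFin lee_fin !normrM ler_wpM2r//.
  exact: le_trans (fa x) (ler_norm _).
- apply: integrableZl => //; exact: density_integrable_self dg.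
Qed.

(** The L1 distance of the densities controls the integrals of bounded
   functions. *)
Lemma density_test nu1 nu2 g1 g2 f (a e : R) :
  density alpha nu1 g1 -> density alpha nu2 g2 ->
  measurable_fun setT f -> (forall x, `|f x| <= a)%R ->
  \int[alpha]_x `|g1 x - g2 x|%:E <= e%:E ->
  (`|\int[nu1]_x f x - \int[nu2]_x f x| <= a * e)%R.
Proof.
move=> d1 d2 mf fa e12.
have [m1 p1 _] := d1; have [m2 p2 _] := d2.
have i1 := density_bounded_integrable d1 mf fa.
have i2 := density_bounded_integrable d2 mf fa.
have [_ E1] := density_integrable d1 mf i1.
have [_ E2] := density_integrable d2 mf i2.
have a0 : (0 <= a)%R by apply: le_trans (fa point).
have ib : alpha.-integrable setT (EFin \o (fun x => f x * g1 x - f x * g2 x)%R).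
  rewrite (_ : _ \o _ = (fun x => (f x * g1 x)%:E) \- (fun x => (f x * g2 x)%:E)).
    exact: integrableB.
  by apply/funext => x /=; rewrite EFinB.
rewrite /Rintegral E1 E2.
rewrite -[X in (`|X| <= _)%R]/(\int[alpha]_x (f x * g1 x)%R - \int[alpha]_x (f x * g2 x)%R)%R.
rewrite -RintegralB//; apply: (le_trans (le_normr_Rintegral _ _)) => //.
rewrite -lee_fin /Rintegral fineK; last first.
  apply: integrable_fin_num => //.
  exact: (integrable_norm ib).
apply: (@le_trans _ _ (\int[alpha]_x (a%:E * `|g1 x - g2 x|%:E))).
  apply: ge0_le_integral => //.
  - apply/measurable_EFinP; apply: measurableT_comp => //.
    by apply: measurable_funB; apply: measurable_funM.
  - apply: emeasurable_funM => //; apply/measurable_EFinP.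
    exact: measurable_dist.
  - by move=> x _; rewrite -EFinM lee_fin -mulrBr normrM ler_wpM2r.
rewrite ge0_integralZl_EFin//.
- by rewrite EFinM lee_wpmul2l ?lee_fin.
- by apply/measurable_EFinP; exact: measurable_dist.
Qed.

Lemma Int_triangle f g (h : T -> R) (a b : R) :
  measurable_fun setT f -> measurable_fun setT g -> measurable_fun setT h ->
  \int[alpha]_x `|f x - g x|%:E <= a%:E -> \int[alpha]_x `|g x - h x|%:E <= b%:E ->
  \int[alpha]_x `|f x - h x|%:E <= (a + b)%:E.
Proof.
move=> mf mg mh fa gb; have mfg := measurable_dist mf mg; have mgh := measurable_dist mg mh.
apply: (@le_trans _ _ (\int[alpha]_x (1 * `|f x - g x| + 1 * `|g x - h x|)%:E)).
  apply: le_Int => //; first exact: measurable_dist.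
    by apply: measurable_funD; apply: measurable_funM.
  by move=> x; rewrite !mul1r; exact: ler_distD.
by rewrite Int_linear// !mul1e EFinD leeD.
Qed.

Section completeness.
Variables (nu : nat -> probability T R) (g : nat -> T -> R).
Hypothesis dg : forall j, density alpha (nu j) (g j).
Hypothesis g_fast : forall j,
  \int[alpha]_x `|g j x - g j.+1 x|%:E <= (2^-1 ^+ j)%:E.

Let mg j : measurable_fun setT (g j). Proof. by have [] := dg j. Qed.
Let g0 j x : (0 <= g j x)%R. Proof. by have [_ /(_ x)] := dg j. Qed.

Let g_dist j m : \int[alpha]_x `|g j x - g (j + m)%N x|%:E <=
  (2 * 2^-1 ^+ j * (1 - 2^-1 ^+ m))%:E.
Proof.
elim: m => [|m IH].
  rewrite addn0 expr0 subrr mulr0 (eq_integral (cst 0)) ?integral0//.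
  by move=> x _; rewrite subrr normr0.
have := Int_triangle (mg j) (mg (j + m)) (mg (j + m).+1) IH (g_fast (j + m)).
rewrite addnS => /le_trans; apply; rewrite lee_fin exprD exprS le_eqVlt.
by apply/orP; left; apply/eqP; field.
Qed.

Let g_dist2 j m : (j <= m)%N ->
  \int[alpha]_x `|g j x - g m x|%:E <= (2 * 2^-1 ^+ j)%:E.
Proof.
move=> jm; rewrite -(subnKC jm); apply: le_trans (g_dist _ _) _.
rewrite lee_fin ler_piMr ?mulr_ge0 ?exprn_ge0// gerBl exprn_ge0//.
Qed.

Let G x := \sum_(0 <= j <oo) `|g j x - g j.+1 x|%:E.

Let mG : measurable_fun setT G.
Proof.
apply: ge0_emeasurable_sum => // j _; apply/measurable_EFinP.
exact: measurable_dist.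
Qed.

Let G_ae : \forall x \ae alpha, G x < +oo.
Proof.
have G0 x : 0 <= G x by apply: nneseries_ge0 => j _ _; rewrite lee_fin.
have iG : alpha.-integrable setT G.
  apply/integrableP; split => //.
  rewrite (eq_integral G); last by move=> x _; rewrite gee0_abs.
  rewrite /G integral_nneseries//; last first.
    by move=> j; apply/measurable_EFinP; exact: measurable_dist.
  apply: (@le_lt_trans _ _ (\sum_(0 <= j <oo) (2^-1 ^+ j)%:E)).
    by apply: lee_nneseries => [j _ _|j _]; [apply: integral_ge0|exact: g_fast].
  have h := @cvg_geometric_series R 1 2^-1.
  have : (`|2^-1| < 1 :> R)%R by rewrite ger0_norm ?invr_ge0// invf_lt1// ltr1n.
  move=> /h hc.
  rewrite (_ : limn _ = (1 / (1 - 2^-1))%:E); first by rewrite ltry.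
  apply/cvg_lim => //; apply: cvg_EFin; first by apply: nearW => n; rewrite sumEFin.
  apply: cvg_trans hc; apply: near_eq_cvg; apply: nearW => n.
  rewrite /= sumEFin/= /series/=; apply: eq_bigr => i _.
  by rewrite /geometric/= mul1r.
have := integrable_ae measurableT iG; apply: filterS => x /(_ I).
by rewrite ge0_fin_numE.
Qed.

Let A := [set x | G x < +oo].

Let mA : measurable A.
Proof.
rewrite (_ : A = setT `&` [set x | G x < +oo]); last by rewrite setTI.
exact: emeasurable_fun_infty_o.
Qed.

(* truncated to the set where the telescoping series converges, so that the
   limit exists at every point *)
Let u j x : R := (\1_A x * g j x)%R.

Let mu j : measurable_fun setT (u j).
Proof. by apply: measurable_funM => //. Qed.

Let u0 j x : (0 <= u j x)%R. Proof. by rewrite /u mulr_ge0. Qed.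

Let u_cvg x : cvgn (fun j => u j x).
Proof.
have [Ax|nAx] := pselect (A x); last first.
  rewrite /u indicE memNset//; under eq_fun do rewrite mul0r.
  exact: is_cvg_cst.
apply: is_cvgM; first exact: is_cvg_cst.
rewrite (_ : (fun j => g j x) =
    (fun n => g 0%N x + series (telescope (fun j => g j x)) n)%R); last first.
  by apply/funext => n; exact: eq_sum_telescope (fun j => g j x) n.
apply: is_cvgD; first exact: is_cvg_cst.
apply: normed_cvg; apply: nondecreasing_is_cvgn; first by apply: nondecreasing_series => j _ _; exact: normr_ge0.
exists (fine (G x)) => _ [n _ <-].
rewrite -lee_fin fineK; last first.
  by rewrite ge0_fin_numE//; apply: nneseries_ge0 => j _ _; rewrite lee_fin.
apply: le_trans (nneseries_lim_ge n _); last by move=> j _ _; rewrite lee_fin.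
rewrite /series/= -sumEFin; apply: lee_sum => j _.
by rewrite lee_fin /telescope/= distrC.
Qed.

Let ginf x := limn (fun j => u j x).

Let mginf : measurable_fun setT ginf.
Proof.
by apply: (measurable_fun_cvg mu) => x _; exact: u_cvg.
Qed.

Let ginf0 x : (0 <= ginf x)%R.
Proof. by apply: limr_ge; [exact: u_cvg|exact: nearW]. Qed.

Let u_ae (f : R -> R -> R) (h : T -> R) j :
  \forall x \ae alpha, f (u j x) (h x) = f (g j x) (h x).
Proof.
apply: filterS G_ae => x Gx.
by rewrite /u indicE mem_set// mul1r.
Qed.

Let ginf_dist j : \int[alpha]_x `|g j x - ginf x|%:E <= (2 * 2^-1 ^+ j)%:E.
Proof.
rewrite (@ae_eq_integral _ _ _ alpha setT (fun x => `|u j x - ginf x|%:E))//; last 3 first.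
- by apply/measurable_EFinP; exact: measurable_dist.
- by apply/measurable_EFinP; exact: measurable_dist.
- apply: filterS (u_ae (fun a b => `|a - b|%R) ginf j) => x h _ /=.
  by rewrite h.
apply: (@fatou_cvg (fun n x => `|u j x - u n x|%R)).
- by move=> n; exact: measurable_dist.
- by move=> n x.
- by move=> x; apply: cvg_norm; apply: cvgB; [exact: cvg_cst|exact: u_cvg].
- move=> e e0; exists j => n jn.
  apply: (@le_trans _ _ (\int[alpha]_x `|g j x - g n x|%:E)).
    apply: le_Int => //; try exact: measurable_dist.
    move=> x; rewrite /u -mulrBr normrM ler_piMl// indicE.
    by case: (x \in A); rewrite ?normr1 ?normr0.
  by apply: le_trans (g_dist2 jn) _; rewrite lee_fin lerDl ltW.
Qed.

Let small (e : R) : (0 < e)%R -> exists j, (2 * 2^-1 ^+ j <= e)%R.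
Proof.
move=> e0; have := @cvg_geometric R 2 2^-1.
have : (`|2^-1| < 1 :> R)%R by rewrite ger0_norm ?invr_ge0// invf_lt1// ltr1n.
move=> + h => /h /cvgr_dist_le /(_ e e0) [N _ hN].
exists N; have /= := hN N (leqnn _).
by rewrite sub0r normrN /geometric/= ger0_norm// mulr_ge0// exprn_ge0.
Qed.

Let ginf_mass : \int[alpha]_x (ginf x)%:E = 1.
Proof.
apply/eqP; rewrite eq_le; apply/andP; split; apply/lee_addgt0Pr => e /small[j je].
  apply: (@le_trans _ _ (\int[alpha]_x (1 * g j x + 1 * `|g j x - ginf x|)%:E)).
    apply: le_Int => //.
      by apply: measurable_funD; apply: measurable_funM => //; exact: measurable_dist.
    by move=> x; rewrite !mul1r -lerBlDl distrC ler_norm.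
  rewrite Int_linear//; last exact: measurable_dist.
  rewrite !mul1e (density_mass (dg j)) leeD2l//.
  by apply: le_trans (ginf_dist j) _; rewrite lee_fin.
apply: (@le_trans _ _ (\int[alpha]_x (1 * ginf x + 1 * `|g j x - ginf x|)%:E)).
  rewrite -(density_mass (dg j)); apply: le_Int => //.
    by apply: measurable_funD; apply: measurable_funM => //; exact: measurable_dist.
  by move=> x; rewrite !mul1r -lerBlDl ler_norm.
rewrite Int_linear//; last exact: measurable_dist.
rewrite !mul1e leeD2l//.
by apply: le_trans (ginf_dist j) _; rewrite lee_fin.
Qed.

(** Completeness of L1 together with lower semicontinuity of the entropy (Fatou);
   the summable rate makes the sequence converge almost everywhere without
   extraction. *)
Lemma density_complete (a : R) :
  (forall e, (0 < e)%R -> exists N, forall n, (N <= n)%N ->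
    entropy alpha (g n) <= (a + e)%:E) ->
  exists nuoo goo, [/\ density alpha nuoo goo, entropy alpha goo <= a%:E &
    forall j, \int[alpha]_x `|g j x - goo x|%:E <= (2 * 2^-1 ^+ j)%:E].
Proof.
move=> ha; have [nuoo dnu] := probability_of_density mginf ginf0 ginf_mass.
exists nuoo, ginf; split => //.
apply: (@fatou_cvg (fun n x => phi (u n x))).
- by move=> n; exact: measurable_phi.
- by move=> n x; exact: phi_ge0.
- by move=> x; apply: phi_cvg => //; exact: u_cvg.
- move=> e /ha[N hN]; exists N => n /hN; rewrite /entropy.
  rewrite (@ae_eq_integral _ _ _ alpha setT (fun x => (phi (u n x))%:E))//.
  + by apply/measurable_EFinP; exact: measurable_phi.
  + by apply/measurable_EFinP; exact: measurable_phi.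
  + by apply: filterS (u_ae (fun a b => phi a) ginf n) => x h _; rewrite h.
Qed.

End completeness.

End density_geometry.

(** * Bounded integrals and Borel sets of a metric space *)

Section bounded_integrals.
Context d (T : measurableType d) (R : realType).
Implicit Types (P : probability T R) (f g : T -> R).

Lemma normr_indic_le1 (A : set T) x : `|\1_A x : R| <= 1.
Proof. by rewrite indicE; case: (_ \in _); rewrite ?normr1 ?normr0 ?ler01. Qed.

Lemma bounded_integrable P f (a : R) : measurable_fun setT f ->
  (forall x, `|f x| <= a) -> P.-integrable setT (EFin \o f).
Proof.
move=> mf fa; apply: measurable_bounded_integrable => //.
  by rewrite [X in (X < _)%E](_ : _ = 1%E) ?ltry//; exact: probability_setT.
exists a; split; first by rewrite num_real.
by move=> M aM x _ /=; apply: le_trans (fa x) (ltW aM).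
Qed.

Lemma Rintegral_cst1 P (a : R) : \int[P]_x a = a.
Proof.
rewrite Rintegral_cst// [X in fine X](_ : _ = 1%E) ?mulr1//.
exact: probability_setT.
Qed.

Lemma le_Rintegral_bounded P f g (a b : R) :
  measurable_fun setT f -> measurable_fun setT g ->
  (forall x, `|f x| <= a) -> (forall x, `|g x| <= b) ->
  (forall x, f x <= g x) -> \int[P]_x f x <= \int[P]_x g x.
Proof.
move=> mf mg fa gb fg; apply: le_Rintegral => //.
- exact: bounded_integrable fa.
- exact: bounded_integrable gb.
Qed.

Lemma Rintegral_le_bound P f (a : R) : measurable_fun setT f ->
  (forall x, `|f x| <= a) -> `|\int[P]_x f x| <= a.
Proof.
move=> mf fa; apply: le_trans (le_normr_Rintegral _ _) _ => //.
  exact: bounded_integrable fa.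
rewrite -[leRHS](Rintegral_cst1 P); apply: (@le_Rintegral_bounded _ _ _ a a) => //.
- exact: measurableT_comp.
- by move=> x; rewrite normr_id.
- by move=> x; rewrite ger0_norm//; exact: le_trans (fa x).
Qed.

Lemma Rintegral_indic P (A : set T) : measurable A ->
  \int[P]_x \1_A x = fine (P A).
Proof. by move=> mA; rewrite /Rintegral integral_indic// setIT. Qed.

Lemma Rintegral_affine P f (a b c : R) : measurable_fun setT f ->
  (forall x, `|f x| <= a) -> \int[P]_x (b * f x + c) = b * \int[P]_x f x + c.
Proof.
move=> mf fa; rewrite RintegralD//.
- rewrite RintegralZl//; last exact: bounded_integrable fa.
  by congr (_ + _); exact: Rintegral_cst1.
- exact: (integrableZl measurableT b (bounded_integrable P mf fa)).
- exact: (@bounded_integrable P (cst c) `|c|).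
Qed.

End bounded_integrals.

Section metric_measures.
Context (R : realType) (E : pointedMetricType R).
Implicit Types (nu : M1 E) (f : E -> R).

Lemma continuous_measurable_borel f : continuous f ->
  measurable_fun [set: borel E] (f : borel E -> R).
Proof.
move=> /continuousP cf mD.
apply: (measurability _ (RGenOpens.measurableE R)) => //.
move=> _ [_ [a [b ->] <-]]; rewrite setTI; apply: sub_sigma_algebra.
exact/cf/interval_open.
Qed.

Lemma open_borel (A : set E) : open A -> measurable (A : set (borel E)).
Proof. by move=> oA; exact: sub_sigma_algebra. Qed.

(** Written without absolute value; the symmetric bound follows by exchanging x
   and y. *)
Definition lipschitz_le (l : R) f := forall x y, f x - f y <= l * mdist x y.

Lemma lipschitz_le_norm l f x y : lipschitz_le l f ->
  `|f x - f y| <= l * mdist x y.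
Proof.
by move=> lf; rewrite ler_norml lerNl opprB {1}metric_sym !lf.
Qed.

Lemma lipschitz_continuous l f : 0 <= l -> lipschitz_le l f -> continuous f.
Proof.
move=> l0 lf x; apply/cvgrPdist_le => e e0.
have el : 0 < e / (l + 1) by rewrite divr_gt0// ltr_wpDl.
have : \forall y \near x, mdist x y < e / (l + 1).
  have := @nbhsx_ballx _ _ x _ el; apply: filterS => y.
  by rewrite -metricType_numDomainType.ball_mdistE.
apply: filterS => y xy; apply: le_trans (lipschitz_le_norm x y lf) _.
apply: (@le_trans _ _ ((l + 1) * mdist x y)).
  by apply: ler_wpM2r; rewrite ?mdist_ge0// lerDl.
by rewrite mulrC -ler_pdivlMr ?ltW// ltr_wpDl.
Qed.

Lemma lipschitz_measurable l f : 0 <= l -> lipschitz_le l f ->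
  measurable_fun [set: borel E] (f : borel E -> R).
Proof. by move=> l0 /(lipschitz_continuous l0) /continuous_measurable_borel. Qed.

Lemma open_mdist_ball (e : E) (rho : R) : open [set z | mdist e z < rho].
Proof.
rewrite (_ : [set z | _] = mdist e @^-1` [set t | t < rho])//.
apply: open_comp; last exact: open_lt.
move=> z _; apply: (@lipschitz_continuous 1) => // v w.
by rewrite mul1r lerBlDr addrC (le_trans (metric_triangle _ w v))// lerD2l metric_sym.
Qed.

Lemma measurable_mdist_ball (e : E) (rho : R) :
  measurable [set z : borel E | mdist e (z : E) < rho].
Proof. by apply: open_borel; exact: open_mdist_ball. Qed.

Lemma finite_net (rho : R) : compact [set: E] -> 0 < rho ->
  exists s : seq E, forall x, has (fun e => mdist e x < rho) s.
Proof.
move=> cE rho0.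
have : finite_subset_cover [set: E] (fun z : E => (ball z rho)°) [set: E].
  move: cE; rewrite compact_cover; apply.
  - by move=> z _; exact: open_interior.
  - by move=> z _; exists z => //; exact: nbhsx_ballx.
move=> [D _ cov]; exists (finmap.enum_fset D) => x.
have [z zD zx] := cov x I; apply/hasP; exists z => //.
by have := interior_subset zx; rewrite -metricType_numDomainType.ball_mdistE.
Qed.

(** Heine's theorem, in terms of the distance. *)
Lemma compact_uniform_continuity f (e : R) : compact [set: E] -> continuous f ->
  0 < e -> exists2 r : R, 0 < r & forall x y, mdist x y < r -> `|f x - f y| <= e.
Proof.
move=> cE cf e0.
have ncov := (compact_near_coveringP _).1 cE.
have := ncov R (0^'+) (fun r x => forall y, mdist x y < r -> `|f x - f y| <= e) _ _.
case.
  move=> x _.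
  have e2 : 0 < e / 2 by rewrite divr_gt0.
  have [r/= r0 hr] : exists2 r : R, 0 < r & forall y, mdist x y < r -> `|f x - f y| <= e / 2.
    have /cvgrPdist_le/(_ _ e2) := cf x.
    move=> /nbhs_ballP[r/= r0 hr]; exists r => // y xy; apply: hr.
    by rewrite -metricType_numDomainType.ball_mdistE.
  have r2 : 0 < r / 2 by rewrite divr_gt0.
  exists ([set y | mdist x y < r / 2], [set t | t < r / 2]).
    split => /=.
      have := @nbhsx_ballx _ _ x _ r2; apply: filterS => y.
      by rewrite -metricType_numDomainType.ball_mdistE.
    by near=> t; rewrite /=; near: t; exact: nbhs_right_lt.
  move=> [x' t]/= [xx' tr] y x'y.
  have h1 : `|f x - f x'| <= e / 2.
    by apply: hr; apply: lt_trans xx' _; rewrite ltr_pdivrMr// ltr_pMr// ltr1n.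
  have h2 : `|f x - f y| <= e / 2.
    apply: hr; apply: le_lt_trans (metric_triangle x x' y) _.
    by rewrite (splitr r) ltrD// (lt_trans x'y).
  apply: le_trans (ler_distD (f x) _ _) _.
  by rewrite (splitr e) lerD// distrC.
move=> x x0 hx.
have /filter_ex[r [r0 hr]] : \forall t \near (0:R)^'+, 0 < t /\ forall z y, mdist z y < t -> `|f z - f y| <= e.
  near=> t; split; first by near: t; exact: nbhs_right_gt.
  have : [set: E] `<=` (fun x => forall y, mdist x y < t -> `|f x - f y| <= e).
    by near: t; exists x.
  by move=> h z y; exact: (h z I).
by exists r.
Unshelve. all: by end_near. Qed.

End metric_measures.

(** * The Fortet-Mourier metric *)

Section fm_ball.
Context (R : realType) (E : pointedMetricType R).
Implicit Types (nu a b : M1 E) (f : E -> R).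

(** The unit ball of the norm sup + Lip, with real witnesses m and l for the two
   norms; see fm_ballP. *)
Definition fm_ball f := exists m l : R,
  [/\ 0 <= m, 0 <= l, m + l <= 1, (forall x, `|f x| <= m) & lipschitz_le l f].

Lemma fm_ball_measurable f : fm_ball f ->
  measurable_fun [set: borel E] (f : borel E -> R).
Proof. by move=> [m [l [_ l0 _ _ /(lipschitz_measurable l0)]]]. Qed.

Lemma fm_ball_bound f : fm_ball f -> forall x, `|f x| <= 1.
Proof. by move=> [m [l [m0 l0 ml fm _]]] x; apply: le_trans (fm x) _; lra. Qed.

Lemma fm_ball_opp f : fm_ball f -> fm_ball (fun x => - f x).
Proof.
move=> [m [l [m0 l0 ml fm fl]]]; exists m, l; split => //.
  by move=> x; rewrite normrN.
by move=> x y; rewrite opprK addrC metric_sym fl.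
Qed.

Lemma fm_ballP f : (sup_norm f + lip_norm f <= 1)%E <-> fm_ball f.
Proof.
have sup0 : (0 <= sup_norm f)%E.
  apply: (@le_trans _ _ `|f point|%:E); first by rewrite lee_fin.
  by apply: ereal_sup_ubound; exists point.
have lip0 : (0 <= lip_norm f)%E.
  apply: (@le_trans _ _ (`|f point - f point| / mdist (point : E) point)%:E).
    by rewrite lee_fin divr_ge0// mdist_ge0.
  by apply: ereal_sup_ubound; exists (point, point).
split.
  move=> h.
  have sfin : (sup_norm f < +oo)%E.
    by apply: le_lt_trans (leeDl _ lip0) _; apply: le_lt_trans h _; rewrite ltry.
  have lfin : (lip_norm f < +oo)%E.
    by apply: le_lt_trans (leeDr _ sup0) _; apply: le_lt_trans h _; rewrite ltry.
  have sE : sup_norm f = (fine (sup_norm f))%:E by rewrite fineK// ge0_fin_numE.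
  have lE : lip_norm f = (fine (lip_norm f))%:E by rewrite fineK// ge0_fin_numE.
  exists (fine (sup_norm f)), (fine (lip_norm f)); split.
  - exact: fine_ge0.
  - exact: fine_ge0.
  - by rewrite -lee_fin EFinD -sE -lE.
  - by move=> x; rewrite -lee_fin -sE; apply: ereal_sup_ubound; exists x.
  - move=> x y; apply: le_trans (ler_norm _) _.
    have [->|xy] := eqVneq x y; first by rewrite subrr normr0 mdistxx mulr0.
    rewrite -ler_pdivrMr ?mdist_gt0// -lee_fin -lE.
    by apply: ereal_sup_ubound; exists (x, y).
move=> [m [l [m0 l0 ml fm fl]]].
apply: (@le_trans _ _ (m%:E + l%:E)%E); last by rewrite -EFinD lee_fin.
apply: leeD; apply: ge_ereal_sup => _ [x _ <-]; rewrite lee_fin//.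
have [->|xy] := eqVneq x.1 x.2; first by rewrite subrr normr0 mul0r.
by rewrite ler_pdivrMr ?mdist_gt0//; exact: lipschitz_le_norm.
Qed.

(** Fortet-Mourier distance at most r, without the supremum; see
   fortet_mourier_le. *)
Definition fm_close (r : R) a nu :=
  forall f, fm_ball f -> `|\int[a]_x f x - \int[nu]_x f x| <= r.

Lemma fm_close_trans r s a b nu : fm_close r a b -> fm_close s b nu ->
  fm_close (r + s) a nu.
Proof.
move=> ab bn f fb; apply: le_trans (ler_distD (\int[b]_x f x) _ _) _.
by rewrite lerD// ?ab// bn.
Qed.

Let S a b := [set \int[a]_x f x - \int[b]_x f x
      | f in [set f : E -> R | (sup_norm f + lip_norm f <= 1)%E]].

Let S0 a b : S a b 0.
Proof.
exists (cst 0); last by rewrite !Rintegral_cst1 subrr.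
apply/fm_ballP; exists 0, 0; split; rewrite ?addr0//.
  by move=> x; rewrite normr0.
by move=> x y; rewrite subrr mul0r.
Qed.

Let S_ub a b : has_ubound (S a b).
Proof.
exists 2 => _ [f /fm_ballP fb <-].
have := Rintegral_le_bound a (fm_ball_measurable fb) (fm_ball_bound fb).
have := Rintegral_le_bound b (fm_ball_measurable fb) (fm_ball_bound fb).
by rewrite !ler_norml => /andP[? ?] /andP[? ?]; lra.
Qed.

Lemma RintegralN f nu : fm_ball f -> \int[nu]_x (- f x) = - \int[nu]_x f x.
Proof.
move=> fb; have := Rintegral_affine nu (-1) 0 (fm_ball_measurable fb) (fm_ball_bound fb).
by rewrite mulN1r addr0 => <-; apply: eq_Rintegral => x _; rewrite mulN1r addr0.
Qed.

Lemma fortet_mourier_le r a b : fortet_mourier_dist a b <= r <-> fm_close r a b.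
Proof.
split => [h f fb|h].
  rewrite ler_norml; apply/andP; split.
    rewrite lerNl opprB; apply: le_trans h.
    apply: ub_le_sup; first exact: S_ub.
    exists (fun x => - f x); first exact/fm_ballP/fm_ball_opp.
    by rewrite !RintegralN// opprK addrC.
  apply: le_trans h; apply: ub_le_sup; first exact: S_ub.
  by exists f => //; exact/fm_ballP.
apply: ge_sup; first by exists 0; exact: S0.
move=> _ [f /fm_ballP fb <-].
by apply: le_trans (ler_norm _) (h f fb).
Qed.

Lemma fortet_mourier_gt r a b : r < fortet_mourier_dist a b ->
  exists2 f, fm_ball f & r < \int[a]_x f x - \int[b]_x f x.
Proof.
move=> /sup_gt -[|_ [f /fm_ballP fb <-] rf]; last by exists f.
by exists 0; exact: S0.
Qed.

End fm_ball.

Section narrow_closed.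
Context (R : realType) (E : pointedMetricType R).
Hypothesis cE : compact [set: E].
Implicit Types (nu a b : M1 E) (f : E -> R).

Lemma continuous_compact_bounded f : continuous f ->
  exists2 M : R, 0 < M & forall x, `|f x| <= M.
Proof.
move=> cf.
have [r r0 hr] := compact_uniform_continuity cE cf (ltr01 : (0:R) < 1).
have [s hs] := finite_net cE r0.
exists (1 + \sum_(e <- s) `|f e|).
  by rewrite ltr_pwDl// sumr_ge0.
move=> x; have /hasP[e es xe] := hs x.
have := hr _ _ xe.
move=> h; rewrite -[f x](subKr (f e)); apply: le_trans (ler_normB _ _) _.
by rewrite addrC lerD// (big_rem e)//= lerDl sumr_ge0.
Qed.

(** The approximation is the infimal convolution of f with l * d, where
   l = 2 * M / r beats the oscillation of f outside balls of radius r. *)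
Lemma lipschitz_approx f (e : R) : continuous f -> 0 < e ->
  exists (g : E -> R) (l : R), [/\ 0 <= l, lipschitz_le l g & forall x, `|f x - g x| <= e].
Proof.
move=> cf e0.
have [M M0 fM] := continuous_compact_bounded cf.
have [r r0 hr] := compact_uniform_continuity cE cf e0.
pose l := 2 * M / r.
have l0 : 0 <= l by rewrite divr_ge0 ?(ltW r0)// mulr_ge0// ltW.
have fl x y : f x - e <= f y + l * mdist x y.
  have [xy|xy] := ltP (mdist x y) r.
    have := hr _ _ xy; rewrite ler_norml => /andP[_ h].
    have : 0 <= l * mdist x y by rewrite mulr_ge0// mdist_ge0.
    lra.
  have : l * r <= l * mdist x y by exact: ler_wpM2l.
  rewrite /l mulfVK ?gt_eqF//.
  have := fM x; have := fM y; rewrite !ler_norml => /andP[? ?] /andP[? ?]; lra.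
pose S x := [set f y + l * mdist x y | y in [set: E]].
have S_lb x : has_lbound (S x).
  by exists (f x - e) => _ [y _ <-]; exact: fl.
have S_ne x : S x !=set0 by exists (f x + l * mdist x x); exists x.
pose g x := inf (S x).
exists g, l; split => //.
  move=> x y; rewrite lerBlDr addrC -lerBlDr.
  apply: lb_le_inf => // _ [z _ <-].
  rewrite lerBlDr.
  apply: (@le_trans _ _ (f z + l * mdist x z)).
    by apply: ge_inf => //; exists z.
  rewrite -addrA lerD2l -mulrDr ler_wpM2l// addrC.
  exact: metric_triangle.
move=> x; rewrite ler_norml; apply/andP; split.
  have : g x <= f x by apply: ge_inf => //; exists x => //; rewrite mdistxx mulr0 addr0.
  by move=> ?; have := e0; lra.
have : f x - e <= g x by apply: lb_le_inf => // _ [y _ <-]; exact: fl.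
by lra.
Qed.

Lemma fm_close_scaled g m l r a b : 0 < m -> 0 <= l -> (forall x, `|g x| <= m) ->
  lipschitz_le l g -> fm_close r a b ->
  `|\int[a]_x g x - \int[b]_x g x| <= (m + l) * r.
Proof.
move=> m0 l0 gm gl ab.
have ml : 0 < m + l by rewrite ltr_pwDl.
have mg := lipschitz_measurable l0 gl.
have fb : fm_ball (fun x => (m + l)^-1 * g x).
  exists (m / (m + l)), (l / (m + l)); split.
  - by rewrite divr_ge0// ltW.
  - by rewrite divr_ge0// ltW.
  - by rewrite -mulrDl divff// gt_eqF.
  - move=> x; rewrite normrM ger0_norm ?invr_ge0 ?(ltW ml)// mulrC.
    by rewrite ler_wpM2r// invr_ge0 ltW.
  - move=> x y; rewrite -mulrBr (mulrC l) -mulrA ler_wpM2l//.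
    by rewrite invr_ge0 ltW.
have := ab _ fb.
have scaled nu : \int[nu]_x ((m + l)^-1 * g x) = (m + l)^-1 * \int[nu]_x g x.
  rewrite -[RHS]addr0 -(Rintegral_affine nu _ 0 mg gm).
  by apply: eq_Rintegral => x _; rewrite addr0.
by rewrite !scaled -mulrBr normrM gtr0_norm ?invr_gt0// ler_pdivrMl.
Qed.

(** On a compact space the Fortet-Mourier metric controls every continuous test
   function, hence is at least as fine as the narrow topology. *)
Lemma fm_close_test f (e : R) : continuous f -> 0 < e ->
  exists2 r : R, 0 < r &
    forall a b, fm_close r a b -> `|\int[a]_x f x - \int[b]_x f x| <= e.
Proof.
move=> cf e0.
have e3 : 0 < e / 3 by rewrite divr_gt0.
have [g [l [l0 gl fg]]] := lipschitz_approx cf e3.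
have [m m0 gm] := continuous_compact_bounded (lipschitz_continuous l0 gl).
have [M M0 fM] := continuous_compact_bounded cf.
have mg := lipschitz_measurable l0 gl.
have mf := continuous_measurable_borel cf.
have ml : 0 < m + l by rewrite ltr_pwDl.
exists (e / 3 / (m + l)); first by rewrite divr_gt0.
move=> a b /(fm_close_scaled m0 l0 gm gl).
rewrite mulrC mulfVK ?gt_eqF// => gab.
have approx nu : `|\int[nu]_x f x - \int[nu]_x g x| <= e / 3.
  rewrite -RintegralB//.
  - by apply: Rintegral_le_bound => //; exact: measurable_funB.
  - exact: (bounded_integrable nu mf fM).
  - exact: (bounded_integrable nu mg gm).
have := approx a; have := approx b; move: gab.
by rewrite !ler_norml => /andP[? ?] /andP[? ?] /andP[? ?]; apply/andP; split; lra.
Qed.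

(** A narrowly closed set is closed for the Fortet-Mourier metric: a basic narrow
   neighbourhood of nu constrains finitely many continuous integrals. *)
Lemma narrow_closed_fm (C : set (M1 E)) nu : closed C ->
  (forall r, 0 < r -> exists2 a, C a & fm_close r a nu) -> C nu.
Proof.
move=> closedC h; apply: contrapT => nCnu.
have oC : open (~` C) by exact: closed_openC.
move: oC => [I' sI' CE].
have : (~` C) nu by [].
rewrite -CE => -[B I'B Bnu].
have BC : B `<=` ~` C by rewrite -CE; exact: bigcup_sup.
have [D sD BE] := sI' _ I'B.
have : exists2 r : R, 0 < r & forall a, fm_close r a nu -> B a.
  have : forall i, i \in finmap.enum_fset D -> exists2 r : R, 0 < r &
      forall a, fm_close r a nu -> narrow_subbase i a.
    move=> i iD; have /set_mem[ci bi oi] := sD _ iD.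
    have : narrow_subbase i nu by move: Bnu; rewrite -BE; exact.
    move=> inu; have [e/= e0 he] := (nbhs_ballP _ _).1 (open_nbhs_nbhs (conj oi inu)).
    have e2 : 0 < e / 2 by rewrite divr_gt0.
    have [r r0 hr] := fm_close_test ci e2.
    exists r => // a /hr; rewrite /narrow_subbase => anu; apply: he.
    rewrite /ball/= distrC; apply: le_lt_trans anu _.
    by rewrite ltr_pdivrMr// ltr_pMr// ltr1n.
  have DE a : (forall i, i \in finmap.enum_fset D -> narrow_subbase i a) -> B a.
    by rewrite -BE.
  move: (finmap.enum_fset D) DE => s DE hs.
  have [r r0 hr] : exists2 r : R, 0 < r & forall i, i \in s ->
      forall a, fm_close r a nu -> narrow_subbase i a.
    elim: s hs {DE} => [|i s IH] hs; first by exists 1.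
    have [|r r0 hr] := IH; first by move=> j js; apply: hs; rewrite inE js orbT.
    have [|r' r'0 hr'] := hs i; first by rewrite inE eqxx.
    exists (Num.min r r'); first by rewrite lt_min r0.
    move=> j; rewrite inE => /orP[/eqP ->|js] a ar.
      by apply: hr' => f /ar /le_trans; apply; rewrite ge_min lexx orbT.
    by apply: (hr j js) => f /ar /le_trans; apply; rewrite ge_min lexx.
  by exists r => // a ar; apply: DE => i si; exact: hr.
move=> [r r0 hr]; have [a Ca ar] := h r r0.
exact: BC (hr _ ar) Ca.
Qed.

End narrow_closed.

(** * Empirical measures and the Prohorov metric *)

Section real_valued_probability.
Context d (T : measurableType d) (R : realType).
Implicit Types (P Q : probability T R) (A B : set T).

Lemma probability_fineK P A : measurable A -> ((fine (P A))%:E = P A)%E.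
Proof. by move=> mA; rewrite fineK// fin_num_measure. Qed.

Lemma fine_probability_le P A B : measurable A -> measurable B -> A `<=` B ->
  fine (P A) <= fine (P B).
Proof.
move=> mA mB AB; rewrite -lee_fin !probability_fineK//.
by apply: le_measure; rewrite ?inE.
Qed.

Lemma fine_probability_ge0 P A : 0 <= fine (P A).
Proof. exact: fine_ge0. Qed.

Lemma fine_probability_le1 P A : measurable A -> fine (P A) <= 1.
Proof. by move=> mA; rewrite -lee_fin probability_fineK// probability_le1. Qed.

Lemma fine_probabilityC P A : measurable A -> fine (P (~` A)) = 1 - fine (P A).
Proof.
move=> mA; rewrite probability_setC// -(probability_fineK P mA) -EFinB.
by [].
Qed.

End real_valued_probability.

Section empirical_theory.
Context d (T : measurableType d) (R : realType).

Lemma ge0_integral_empirical n (x : n.-tuple T) (F : T -> \bar R) : (0 < n)%N ->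
  measurable_fun setT F -> (forall t, (0 <= F t)%E) ->
  (\int[empirical R x]_t F t = n%:R^-1%:E * \sum_(i < n) F (tnth x i))%E.
Proof.
move=> n0 mF F0.
have n1 : 0 <= n%:R^-1 :> R by rewrite invr_ge0.
pose m := mscale (NngNum n1) (msum (fun i => \d_(nth point x i) : {measure set T -> \bar R}) n).
transitivity (\int[m]_t F t)%E.
  apply: eq_measure_integral => A _ _.
  rewrite [LHS]empiricalE// /m /mscale/= /msum; congr (_ * _)%E.
  by apply: eq_bigr => i _; rewrite (tnth_nth point).
rewrite ge0_integral_mscale// ge0_integral_measure_sum//=; congr (_ * _)%E.
apply: eq_bigr => i _; rewrite integral_dirac//= (tnth_nth point).
by rewrite diracT mul1e.
Qed.

Lemma Rintegral_empirical n (x : n.-tuple T) (f : T -> R) (a : R) : (0 < n)%N ->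
  measurable_fun setT f -> (forall t, `|f t| <= a) ->
  \int[empirical R x]_t f t = n%:R^-1 * \sum_(i < n) f (tnth x i).
Proof.
move=> n0 mf fa.
have h : \int[empirical R x]_t (1 * f t + a) =
    n%:R^-1 * \sum_(i < n) (f (tnth x i) + a).
  rewrite /Rintegral ge0_integral_empirical//.
  - rewrite sumEFin -EFinM/=; congr (_ * _).
    by apply: eq_bigr => i _; rewrite mul1r.
  - apply/measurable_EFinP; apply: measurable_funD => //.
    by apply: measurable_funM.
  - move=> t; rewrite lee_fin mul1r.
    by have := fa t; rewrite ler_norml => /andP[? ?]; lra.
move: h; rewrite (Rintegral_affine _ 1 a mf fa) mul1r big_split/= mulrDr.
rewrite sumr_const card_ord -[a *+ n]mulr_natl mulKf ?pnatr_eq0 -?lt0n//.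
by move/addIr.
Qed.

Lemma fine_empirical n (x : n.-tuple T) (A : set T) : (0 < n)%N ->
  fine (empirical R x A) = n%:R^-1 * \sum_(i < n) \1_A (tnth x i).
Proof.
by move=> n0; rewrite empiricalE//= sumEFin -EFinM.
Qed.

End empirical_theory.

Section enlargements.
Context (R : realType) (E : pointedMetricType R).
Implicit Types (A : set E) (r s : R) (a b : M1 E).
Local Notation enl := (enlargement (@mdist R E)).

Lemma enlargementP A r x : enl A r x <->
  forall e, 0 < e -> exists2 y, A y & mdist y x < r + e.
Proof.
split => [xr e e0|h].
  have : (dist_to (@mdist R E) A x < (r + e)%:E)%E.
    by apply: le_lt_trans xr _; rewrite lte_fin ltrDl.
  by move=> /ereal_inf_lt[_ [y Ay <-]]; rewrite lte_fin; exists y.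
rewrite /enlargement/=; apply/lee_addgt0Pr => e /h[y Ay yx].
apply: (@le_trans _ _ (mdist y x)%:E); first by apply: ereal_inf_lbound; exists y.
by rewrite -EFinD lee_fin ltW.
Qed.

Lemma enlargement_mem A r x y : A y -> mdist y x <= r -> enl A r x.
Proof.
move=> Ay yx; apply/enlargementP => e e0; exists y => //.
by apply: le_lt_trans yx _; rewrite ltrDl.
Qed.

Lemma sub_enlargement A r : 0 <= r -> A `<=` enl A r.
Proof. by move=> r0 x Ax; apply: (enlargement_mem Ax); rewrite mdistxx. Qed.

Lemma enlargement_enlargement A r s : enl (enl A r) s `<=` enl A (r + s).
Proof.
move=> x /enlargementP h; apply/enlargementP => e e0.
have e2 : 0 < e / 2 by rewrite divr_gt0.
have [y /enlargementP/(_ _ e2)[z Az zy] yx] := h _ e2.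
exists z => //; apply: le_lt_trans (metric_triangle z y x) _.
by rewrite (splitr e) addrACA ltrD.
Qed.

(** A closed enlargement is a countable intersection of open ones, whatever the
   set A. *)
Lemma measurable_enlargement A r : measurable (enl A r : set (borel E)).
Proof.
rewrite (_ : enl A r = \bigcap_m \bigcup_(y in A) ball y (r + m.+1%:R^-1)); last first.
  apply/seteqP; split => x.
    move=> /enlargementP h m _.
    have [|y Ay yx] := h m.+1%:R^-1; first by rewrite invr_gt0.
    by exists y => //; rewrite -metricType_numDomainType.ball_mdistE.
  move=> h; apply/enlargementP => e e0.
  have [m me] := @ltr_add_invr R 0 e e0; rewrite add0r in me.
  have [y Ay] := h m I.
  rewrite -metricType_numDomainType.ball_mdistE/= => yx; exists y => //.
  by apply: lt_trans yx _; rewrite ltrD2l.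
apply: bigcap_measurable => [|m _]; first by exists 0%N.
apply: open_borel; apply: bigcup_open => y _.
rewrite -metricType_numDomainType.ball_mdistE; exact: open_mdist_ball.
Qed.

(** Membership of r in the set whose infimum is the Prohorov distance; see
   prohorov_closeP. *)
Definition prohorov_close r a b := 0 < r /\
  forall A : set (borel E), measurable A -> fine (a A) <= fine (b (enl A r)) + r.

Lemma prohorov_closeP r a b :
  (0 < r /\
    (ereal_sup [set a A - b (enl A r) | A in (measurable : set (set (borel E)))]
      <= r%:E)%E) <-> prohorov_close r a b.
Proof.
have eqv (A : set (borel E)) : measurable A ->
    (a A - b (enl A r) <= r%:E)%E = (fine (a A) <= fine (b (enl A r)) + r).
  move=> mA; rewrite -(probability_fineK a mA).
  rewrite -(probability_fineK b (measurable_enlargement A r)) -EFinB lee_fin.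
  by rewrite lerBlDl.
split => -[r0 h]; split => //.
  move=> A mA; rewrite -eqv//; apply: le_trans h.
  by apply: ereal_sup_ubound; exists A.
by apply: ge_ereal_sup => _ [A mA <-]; rewrite eqv//; exact: h.
Qed.

Lemma prohorov_close1 a b : prohorov_close 1 a b.
Proof.
split => // A mA; apply: le_trans (fine_probability_le1 a mA) _.
by rewrite lerDr fine_probability_ge0.
Qed.

Lemma prohorov_dist_le r a b : prohorov_close r a b -> prohorov_dist a b <= r.
Proof.
move=> rab; apply: ge_inf; last exact/prohorov_closeP.
by exists 0 => s [/ltW].
Qed.

Lemma prohorov_dist_lt r a b : prohorov_dist a b < r ->
  exists2 s, s < r & prohorov_close s a b.
Proof.
move=> /inf_lt -[|s /prohorov_closeP sab sr]; last by exists s.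
by exists 1; apply/prohorov_closeP; exact: prohorov_close1.
Qed.

(** Test the hypothesis on the complement of an enlargement of B; the slack
   between r and s absorbs the difference between open and closed
   enlargements. *)
Lemma prohorov_close_sym r s a b : r < s -> prohorov_close r a b ->
  prohorov_close s b a.
Proof.
move=> rs [r0 h]; split; first exact: lt_trans r0 rs.
move=> B mB; pose A : set (borel E) := ~` enl B s.
have mA : measurable A by apply: measurableC; exact: measurable_enlargement.
have := h A mA; rewrite {1}/A fine_probabilityC; last exact: measurable_enlargement.
have : fine (b B) <= fine (b (~` enl A r)).
  apply: fine_probability_le => //.
    by apply: measurableC; exact: measurable_enlargement.
  move=> x Bx /enlargementP/(_ (s - r)); rewrite subr_gt0 => /(_ rs)[y Ay].
  rewrite subrKC => yx; apply: Ay; apply: (enlargement_mem Bx).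
  by rewrite metric_sym ltW.
rewrite fine_probabilityC; last exact: measurable_enlargement.
by lra.
Qed.

Lemma prohorov_close_trans r s a b c : prohorov_close r a b ->
  prohorov_close s b c -> prohorov_close (r + s) a c.
Proof.
move=> [r0 ab] [s0 bc]; split; first by rewrite addr_gt0.
move=> A mA; apply: le_trans (ab A mA) _.
have := bc _ (measurable_enlargement A r).
have : fine (c (enl (enl A r) s)) <= fine (c (enl A (r + s))).
  apply: fine_probability_le; [exact: measurable_enlargement..|].
  exact: enlargement_enlargement.
lra.
Qed.

(** Layer-cake decomposition of v, discretised with step delta: it reduces the
   integral of a bounded function to the measures of finitely many level sets. *)
Lemma staircase (delta v : R) N : 0 <= delta -> 0 <= v -> v <= N%:R * delta ->
  let S := \sum_(j < N) delta * (delta * j.+1%:R <= v)%R%:R in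
  S <= v /\ v <= delta + S.
Proof.
move=> d0 v0 vN /=.
have [h1 h2] : let S := \sum_(j < N) delta * (delta * j.+1%:R <= v)%R%:R in
    (S <= v /\ S <= N%:R * delta) /\ (v <= delta + S \/ S = N%:R * delta).
  move=> {vN}; elim: N => [|N [[IH1 IH2] IH3]] /=.
    by rewrite big_ord0 mul0r; split; [split|right].
  rewrite big_ord_recr/=; move: IH1 IH2 IH3; set S := \sum_(j < N) _ => IH1 IH2 IH3.
  have dN : delta * N.+1%:R = N%:R * delta + delta.
    by rewrite -natr1 mulrDr mulr1 mulrC.
  have [le|lt] := leP (delta * N.+1%:R) v; rewrite ?mulr1 ?mulr0 ?addr0.
    split; first by split; [lra|rewrite mulrC; lra].
    by case: IH3 => h; [left; lra|right; rewrite mulrC; lra].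
  split; first by split; [lra|rewrite mulrC; lra].
  by left; case: IH3 => h; lra.
by split; [lra|case: h2 => h; lra].
Qed.

End enlargements.

(** * A common interface for the two metrics *)

Section good_distances.
Context (R : realType) (E : pointedMetricType R).
Implicit Types (a b c nu Q : M1 E) (r s rho : R).
Local Notation enl := (enlargement (@mdist R E)).

(** The three features of the metric on which the argument rests: moving the
   points of a sample by rho moves its empirical measure by at most rho; the
   metric dominates the Fortet-Mourier metric; a ball of radius e / 4 that is not
   contained in the e-ball around Q is separated from Q by the integral of a
   function with values in [0, 1], with a gap kappa * e. Hoeffding's inequality
   turns the last feature into the exponent 2 * kappa^2 of the covering
   condition. *)
Definition good_distance (dbar : M1 E -> M1 E -> R) (kappa : R) := [/\
  forall n (x y : n.-tuple (borel E)) rho a, (0 < n)%N -> 0 < rho ->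
    (forall i, mdist (tnth x i : E) (tnth y i) <= rho) ->
    dbar a (empirical R y) <= dbar a (empirical R x) + rho,
  forall tau, 0 < tau -> exists2 r, 0 < r &
    forall a nu, dbar a nu <= r -> fm_close tau a nu &
  forall Q c e, 0 < e -> (forall nu, dbar c nu < e / 4 -> dbar Q nu <= e) \/
    exists f : borel E -> R, [/\ measurable_fun setT f,
      forall x, 0 <= f x <= 1 & forall nu, dbar c nu < e / 4 ->
        kappa * e <= \int[Q]_x f x - \int[nu]_x f x]].

(** If d(Q, c) > 3 e / 4, a near-optimal test function for (Q, c) has gap at least
   e / 2 on the ball around c; mapping its range [-1, 1] to [0, 1] halves the
   gap. *)
Lemma fortet_mourier_good : good_distance fortet_mourier_dist (1 / 4).
Proof.
split.
- move=> n x y rho a n0 rho0 xy; apply/fortet_mourier_le.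
  apply: (@fm_close_trans _ _ _ _ _ (empirical R x)); first exact/fortet_mourier_le.
  move=> f fb; have mf := fm_ball_measurable fb; have f1 := fm_ball_bound fb.
  have [m [l [m0 l0 ml _ fl]]] := fb.
  rewrite !(Rintegral_empirical _ _ mf f1)// -mulrBr -sumrB normrM.
  rewrite ger0_norm ?invr_ge0// ler_pdivrMl ?ltr0n//.
  apply: le_trans (ler_norm_sum _ _ _) _.
  rewrite -[X in X%:R * _]card_ord mulr_natl -sumr_const.
  apply: ler_sum => i _; apply: le_trans (lipschitz_le_norm _ _ fl) _.
  apply: (@le_trans _ _ (1 * rho)); last by rewrite mul1r.
  by apply: ler_pM => //; [exact: mdist_ge0|lra].
- by move=> tau tau0; exists tau => // a nu /fortet_mourier_le.
- move=> Q c e e0.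
  have [Qc|] := leP (fortet_mourier_dist Q c) (3 * e / 4).
    left => nu /ltW/fortet_mourier_le cnu; apply/fortet_mourier_le.
    move/fortet_mourier_le : Qc => /fm_close_trans/(_ cnu).
    by rewrite (_ : 3 * e / 4 + e / 4 = e)//; lra.
  move=> /fortet_mourier_gt[f fb Qcf]; right.
  have mf := fm_ball_measurable fb; have f1 := fm_ball_bound fb.
  exists (fun x => 1 / 2 * f x + 1 / 2); split.
  - by apply: measurable_funD => //; apply: measurable_funM.
  - move=> x; have := f1 x; rewrite ler_norml => /andP[? ?].
    by apply/andP; split; lra.
  move=> nu /ltW/fortet_mourier_le/(_ f fb); rewrite ler_norml => /andP[? ?].
  by rewrite !(Rintegral_affine _ _ _ mf f1); lra.
Qed.

(** Compare level sets: a Lipschitz function cannot vary by more than l * r on an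
   enlargement by r, so the level sets of f + l * r contain the enlarged level
   sets of f. The N steps of the staircase cost 2 / N. *)
Lemma prohorov_close_fm r a b (N : nat) : (0 < N)%N -> prohorov_close r a b ->
  fm_close (2 / N%:R + 2 * r) a b.
Proof.
move=> N0 [r0 ab].
suff h f : fm_ball f -> \int[a]_x f x - \int[b]_x f x <= 2 / N%:R + 2 * r.
  move=> f fb; rewrite ler_norml h// andbT lerNl opprB.
  have := h _ (fm_ball_opp fb); rewrite !RintegralN//; lra.
move=> fb; have mf := fm_ball_measurable fb; have f1 := fm_ball_bound fb.
have [m [l [m0 l0 ml fm fl]]] := fb.
pose delta := 2 * m / N%:R.
have N0' : 0 < N%:R :> R by rewrite ltr0n.
have d0 : 0 <= delta by rewrite divr_ge0// mulr_ge0.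
have dN : N%:R * delta = 2 * m by rewrite mulrC divfK// gt_eqF.
pose F x := f x + m.
have F0 x : 0 <= F x by have := fm x; rewrite /F ler_norml => /andP[? ?]; lra.
have F2 x : F x <= 2 * m by have := fm x; rewrite /F ler_norml => /andP[? ?]; lra.
have mF : measurable_fun [set: borel E] (F : borel E -> R).
  by apply: measurable_funD.
pose A (G : borel E -> R) (j : nat) : set (borel E) := [set x | delta * j.+1%:R <= G x].
have mA G j : measurable_fun setT G -> measurable (A G j).
  move=> mG; rewrite (_ : A G j = setT `&` G @^-1` `[delta * j.+1%:R, +oo[%classic).
    by apply: mG => //; exact: measurable_itv.
  by rewrite setTI; apply/seteqP; split => x /=; rewrite in_itv/= andbT.
pose S (G : borel E -> R) x := \sum_(j < N) delta * \1_(A G j) x.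
have SE G x : S G x = \sum_(j < N) delta * (delta * j.+1%:R <= G x)%R%:R.
  apply: eq_bigr => j _; rewrite indicE; congr (_ * (nat_of_bool _)%:R).
  by apply/idP/idP => [/set_mem//|h]; apply/mem_set.
have mS G : measurable_fun setT G -> measurable_fun setT (S G).
  move=> mG; apply: measurable_sum => j; apply: measurable_funM => //.
  by apply: measurable_indic; exact: mA.
have S_int (P : M1 E) G : measurable_fun setT G ->
    \int[P]_x S G x = \sum_(j < N) delta * fine (P (A G j)).
  move=> mG; rewrite /S /Rintegral.
  under eq_integral do rewrite -sumEFin.
  rewrite ge0_integral_sum//.
  - transitivity (fine (\sum_(j < N) (delta * fine (P (A G j)))%:E)%E).
      congr fine; apply: eq_bigr => j _.
      under eq_integral do rewrite EFinM.
      rewrite ge0_integralZl_EFin//.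
      + by rewrite integral_indic ?setIT ?EFinM ?probability_fineK//; exact: mA.
      + by apply/measurable_EFinP/measurable_indic; exact: mA.
    by rewrite sumEFin.
  - move=> j; apply/measurable_EFinP; apply: measurable_funM => //.
    by apply: measurable_indic; exact: mA.
  - by move=> j x _; rewrite lee_fin mulr_ge0.
pose G x := F x + l * r.
have mG : measurable_fun [set: borel E] (G : borel E -> R) by apply: measurable_funD.
have G0 x : 0 <= G x by rewrite addr_ge0// mulr_ge0// ltW.
have step j : fine (a (A F j)) <= fine (b (A G j)) + r.
  apply: le_trans (ab _ (mA _ _ mF)) _; rewrite lerD2r.
  apply: fine_probability_le; [exact: measurable_enlargement|exact: mA|].
  move=> x /enlargementP h; rewrite /A/= /G.
  apply/ler_addgt0Pr => e e0.
  have el : 0 < e / (l + 1) by rewrite divr_gt0// ltr_wpDl.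
  have [y Ay yx] := h _ el.
  have : F y - F x <= l * mdist y x.
    by rewrite /F opprD addrACA subrr addr0 fl.
  have : l * mdist y x <= l * (r + e / (l + 1)) by rewrite ler_wpM2l// ltW.
  have : l * (e / (l + 1)) <= e.
    rewrite mulrA ler_pdivrMr ?ltr_wpDl// mulrC ler_wpM2l//; first exact: ltW.
    by rewrite lerDl.
  by rewrite /A/= in Ay; lra.
have SF x : F x <= delta + S F x.
  by rewrite SE; apply: (staircase d0 (F0 x) _).2; rewrite dN.
have SG x : S G x <= G x.
  rewrite SE.
  have sub : \sum_(j < N) delta * (delta * j.+1%:R <= G x)%R%:R =
      \sum_(j < N) delta * (delta * j.+1%:R <= Num.min (G x) (2 * m))%R%:R.
    apply: eq_bigr => j _; congr (_ * _%:R); rewrite le_min.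
    suff -> : delta * j.+1%:R <= 2 * m by rewrite andbT.
    by rewrite -dN mulrC ler_wpM2r// ler_nat.
  rewrite sub; apply: (@le_trans _ _ (Num.min (G x) (2 * m))).
    apply: (staircase d0 _ _).1; first by rewrite le_min G0 mulr_ge0.
    by rewrite dN ge_min lexx orbT.
  by rewrite ge_min lexx.
have F_b x : `|F x| <= 2 * m by rewrite ger0_norm.
have G_b x : `|G x| <= 2 * m + l * r by rewrite ger0_norm// lerD2r.
have S0 H x : 0 <= S H x by apply: sumr_ge0 => j _; rewrite mulr_ge0.
have S_b H x : `|S H x| <= N%:R * delta.
  rewrite ger0_norm// mulr_natl -[X in _ *+ X]card_ord -sumr_const.
  by apply: ler_sum => j _; rewrite ler_piMr.
have h1 : \int[a]_x F x <= delta + \sum_(j < N) delta * fine (a (A F j)).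
  rewrite -S_int// addrC -[X in _ <= X + _]mul1r.
  rewrite -(Rintegral_affine a 1 delta (mS _ mF) (S_b F)).
  apply: (@le_Rintegral_bounded _ _ _ _ _ _ (2 * m) (N%:R * delta + delta)) => //.
  - by apply: measurable_funD => //; apply: measurable_funM => //; exact: mS.
  - move=> x; rewrite mul1r; apply: le_trans (ler_normD _ _) _.
    by rewrite lerD// ger0_norm.
  - by move=> x; rewrite mul1r addrC.
have h2 : \sum_(j < N) delta * fine (b (A G j)) <= \int[b]_x G x.
  rewrite -S_int//.
  apply: (@le_Rintegral_bounded _ _ _ _ _ _ (N%:R * delta) (2 * m + l * r)) => //.
  exact: mS.
have h3 : \sum_(j < N) delta * fine (a (A F j)) <=
    \sum_(j < N) delta * fine (b (A G j)) + 2 * m * r.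
  rewrite -dN -mulrA mulr_natl -[X in _ *+ X]card_ord -sumr_const -big_split/=.
  by apply: ler_sum => j _; rewrite -mulrDr ler_wpM2l.
have hF (P : M1 E) : \int[P]_x F x = \int[P]_x f x + m.
  rewrite -[X in X + m]mul1r -(Rintegral_affine P 1 m mf f1).
  by apply: eq_Rintegral => x _; rewrite mul1r.
have hG : \int[b]_x G x = \int[b]_x f x + m + l * r.
  rewrite -hF -[X in X + _]mul1r -(Rintegral_affine b 1 (l * r) mF F_b).
  by apply: eq_Rintegral => x _; rewrite mul1r.
have dle : delta <= 2 / N%:R.
  by rewrite ler_wpM2r ?invr_ge0 ?(ltW N0')//; lra.
have : m * r + l * r <= r by rewrite -mulrDl -[leRHS]mul1r ler_wpM2r// ltW.
have : m * r <= r by rewrite -[leRHS]mul1r ler_wpM2r ?(ltW r0)//; lra.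
by move: h1; rewrite hF; lra.
Qed.

(** If Q is not 3 e / 4 -close to c, some A has Q(A) > c(A enlarged by 3 e / 4)
   + 3 e / 4; the indicator of the enlargement of A by e / 2 then separates Q from
   the ball around c, since e / 2 + e / 4 = 3 e / 4 and 3 e / 4 - e / 4 = e / 2. *)
Lemma prohorov_good : good_distance prohorov_dist (1 / 2).
Proof.
split.
- move=> n x y rho a n0 rho0 xy; rewrite -lerBlDr.
  apply: lb_le_inf.
    by exists 1; apply/prohorov_closeP; exact: prohorov_close1.
  move=> r /prohorov_closeP[r0 ar]; rewrite lerBlDr.
  apply: prohorov_dist_le; apply: (@prohorov_close_trans _ _ _ _ _ (empirical R x)) => //.
  split => // A mA; apply: ler_wpDr; first exact: ltW.
  rewrite !fine_empirical// ler_wpM2l ?invr_ge0//; apply: ler_sum => i _.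
  rewrite !indicE ler_nat; have [/set_mem Ax|//] := boolP (tnth x i \in A).
  by rewrite mem_set//; exact: (enlargement_mem Ax).
- move=> tau tau0; exists (tau / 8); first by rewrite divr_gt0.
  move=> a nu anu.
  have : prohorov_dist a nu < tau / 4.
    by apply: le_lt_trans anu _; rewrite ltr_pM2l// ltf_pV2 ?posrE// ltr_nat.
  move=> /prohorov_dist_lt[s st [s0 san]].
  have t4 : 0 < tau / 4 by rewrite divr_gt0.
  have [N] := @ltr_add_invr R 0 (tau / 4) t4; rewrite add0r => Nt.
  have := @prohorov_close_fm s a nu N.+1 isT (conj s0 san).
  move: (N.+1%:R^-1) Nt => t Nt h f /h /le_trans; apply; lra.
- move=> Q c e e0; pose r := 3 * e / 4.
  have r0 : 0 < r by rewrite divr_gt0// mulr_gt0.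
  have [Qc|nQc] := pselect (prohorov_close r Q c).
    left => nu /prohorov_dist_lt[s se cnu].
    apply: (@le_trans _ _ (r + s)); last by rewrite /r; lra.
    exact: prohorov_dist_le (prohorov_close_trans Qc cnu).
  right.
  have [A [mA hA]] : exists A : set (borel E), measurable A /\
      fine (c (enl A r)) + r < fine (Q A).
    apply: contrapT => h; apply: nQc; split => // A mA.
    by rewrite leNgt; apply/negP => hA; apply: h; exists A.
  pose B : set (borel E) := enl A (e / 2).
  have mB : measurable B by exact: measurable_enlargement.
  exists \1_B; split; first exact: measurable_indic.
    by move=> x; rewrite indicE; case: (x \in B); rewrite !lexx !ler01.
  move=> nu /prohorov_dist_lt[s se /(prohorov_close_sym se)[_ /(_ B mB)]].
  rewrite !Rintegral_indic//.
  have : fine (c (enl B (e / 4))) <= fine (c (enl A r)).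
    apply: fine_probability_le; [exact: measurable_enlargement..|].
    rewrite (_ : r = e / 2 + e / 4); last by rewrite /r; lra.
    exact: enlargement_enlargement.
  have : fine (Q A) <= fine (Q B).
    by apply: fine_probability_le => //; apply: sub_enlargement; lra.
  by rewrite /r in hA *; lra.
Qed.

End good_distances.

(** * Concentration of the empirical measure *)

Section concentration.
Context d (T : measurableType d) (R : realType).
Implicit Types (P : probability T R).

(** Chernoff's method with the exponential parameter 4 * s, the minimizer of
   t^2 / 8 - t * s. *)
Lemma hoeffding P (f : T -> R) (s : R) n : measurable_fun setT f ->
  (forall x, 0 <= f x <= 1) -> 0 <= s ->
  (product_law P n [set x : n.-tuple T | (\sum_(i < n) f (tnth x i) <=
      n%:R * (\int[P]_x f x - s))%R] <= (expR (- (2 * n%:R * s ^+ 2)))%:E)%E.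
Proof.
move=> mf f01 s0; set m := Rintegral _ _ _.
have f1 x : `|f x| <= 1 by have /andP[f0 f1] := f01 x; rewrite ger0_norm.
have m01 : 0 <= m <= 1.
  apply/andP; split; first by apply: Rintegral_ge0 => x _; have /andP[] := f01 x.
  by have := Rintegral_le_bound P mf f1; rewrite ler_norml => /andP[].
pose g x := expR (4 * s * (m - s - f x)).
have mg : measurable_fun setT g.
  apply: measurableT_comp => //; apply: measurable_funM => //.
  exact: measurable_funB.
pose G (u : 1.-tuple T) := g (tnth u ord0).
have mG : measurable_fun [set: 1.-tuple T] G.
  by apply: (measurableT_comp mg); exact: measurable_tnth.
have G_int : (\int[product_law P 1]_u (G u)%:E <= (expR (- (2 * s ^+ 2)))%:E)%E.
  have -> : (\int[product_law P 1]_u (G u)%:E = \int[P]_x (g x)%:E)%E.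
    rewrite -(@integral_nth _ _ _ P 1 0 (fun x => (g x)%:E))//.
    - by apply: eq_integral => u _; rewrite /G (tnth_nth point).
    - exact/measurable_EFinP.
    - by move=> x; rewrite lee_fin expR_ge0.
  apply: (@le_trans _ _ (\int[P]_x ((expR (4 * s * (m - s - 1)) *
       (1 - (1 - f x) + (1 - f x) * expR (4 * s)))%:E))%E).
    apply: ge0_le_integral => //.
    - by move=> x _; rewrite lee_fin expR_ge0.
    - exact/measurable_EFinP.
    - apply/measurable_EFinP; apply: measurable_funM => //.
      by apply: measurable_funD; [|apply: measurable_funM => //];
        do ?apply: measurable_funB.
    - move=> x _; rewrite lee_fin /g.
      rewrite (_ : 4 * s * (m - s - f x) = 4 * s * (m - s - 1) + 4 * s * (1 - f x)); last by ring.
      rewrite expRD ler_pM2l ?expR_gt0//; apply: expR_chord.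
      by have /andP[? ?] := f01 x; apply/andP; split; lra.
  have E x : expR (4 * s * (m - s - 1)) * (1 - (1 - f x) + (1 - f x) * expR (4 * s)) =
    (expR (4 * s * (m - s - 1)) * (1 - expR (4 * s))) * f x +
      expR (4 * s * (m - s - 1)) * expR (4 * s) by ring.
  under eq_integral do rewrite E.
  rewrite -[leLHS]fineK; last first.
    apply: integrable_fin_num => //.
    rewrite (_ : (fun x => _) = EFin \o (fun x => (expR (4 * s * (m - s - 1)) * (1 - expR (4 * s))) * f x +
      expR (4 * s * (m - s - 1)) * expR (4 * s)))//.
    apply: (@bounded_integrable _ _ _ _ _ (`|expR (4 * s * (m - s - 1)) * (1 - expR (4 * s))| +
        `|expR (4 * s * (m - s - 1)) * expR (4 * s)|)).
      by apply: measurable_funD => //; apply: measurable_funM.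
    move=> x; apply: le_trans (ler_normD _ _) _; rewrite lerD2r normrM.
    by rewrite ler_piMr.
  rewrite [fine _](Rintegral_affine P _ _ mf f1) -/m lee_fin.
  have := @bernoulli_mgf_le R (1 - m) (4 * s).
  have -> : 0 <= 1 - m <= 1 by have /andP[? ?] := m01; apply/andP; split; lra.
  have -> : 0 <= 4 * s by rewrite mulr_ge0.
  move=> /(_ isT isT) h.
  apply: (@le_trans _ _ (expR (4 * s * (m - s - 1)) *
     expR ((1 - m) * (4 * s) + (4 * s) ^+ 2 / 8))).
    apply: le_trans (ler_wpM2l (expR_ge0 _) h).
    by rewrite le_eqVlt; apply/orP; left; apply/eqP; ring.
  by rewrite -expRD ler_expR le_eqVlt; apply/orP; left; apply/eqP; field.
have := @integral_prod_block _ _ _ P 1 n n G _ _ mG (fun u => expR_ge0 _) G_int.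
rewrite muln1 leqnn => /(_ isT).
rewrite -expRM_natl (_ : n%:R * - (2 * s ^+ 2) = - (2 * n%:R * s ^+ 2)); last by ring.
apply: le_trans.
set A := [set x | _].
have mS : measurable_fun [set: n.-tuple T] (fun x => \sum_(i < n) f (tnth x i)).
  by apply: measurable_sum => i; apply: (measurableT_comp mf); exact: measurable_tnth.
have mA : measurable A.
  rewrite (_ : A = setT `&` (fun x => \sum_(i < n) f (tnth x i)) @^-1` `]-oo, n%:R * (m - s)]%classic).
    by apply: mS => //; exact: measurable_itv.
  by rewrite setTI; apply/seteqP; split => x /=; rewrite in_itv.
have -> : (product_law P n A = \int[product_law P n]_x (\1_A x)%:E)%E.
  by rewrite integral_indic// setIT.
have prodE (x : n.-tuple T) : \prod_(j < n) G (block 1 j x) =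
    expR (4 * s * (n%:R * (m - s) - \sum_(i < n) f (tnth x i))).
  rewrite /G /g -expR_sum -mulr_sumr; congr expR; congr (_ * _).
  rewrite sumrB sumr_const card_ord mulr_natl; congr (_ - _).
  apply: eq_bigr => i _; congr f.
  by rewrite tnth_mktuple muln1 addn0 (tnth_nth point).
apply: ge0_le_integral => //.
- exact/measurable_EFinP/measurable_indic.
- apply/measurable_EFinP; apply: measurable_prod => j _.
  by apply: (measurableT_comp mG); exact: measurable_block.
- move=> x _; rewrite lee_fin prodE indicE; have [/set_mem Ax|_] := boolP (x \in A).
    rewrite [leLHS](_ : _ = expR 0) ?expR0// -[leLHS]expR0.
    by rewrite ler_expR mulr_ge0 ?mulr_ge0// subr_ge0.
  exact: expR_ge0.
Qed.

End concentration.

Section empirical_events.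
Context (R : realType) (E : pointedMetricType R).
Hypothesis cE : compact [set: E].
Implicit Types (a Q : M1 E) (C : set (M1 E)).

Lemma measurable_box n (s : seq E) rho (u : n.-tuple 'I_(size s)) :
  measurable [set x : n.-tuple (borel E) |
    forall i, mdist (nth point s (tnth u i)) (tnth x i : E) < rho].
Proof.
rewrite (_ : [set x | _] = \bigcap_(i in [set: 'I_n]) ((@tnth n (borel E))^~ i @^-1`
    [set z : borel E | mdist (nth point s (tnth u i)) (z : E) < rho])).
  apply: fin_bigcap_measurable => // i _.
  by rewrite -[X in measurable X]setTI; apply: measurable_tnth => //; exact: measurable_mdist_ball.
by apply/seteqP; split => [x h i _|x h i]; exact: h.
Qed.

(** A function on tuples that is Lipschitz for the sup distance has open strict
   superlevel sets, but being open in E^n does not by itself give measurability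
   for the product sigma-algebra: compactness provides finite nets, hence a
   countable family of boxes that exhausts the superlevel set. *)
Lemma measurable_lipschitz_sublevel n (Phi : n.-tuple (borel E) -> \bar R) (e : R) :
  (forall (x y : n.-tuple (borel E)) rho, 0 < rho ->
    (forall i, mdist (tnth x i : E) (tnth y i) <= rho) ->
    (Phi y <= Phi x + rho%:E)%E) ->
  measurable [set x | (Phi x <= e%:E)%E].
Proof.
move=> lipPhi.
have net m : {s : seq E | forall x, has (fun y => mdist y x < m.+1%:R^-1) s}.
  by apply: cid; apply: finite_net => //; rewrite invr_gt0.
pose s m := proj1_sig (net m).
pose box m (u : n.-tuple 'I_(size (s m))) : set (n.-tuple (borel E)) :=
  [set x | forall i, mdist (nth point (s m) (tnth u i)) (tnth x i : E) < m.+1%:R^-1].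
rewrite -[X in measurable X]setCK; apply: measurableC.
rewrite (_ : ~` _ = \bigcup_m \bigcup_(u in [set u | box m u `<=`
    [set x | (e%:E < Phi x)%E]]) box m u); last first.
  apply/seteqP; split => x /=.
    move=> /negP; rewrite -ltNge => ex.
    have [m hm] : exists m, (e%:E + (2 * m.+1%:R^-1)%:E < Phi x)%E.
      move: ex; case: (Phi x) => [r| |//]; last by exists 0%N; rewrite -EFinD ltry.
      rewrite lte_fin => er.
      have er2 : 0 < (r - e) / 2 by rewrite divr_gt0// subr_gt0.
      have [m hm] := @ltr_add_invr R 0 _ er2; rewrite add0r in hm.
      exists m; rewrite -EFinD lte_fin; move: hm; move: (m.+1%:R^-1) => t; lra.
    have idx (i : 'I_n) : {j : 'I_(size (s m)) |
        mdist (nth point (s m) j) (tnth x i : E) < m.+1%:R^-1}.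
      have /hasP/cid2[y ys yx] := proj2_sig (net m) (tnth x i : E).
      have ly : (index y (s m) < size (s m))%N by rewrite index_mem.
      by exists (Ordinal ly); rewrite /= nth_index.
    exists m => //; exists [tuple proj1_sig (idx i) | i < n]; last first.
      by move=> i; rewrite tnth_mktuple; exact: (proj2_sig (idx i)).
    move=> y ybox /=; have m0 : 0 < 2 * m.+1%:R^-1 :> R by rewrite mulr_gt0// invr_gt0.
    have := lipPhi y x _ m0.
    have xy i : mdist (tnth y i : E) (tnth x i) <= 2 * m.+1%:R^-1.
      apply: le_trans (metric_triangle _ (nth point (s m) (proj1_sig (idx i))) _) _.
      rewrite mulr_natl mulr2n lerD//; last exact/ltW/(proj2_sig (idx i)).
      by rewrite metric_sym ltW//; have := ybox i; rewrite tnth_mktuple.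
    move=> /(_ xy)/(lt_le_trans hm).
    by rewrite lteD2rE.
  move=> [m _ [u ub xu]]; apply/negP; rewrite -ltNge; exact: ub.
apply: bigcup_measurable => m _.
apply: fin_bigcup_measurable => [|u _]; last exact: measurable_box.
exact: finite_finset.
Qed.

Variables (dbar : M1 E -> M1 E -> R) (kappa : R).
Hypothesis good : good_distance dbar kappa.

Lemma measurable_empirical_event n C (e : R) : (0 < n)%N ->
  measurable (@empirical_event _ (borel E) R n (enlargement dbar C e)).
Proof.
move=> n0; apply: measurable_lipschitz_sublevel => x y rho rho0 xy.
have [lip _ _] := good.
rewrite -leeBlDr//; apply: le_ereal_inf_tmp => _ [a Ca <-].
have ay : (dist_to dbar C (empirical R y) <= (dbar a (empirical R y))%:E)%E.
  by apply: ereal_inf_lbound; exists a.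
by rewrite leeBlDr// (le_trans ay)// -EFinD lee_fin; exact: lip.
Qed.

(** Off the event, the empirical measure is at distance more than e from Q, so it
   falls in a ball of the cover that is separated from Q by some function, whose
   empirical mean deviates by kappa * e from its Q-mean. *)
Lemma empirical_event_compl n C Q (e : R) (N : nat) (c : 'I_N -> M1 E) :
  (0 < n)%N -> C Q -> 0 < e -> 0 <= kappa ->
  (forall nu, exists i, dbar (c i) nu < e / 4) ->
  (product_law Q n (~` @empirical_event _ (borel E) R n (enlargement dbar C e))
    <= (N%:R * expR (- (2 * n%:R * (kappa * e) ^+ 2)))%:E)%E.
Proof.
move=> n0 CQ e0 k0 cov; set S := empirical_event _.
have mS : measurable S by exact: measurable_empirical_event.
have [_ _ sep] := good.
have piece (i : 'I_N) : {B : set (n.-tuple (borel E)) | [/\ measurable B,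
    (product_law Q n B <= (expR (- (2 * n%:R * (kappa * e) ^+ 2)))%:E)%E &
    forall x, dbar (c i) (empirical R x) < e / 4 -> ~ S x -> B x]}.
  apply: cid; have [near|[f [mf f01 hf]]] := sep Q (c i) e e0.
    exists set0; split => //; first by rewrite measure0 lee_fin expR_ge0.
    move=> x /near Qx; apply; rewrite /S /empirical_event /enlargement/=.
    apply: (@le_trans _ _ (dbar Q (empirical R x))%:E); last by rewrite lee_fin.
    by apply: ereal_inf_lbound; exists Q.
  have f1 x : `|f x| <= 1 by have /andP[f0 f1] := f01 x; rewrite ger0_norm.
  exists [set x : n.-tuple (borel E) | \sum_(i < n) f (tnth x i) <=
      n%:R * (\int[Q]_x f x - kappa * e)]; split.
  - have mS' : measurable_fun [set: n.-tuple (borel E)]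
        (fun x => \sum_(i < n) f (tnth x i)).
      by apply: measurable_sum => j; apply: (measurableT_comp mf); exact: measurable_tnth.
    rewrite (_ : [set x | _] = setT `&` (fun x : n.-tuple (borel E) =>
        \sum_(i < n) f (tnth x i)) @^-1` `]-oo, n%:R * (\int[Q]_x f x - kappa * e)]%classic).
      by apply: mS' => //; exact: measurable_itv.
    by rewrite setTI; apply/seteqP; split => x /=; rewrite in_itv.
  - by apply: hoeffding => //; rewrite mulr_ge0// ltW.
  - move=> x cx _ /=; have := hf _ cx.
    rewrite (Rintegral_empirical _ _ mf f1)// => h.
    rewrite mulrC -ler_pdivrMr ?ltr0n// mulrC; lra.
pose A (j : nat) := if insub j is Some i then proj1_sig (piece i) else set0.
have mA j : measurable (A j).
  by rewrite /A; case: insubP => // i _ _; have [] := proj2_sig (piece i).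
apply: (@le_trans _ _ (product_law Q n (\big[setU/set0]_(j < N) A j))).
  apply: le_measure; rewrite ?inE.
  - exact: measurableC.
  - exact: bigsetU_measurable.
  - move=> x nSx; have [i ix] := cov (empirical R x).
    rewrite -bigcup_seq; exists i; first by rewrite /= mem_index_enum.
    by rewrite /A valK; have [_ _] := proj2_sig (piece i); apply.
apply: le_trans (Boole_inequality _ _) _ => //.
rewrite (_ : N%:R * _ = \sum_(j < N) expR (- (2 * n%:R * (kappa * e) ^+ 2))); last first.
  by rewrite sumr_const card_ord mulr_natl.
rewrite -sumEFin; apply: lee_sum => j _.
by rewrite /A valK; have [] := proj2_sig (piece j).
Qed.

Lemma empirical_event_whp C Q (eps : R^nat) (c : R) : C Q -> 0 <= kappa ->
  2 * kappa ^+ 2 = c^-1 -> (forall n, 0 < eps n) ->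
  (covering_number dbar (eps n / 4) *
     (expR (- (n%:R * eps n ^+ 2 / c)))%:E)%E @[n --> \oo] --> 0%E ->
  forall tau, 0 < tau -> \forall n \near \oo,
    (product_law Q n (~` @empirical_event _ (borel E) R n (enlargement dbar C (eps n)))
      <= tau%:E)%E.
Proof.
move=> CQ k0 kc eps0 cov tau tau0.
have small : \forall n \near \oo, (covering_number dbar (eps n / 4) *
    (expR (- (n%:R * eps n ^+ 2 / c)))%:E < tau%:E)%E.
  have /fine_cvgP[fin /cvgr_lt/(_ tau tau0)] := cov.
  move: fin; apply: filterS2 => n fin_n h.
  by rewrite -(fineK fin_n) lte_fin.
near=> n.
have n0 : (0 < n)%N by near: n; exists 1%N.
have small_n : (covering_number dbar (eps n / 4) *
    (expR (- (n%:R * eps n ^+ 2 / c)))%:E < tau%:E)%E by near: n; exact: small.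
move: small_n; set X := - (n%:R * eps n ^+ 2 / c) => small_n.
have : (covering_number dbar (eps n / 4) < (tau / expR X)%:E)%E.
  by rewrite EFinM lte_pdivlMr ?expR_gt0.
move=> /ereal_inf_lt[_ [m [cc hcc] <-]]; rewrite lte_fin ltr_pdivlMr ?expR_gt0// => hm.
apply: le_trans (@empirical_event_compl n C Q (eps n) m cc n0 CQ (eps0 n) k0 hcc) _.
rewrite lee_fin (_ : - (2 * n%:R * (kappa * eps n) ^+ 2) = X) ?ltW//.
by rewrite /X -kc; ring.
Unshelve. all: by end_near. Qed.

End empirical_events.

(** * Near-minimizers of the entropy *)

Section mixtures.
Context (R : realType) (E : pointedMetricType R).
Implicit Types (nu : M1 E) (f : borel E -> R).

(** Bounded functions are shifted to nonnegative ones, for which integration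
   against a sum of measures is additive. *)
Lemma mixture_exists (t : R) nu1 nu2 : 0 <= t <= 1 ->
  exists nu, is_mixture t nu1 nu2 nu /\
    forall f b, measurable_fun setT f -> (forall x, `|f x| <= b) ->
      \int[nu]_x f x = t * \int[nu1]_x f x + (1 - t) * \int[nu2]_x f x.
Proof.
move=> /andP[t0 t1]; have t1' : 0 <= 1 - t by rewrite subr_ge0.
pose m1 : {measure set (borel E) -> \bar R} := mscale (NngNum t0) nu1.
pose m2 : {measure set (borel E) -> \bar R} := mscale (NngNum t1') nu2.
pose m : {measure set (borel E) -> \bar R} := measure_add m1 m2.
have mE A : m A = (t%:E * nu1 A + (1 - t)%:E * nu2 A)%E.
  exact: measure_addE.
have mT : m setT = 1%E.
  rewrite mE [nu1 _](_ : _ = 1%E); last exact: probability_setT.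
  rewrite [nu2 _](_ : _ = 1%E); last exact: probability_setT.
  by rewrite !mule1 -EFinD subrKC.
pose nu : M1 E := mnormalize m nu1.
have nuE A : nu A = m A by rewrite /nu/= /mnormalize mT onee_eq0/= invr1 mule1.
exists nu; split; first by move=> A mA; rewrite nuE mE.
move=> f b mf fb.
have pos : \int[nu]_x (1 * f x + b) =
    t * \int[nu1]_x (1 * f x + b) + (1 - t) * \int[nu2]_x (1 * f x + b).
  have mg : measurable_fun setT (fun x : borel E => (1 * f x + b)%:E).
    by apply/measurable_EFinP; apply: measurable_funD => //; apply: measurable_funM.
  have bg x : `|1 * f x + b| <= b + `|b|.
    by rewrite mul1r; apply: le_trans (ler_normD _ _) _; rewrite lerD.
  have g0 x : (0 <= (1 * f x + b)%:E)%E.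
    by have := fb x; rewrite ler_norml lee_fin mul1r => /andP[? ?]; lra.
  have fin (P : M1 E) : (\int[P]_x (1 * f x + b)%:E)%E \is a fin_num.
    apply: integrable_fin_num => //; apply: (bounded_integrable P _ bg).
    by apply/measurable_EFinP.
  rewrite /Rintegral (eq_measure_integral m); last by move=> A _ _; exact: nuE.
  rewrite ge0_integral_measure_add// !ge0_integral_mscale//=.
  by rewrite fineD ?fineM// fin_numM.
move: pos; rewrite !(Rintegral_affine _ _ _ mf fb) !mul1r.
rewrite !mulrDr addrACA -mulrDl (_ : t + (1 - t) = 1); last by rewrite subrKC.
by rewrite mul1r => /addIr.
Qed.

(** Binary convexity iterated. Weights are not normalized, which keeps the
   induction hypothesis applicable to a tail of the sequence. *)
Lemma finite_mixture (I : eqType) (C : set (M1 E)) (w : I -> R) (c : I -> M1 E) (s : seq I) :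
  convex_measures C -> (forall i, 0 <= w i) -> (forall i, C (c i)) ->
  0 < \sum_(i <- s) w i ->
  exists2 a, C a & forall f b, measurable_fun setT f -> (forall x, `|f x| <= b) ->
    (\sum_(i <- s) w i) * \int[a]_x f x = \sum_(i <- s) w i * \int[c i]_x f x.
Proof.
move=> convC w0 Cc; elim: s => [|j s IH]; first by rewrite big_nil ltxx.
rewrite big_cons; set W := \sum_(i <- s) w i => W1.
have : 0 <= W by exact: sumr_ge0.
rewrite le_eqVlt => /orP[/eqP WE|W0].
  exists (c j) => // f b mf fb; rewrite big_cons -WE addr0.
  have := psumr_eq0 s (fun i (_ : xpredT i) => w0 i); rewrite -/W -WE eqxx.
  move=> /esym/allP ws; rewrite big1_seq ?addr0// => i /= si.
  by rewrite (eqP (ws _ si)) mul0r.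
have [a Ca aE] := IH W0.
have t01 : 0 <= w j / (w j + W) <= 1.
  rewrite divr_ge0 ?(ltW W1) ?(ltW W0)//= ler_pdivrMr// mul1r lerDl.
  exact: ltW.
have [nu [mix nuE]] := mixture_exists (c j) a t01.
exists nu; first exact: convC mix.
move=> f b mf fb; rewrite big_cons -(aE f b)// (nuE f b)//.
rewrite -/W; move: (w j) W W1 {W0 aE IH t01 mix nuE} => v W W1.
by field; rewrite gt_eqF.
Qed.

End mixtures.

Section near_minimizers.
Context (R : realType) (E : pointedMetricType R).
Hypothesis cE : compact [set: E].
Variables (alpha : M1 E) (C : set (M1 E)).
Implicit Types (nu : M1 E) (g : borel E -> R).

(** The density is determined up to an alpha-null set, and lne 0 = -oo while
   ln 0 = 0; the two integrands agree nu-almost everywhere. *)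
Lemma relative_entropyE nu g : density alpha nu g ->
  relative_entropy nu alpha = (\int[nu]_x (ln (g x))%:E)%E.
Proof.
move=> dg; have [mg g0 nuE] := dg.
have nua := density_dominates dg.
rewrite /relative_entropy; case: pselect => // nua'.
set f := Radon_Nikodym _ _.
have ffin x : f x \is a fin_num by exact: Radon_Nikodym_fin_num.
have fi : alpha.-integrable setT f by exact: Radon_Nikodym_integrable.
have mf : measurable_fun setT f := measurable_int _ fi.
have h1 : ae_eq alpha setT f (EFin \o g).
  apply: ae_eq_trans (density_RN dg).
  by apply: ae_eq_sym; exact: ae_eq_Radon_Nikodym_SigmaFinite.
have h2 : ae_eq nu setT f (EFin \o g) by exact: null_dominates_ae_eq h1.
have mln : measurable_fun setT (fun x => (ln (g x))%:E).
  by apply/measurable_EFinP/measurableT_comp => //; exact: measurable_ln.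
have lneE : (fun x => lne (f x)) =
    (fun x => if (0 < fine (f x))%R then (ln (fine (f x)))%:E else -oo%E).
  apply/funext => x; rewrite -{1}(fineK (ffin x)); case: ifPn => [|/negbTE fx].
    exact: lne_EFin.
  by rewrite le0_lneNy// lee_fin leNgt fx.
apply: ae_eq_integral => //.
  rewrite lneE; have mff : measurable_fun setT (fun x => fine (f x)).
    by apply: measurableT_comp => //; exact: fine_measurable.
  apply: measurable_fun_ifT => //.
    by apply: measurable_fun_ltr.
  by apply/measurable_EFinP/measurableT_comp => //; exact: measurable_ln.
have h3 : {ae nu, forall x, g x != 0}.
  exists [set x | g x = 0]; split.
  - by rewrite -[X in measurable X]setTI; exact: (mg measurableT _ (measurable_set1 0)).
  - exact: density_gt0 dg.
  - by move=> x /= /negP; rewrite negbK => /eqP.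
apply: filterS2 h2 h3 => x /(_ I) /= fg gx0 _.
by rewrite fg lne_EFin// lt_neqAle eq_sym gx0 g0.
Qed.

(** The Fortet-Mourier neighbourhood of C. It serves for both metrics, since each
   of them dominates the Fortet-Mourier one, and it is stable under mixtures. *)
Definition neighborhood (r : R) : set (M1 E) := [set nu | exists2 a, C a & fm_close r a nu].

Lemma neighborhood_mono r s : r <= s -> neighborhood r `<=` neighborhood s.
Proof.
by move=> rs nu [a Ca ar]; exists a => // f /ar/le_trans; apply.
Qed.

Lemma fm_close_density (e : R) nu1 nu2 g1 g2 :
  density alpha nu1 g1 -> density alpha nu2 g2 ->
  (\int[alpha]_x `|g1 x - g2 x|%:E <= e%:E)%E -> fm_close e nu1 nu2.
Proof.
move=> d1 d2 h f fb; rewrite -[e]mul1r.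
apply: (density_test d1 d2 _ _ h); first exact: fm_ball_measurable.
exact: fm_ball_bound.
Qed.

Hypothesis convC : convex_measures C.

Lemma neighborhood_midpoint r nu1 nu2 g1 g2 :
  neighborhood r nu1 -> neighborhood r nu2 ->
  density alpha nu1 g1 -> density alpha nu2 g2 ->
  exists2 nu, neighborhood r nu & density alpha nu (fun x => (g1 x + g2 x) / 2).
Proof.
move=> [a1 Ca1 h1] [a2 Ca2 h2] d1 d2.
have t01 : ((0 : R) <= (1 / 2 : R)) && ((1 / 2 : R) <= 1) by apply/andP; split; lra.
have [a [mixa aE]] := mixture_exists a1 a2 t01.
have [nu [mixnu nuE]] := mixture_exists nu1 nu2 t01.
exists nu.
  exists a; first exact: convC mixa.
  move=> f fb; have mf := fm_ball_measurable fb; have f1 := fm_ball_bound fb.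
  rewrite (aE f 1)// (nuE f 1)//; have := h1 f fb; have := h2 f fb.
  by rewrite !ler_norml => /andP[? ?] /andP[? ?]; apply/andP; split; lra.
have [m1 p1 E1] := d1; have [m2 p2 E2] := d2; split.
- by apply: measurable_funM => //; exact: measurable_funD.
- by move=> x; rewrite divr_ge0// addr_ge0.
- move=> A mA; rewrite mixnu// E1// E2//.
  have half x : ((g1 x + g2 x) / 2)%:E = ((1 / 2)%:E * (g1 x)%:E + (1 / 2)%:E * (g2 x)%:E)%E.
    by rewrite -!EFinM -EFinD; congr (_%:E); field.
  under [RHS]eq_integral do rewrite half.
  have mg1 : measurable_fun A (EFin \o g1) by apply/measurable_EFinP; exact: measurable_funTS.
  have mg2 : measurable_fun A (EFin \o g2) by apply/measurable_EFinP; exact: measurable_funTS.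
  rewrite ge0_integralD//.
  + rewrite !ge0_integralZl_EFin//.
    * by congr (_ + _%:E * _)%E; field.
    * by move=> x _; rewrite lee_fin.
    * by move=> x _; rewrite lee_fin.
  + by move=> x _; rewrite mule_ge0 ?lee_fin.
  + exact: emeasurable_funM.
  + by move=> x _; rewrite mule_ge0 ?lee_fin.
  + exact: emeasurable_funM.
Qed.

Definition entropy_bound (r c : R) := forall nu g,
  neighborhood r nu -> density alpha nu g -> (c%:E <= entropy alpha g)%E.

Lemma near_minimizers_close (r a b c s : R) nu1 nu2 g1 g2 : 0 < s ->
  entropy_bound r c -> neighborhood r nu1 -> neighborhood r nu2 ->
  density alpha nu1 g1 -> density alpha nu2 g2 ->
  (entropy alpha g1 <= a%:E)%E -> (entropy alpha g2 <= b%:E)%E ->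
  (\int[alpha]_x `|g1 x - g2 x|%:E <= (12 / s * ((a + b) / 2 - c) + s / 2)%:E)%E.
Proof.
move=> s0 hc n1 n2 d1 d2 e1 e2.
have [nu nn dn] := neighborhood_midpoint n1 n2 d1 d2.
exact: entropy_gap d1 d2 s0 e1 e2 (hc _ _ nn dn).
Qed.

Hypothesis closedC : closed C.
Variables (Q : M1 E) (h : borel E -> R) (H : R).
Hypothesis CQ : C Q.
Hypothesis dh : density alpha Q h.
Hypothesis hH : entropy alpha h = H%:E.
Hypothesis minH : forall nu g, C nu -> density alpha nu g -> (H%:E <= entropy alpha g)%E.

Let neighborhood_Q (r : R) : 0 <= r -> neighborhood r Q.
Proof. by move=> r0; exists Q => // f _; rewrite subrr normr0. Qed.

(** The infimum I(r) of the entropy over the r-neighbourhood increases to some H0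
   as r decreases to 0. Near-minimizers taken at suitable radii form a fast
   Cauchy sequence in L1 by near_minimizers_close; the limit has entropy at most
   H0 by Fatou and belongs to C because C is closed. Hence H <= H0. *)
Lemma entropy_neighborhood (eta : R) : 0 < eta ->
  exists2 r : R, 0 < r & entropy_bound r (H - eta).
Proof.
move=> eta0; apply: contrapT => noR.
have low (r : R) : 0 < r -> exists nu g, [/\ neighborhood r nu, density alpha nu g &
    (entropy alpha g <= (H - eta)%:E)%E].
  move=> r0; apply: contrapT => nex; apply: noR; exists r => // nu g nr dg.
  by rewrite leNgt; apply/negP => /ltW lt; apply: nex; exists nu, g.
pose V r := [set e : R | exists nu g, [/\ neighborhood r nu, density alpha nu g &
    (entropy alpha g <= e%:E)%E]].
have V_lb r : lbound (V r) 0.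
  by move=> e [nu [g [_ dg ge]]]; rewrite -lee_fin (le_trans (entropy_ge0 dg)).
have V_in (r : R) : 0 < r -> V r (H - eta) by move=> /low.
pose I r := inf (V r).
have I_le r e : V r e -> I r <= e by move=> ?; apply: ge_inf => //; exists 0; exact: V_lb.
have I_bound (r : R) : 0 < r -> entropy_bound r (I r).
  move=> r0 nu g nr dg.
  have : (0 <= entropy alpha g)%E by exact: entropy_ge0 dg.
  case eE: (entropy alpha g) => [e| |] e0; [|by rewrite leey|by []].
   by rewrite lee_fin; apply: I_le; exists nu, g; rewrite eE; split.
pose J := [set I r | r in [set r : R | 0 < r]].
have J_ub : ubound J (H - eta) by move=> _ [r r0 <-]; apply: I_le; exact: V_in.
have J_sup : has_sup J by split; [by exists (I 1); exists 1 => //=; exact: ltr01|by exists (H - eta)].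
pose H0 := sup J.
have H0_le : H0 <= H - eta by apply: ge_sup => //; case: J_sup.
have I_H0 (r : R) : 0 < r -> I r <= H0.
  by move=> r0; apply: sup_upper_bound => //; exists r.
(* with s = 2^-j, near_minimizers_close gives 2^-j exactly when the entropies are
   within 4^-j / 48 of H0 *)
pose kap (j : nat) : R := (2^-1 ^+ j) ^+ 2 / 48.
have kap0 j : 0 < kap j by rewrite divr_gt0// exprn_gt0// exprn_gt0.
have rho_ex j : {r : R | 0 < r /\ H0 - kap j < I r}.
  apply: cid; have [_ [r r0 <-] hr] := sup_adherent (kap0 j) J_sup.
  by exists r.
pose rho j := proj1_sig (rho_ex j).
have rho0 j : 0 < rho j by have [] := proj2_sig (rho_ex j).
have rhoI j : H0 - kap j < I (rho j) by have [] := proj2_sig (rho_ex j).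
pose rad := fix rad j : R := if j is i.+1
  then Num.min (rad i) (Num.min (rho i.+1) (i.+2%:R^-1))
  else Num.min (rho 0%N) 1.
have rad0 j : 0 < rad j.
  by elim: j => [|j IH] /=; rewrite !lt_min rho0 ?ltr01 ?IH ?invr_gt0 ?ltr0n.
have rad_rho j : rad j <= rho j by case: j => [|j] /=; rewrite !ge_min lexx ?orbT.
have rad_dec j : rad j.+1 <= rad j by rewrite /= ge_min lexx.
have rad_small j : rad j <= j.+1%:R^-1.
  by case: j => [|j] /=; rewrite !ge_min ?invr1 lexx ?orbT.
have seq_ex j : {p : M1 E * (borel E -> R) | [/\ neighborhood (rad j) p.1,
    density alpha p.1 p.2 & (entropy alpha p.2 <= (H0 + kap j)%:E)%E]}.
  apply: cid.
  have : I (rad j) < H0 + kap j.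
    by apply: le_lt_trans (I_H0 _ (rad0 j)) _; rewrite ltrDl.
  move=> /inf_lt -[|e [nu [g [nn dg ge]]] eH].
    by exists (H - eta); exact: V_in.
  by exists (nu, g); split => //; apply: le_trans ge _; rewrite lee_fin ltW.
pose mu j := (proj1_sig (seq_ex j)).1; pose g j := (proj1_sig (seq_ex j)).2.
have nmu j : neighborhood (rad j) (mu j) by have [] := proj2_sig (seq_ex j).
have dg j : density alpha (mu j) (g j) by have [] := proj2_sig (seq_ex j).
have eg j : (entropy alpha (g j) <= (H0 + kap j)%:E)%E by have [] := proj2_sig (seq_ex j).
have kap_dec j : kap j.+1 <= kap j.
  rewrite /kap ler_wpM2r// [2^-1 ^+ j.+1]exprS exprMn; set t := 2^-1 ^+ j.
  by have := sqr_ge0 t; lra.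
have fast j : (\int[alpha]_x `|g j x - g j.+1 x|%:E <= (2^-1 ^+ j)%:E)%E.
  have n1 := neighborhood_mono (rad_rho j) (nmu j).
  have n2 : neighborhood (rho j) (mu j.+1).
    exact: neighborhood_mono (le_trans (rad_dec j) (rad_rho j)) _ (nmu j.+1).
  have e2 : (entropy alpha (g j.+1) <= (H0 + kap j)%:E)%E.
    by apply: le_trans (eg j.+1) _; rewrite lee_fin lerD2l.
  have s0 : 0 < 2^-1 ^+ j :> R by rewrite exprn_gt0.
  apply: le_trans (near_minimizers_close s0 (I_bound _ (rho0 j)) n1 n2 (dg j) (dg j.+1) (eg j) e2) _.
  rewrite lee_fin; have := rhoI j; rewrite /kap; move: (I _) => i.
  set t := 2^-1 ^+ j in s0 * => hi.
  have : 12 / t * ((H0 + t ^+ 2 / 48 + (H0 + t ^+ 2 / 48)) / 2 - i) <= 12 / t * (t ^+ 2 / 24).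
    by rewrite ler_wpM2l ?divr_ge0 ?(ltW s0)//; lra.
  have -> : 12 / t * (t ^+ 2 / 24) = t / 2 by field; rewrite gt_eqF.
  lra.
have ent_lim e : 0 < e -> exists N, forall n, (N <= n)%N ->
    (entropy alpha (g n) <= (H0 + e)%:E)%E.
  move=> e0.
  have := @cvg_geometric R 1 2^-1.
  have : `|2^-1| < 1 :> R by rewrite ger0_norm ?invr_ge0// invf_lt1// ltr1n.
  have e1 : 0 < Num.min e 1 by rewrite lt_min e0 ltr01.
  move=> + hc => /hc /cvgr_dist_le /(_ _ e1) [N _ hN].
  exists N => n Nn; apply: le_trans (eg n) _; rewrite lee_fin lerD2l.
  have := hN n Nn; rewrite /= sub0r normrN /geometric/= mul1r.
  rewrite ger0_norm ?exprn_ge0// /kap le_min; set t := 2^-1 ^+ n => /andP[te t1].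
  have : 0 <= t by rewrite exprn_ge0.
  by move=> t0; nra.
have [nuoo [goo [doo eoo distoo]]] := density_complete dg fast ent_lim.
have : C nuoo.
  apply: (narrow_closed_fm cE closedC) => r r0.
  have r2 : 0 < r / 2 by rewrite divr_gt0.
  have [j [jr1 jr2]] : exists j : nat, rad j <= r / 2 /\ 2 * 2^-1 ^+ j <= r / 2.
    have := @cvg_geometric R 2 2^-1.
    have : `|2^-1| < 1 :> R by rewrite ger0_norm ?invr_ge0// invf_lt1// ltr1n.
    move=> + hc => /hc /cvgr_dist_le /(_ _ r2) [N _ hN].
    have [M] := @ltr_add_invr R 0 _ r2; rewrite add0r => hM.
    exists (maxn N M); split.
      apply: le_trans (rad_small _) (le_trans _ (ltW hM)).
      by rewrite lef_pV2 ?posrE ?ltr0n// ler_nat ltnS leq_maxr.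
    have := hN _ (leq_maxl N M).
    by rewrite /= sub0r normrN /geometric/= ger0_norm// mulr_ge0// exprn_ge0.
  have [a Ca aj] := nmu j; exists a => //.
  rewrite (splitr r) => f fb.
  have h1 := aj f fb.
  have h2 := fm_close_density (dg j) doo (distoo j) fb.
  apply: le_trans (ler_distD (\int[mu j]_x f x) _ _) _.
  by rewrite lerD// ?(le_trans h1)// (le_trans h2).
move=> /minH/(_ doo)/le_trans/(_ eoo); rewrite lee_fin; lra.
Qed.

(** Uniqueness of the projection, made quantitative and stable under small
   enlargements of C. *)
Lemma near_projection_close (tau : R) : 0 < tau ->
  exists r eta : R, [/\ 0 < r, 0 < eta & forall nu g, neighborhood r nu ->
    density alpha nu g -> (entropy alpha g <= (H + eta)%:E)%E ->
    (\int[alpha]_x `|g x - h x|%:E <= tau%:E)%E].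
Proof.
(* 12 / tau * (3 / 2 * eta) = tau / 2 *)
move=> tau0; pose eta := tau ^+ 2 / 36.
have eta0 : 0 < eta by rewrite divr_gt0// exprn_gt0.
have [r r0 rH] := entropy_neighborhood eta0.
exists r, eta; split => // nu g nr dg ge.
have hle : (entropy alpha h <= H%:E)%E by rewrite hH.
have := near_minimizers_close tau0 rH nr (neighborhood_Q (ltW r0)) dg dh ge hle.
move=> /le_trans; apply; rewrite lee_fin /eta le_eqVlt; apply/orP; left; apply/eqP.
by field; rewrite gt_eqF.
Qed.

End near_minimizers.

(** * Change of measure and the lower bound *)

Section push_forward.
Context d1 d2 (T1 : measurableType d1) (T2 : measurableType d2) (R : realType).
Variables (mu : probability T1 R) (nu : probability T2 R) (X : T1 -> T2).
Hypothesis mX : measurable_fun setT X.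
Hypothesis law : forall A, measurable A -> mu (X @^-1` A) = nu A.

Lemma ge0_integral_law (F : T2 -> \bar R) : measurable_fun setT F ->
  (forall y, (0 <= F y)%E) -> (\int[mu]_x F (X x) = \int[nu]_y F y)%E.
Proof.
move=> mF F0.
pose X' : {mfun T1 >-> T2} := HB.pack X (isMeasurableFun.Build _ _ _ _ X mX).
transitivity (\int[distribution mu X']_y F y)%E.
  by rewrite ge0_integral_distribution.
by apply: eq_measure_integral => A mA _; exact: law.
Qed.

Lemma integrable_law (f : T2 -> R) : measurable_fun setT f ->
  nu.-integrable setT (fun y => (f y)%:E) ->
  mu.-integrable setT (fun x => (f (X x))%:E) /\
  \int[mu]_x f (X x) = \int[nu]_y f y.
Proof.
move=> mf fi; have mfX := measurableT_comp mf mX.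
have mf' : measurable_fun setT (fun y => (f y)%:E) by exact/measurable_EFinP.
split.
  apply/integrableP; split; first exact/measurable_EFinP.
  rewrite (@ge0_integral_law (fun y => `|(f y)%:E|)%E)//.
    by have /integrableP[] := fi.
  exact: measurableT_comp.
rewrite /Rintegral integralE [in RHS]integralE; congr (fine (_ - _)).
  rewrite -(ge0_integral_law (measurable_funepos mf'))//.
  by apply: eq_integral => x _; rewrite !funeposE.
rewrite -(ge0_integral_law (measurable_funeneg mf'))//.
by apply: eq_integral => x _; rewrite !funenegE.
Qed.

End push_forward.

Lemma Rintegral_fin_sum d (T : measurableType d) (R : realType)
    (mu : probability T R) (I : Type) (s : seq I) (f : I -> T -> R) :
  (forall i, mu.-integrable setT (fun x => (f i x)%:E)) ->
  \int[mu]_x (\sum_(i <- s) f i x) = \sum_(i <- s) \int[mu]_x f i x.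
Proof.
move=> fi; rewrite /Rintegral; under eq_integral do rewrite -sumEFin.
by rewrite integral_sum// sum_fine// => i _; exact: integrable_fin_num.
Qed.

Lemma product_law_coordinate d (T : measurableType d) (R : realType)
    (P : probability T R) n i A : (i < n)%N -> measurable A ->
  product_law P n [set x | A (nth point x i)] = P A.
Proof.
move=> ni mA.
have mB : measurable [set x : n.-tuple T | A (nth point x i)].
  by rewrite -[X in measurable X]setTI; exact: measurable_nth_tuple.
transitivity (\int[product_law P n]_x (\1_A (nth point x i))%:E)%E.
  rewrite (eq_integral (fun x => (\1_[set x : n.-tuple T | A (nth point x i)] x)%:E))//.
  by rewrite integral_indic// setIT.
rewrite (integral_nth P (F := fun t => (\1_A t)%:E))//.
- by rewrite integral_indic// setIT.
- by apply/measurable_EFinP; exact: measurable_indic.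
Qed.

Lemma ae_le_Rintegral d (T : measurableType d) (R : realType)
    (mu : probability T R) (f g : T -> R) :
  mu.-integrable setT (fun x => (f x)%:E) -> mu.-integrable setT (fun x => (g x)%:E) ->
  {ae mu, forall x, f x <= g x} -> \int[mu]_x f x <= \int[mu]_x g x.
Proof.
move=> fi gi fg; have gfi := integrableB measurableT gi fi.
rewrite -subr_ge0 -RintegralB// /Rintegral; apply: fine_ge0.
have mgf : measurable_fun setT (fun x => (g x - f x)%:E) by exact: measurable_int gfi.
rewrite (ae_eq_integral (fun x => (g x - f x)%:E)^\+%E)//.
- exact: integral_ge0.
- exact: measurable_funepos.
- apply: filterS fg => x fgx _; rewrite funeposE.
  by apply/esym/max_idPl; rewrite lee_fin subr_ge0.
Qed.

Section sums_of_coordinates.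
Context d (T : measurableType d) (R : realType).
Variables (n : nat) (mu : probability (n.-tuple T) R) (nu : probability T R).
Hypothesis law : forall i A, (i < n)%N -> measurable A ->
  mu [set x | A (nth point x i)] = nu A.

Lemma integrable_coordinate_sum (f : T -> R) : measurable_fun setT f ->
  nu.-integrable setT (fun t => (f t)%:E) ->
  mu.-integrable setT (fun x : n.-tuple T => (\sum_(i < n) f (tnth x i))%:E) /\
  \int[mu]_x (\sum_(i < n) f (tnth x i)) = n%:R * \int[nu]_t f t.
Proof.
move=> mf fi.
have h (i : 'I_n) : mu.-integrable setT (fun x : n.-tuple T => (f (tnth x i))%:E) /\
    \int[mu]_x f (tnth x i) = \int[nu]_t f t.
  have mX : measurable_fun setT (fun x : n.-tuple T => nth point x i).
    exact: measurable_nth_tuple.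
  have := integrable_law mX (fun A mA => law (ltn_ord i) mA) mf fi.
  rewrite (_ : (fun x : n.-tuple T => f (tnth x i)) = (fun x : n.-tuple T => f (nth point x i))).
    by rewrite (_ : (fun x => (f (tnth x i))%:E) = (fun x : n.-tuple T => (f (nth point x i))%:E))//;
      apply/funext => x; rewrite (tnth_nth point).
  by apply/funext => x; rewrite (tnth_nth point).
split.
  under eq_fun do rewrite -sumEFin.
  by apply: integrable_sum => // i _; have [] := h i.
rewrite Rintegral_fin_sum; last by move=> i; have [] := h i.
by rewrite (eq_bigr (fun=> \int[nu]_t f t)) ?sumr_const ?card_ord ?mulr_natl// => i _; have [] := h i.
Qed.

End sums_of_coordinates.

Section change_of_measure.
Context d (T : measurableType d) (R : realType).
Variables (alpha Q : probability T R) (h : T -> R) (H : R).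
Hypothesis dh : density alpha Q h.
Hypothesis hH : entropy alpha h = H%:E.

(** exp (- ln h) inverts the density where h > 0; where h = 0, the measure Q has
   no mass and the left-hand side loses the corresponding part of alpha. *)
Lemma le_integral_inverse_density (F : T -> \bar R) : measurable_fun setT F ->
  (forall x, 0 <= F x)%E ->
  (\int[Q]_x (F x * (expR (- ln (h x)))%:E) <= \int[alpha]_x F x)%E.
Proof.
have [mh h0 _] := dh; move=> mF F0.
have mw : measurable_fun setT (fun x => (expR (- ln (h x)))%:E).
  apply/measurable_EFinP; apply: measurableT_comp => //.
  apply: measurableT_comp => //; apply: measurableT_comp => //; exact: measurable_ln.
rewrite (density_integral dh); last 2 first.
- exact: emeasurable_funM.
- by move=> x; rewrite mule_ge0// lee_fin expR_ge0.
apply: ge0_le_integral => //.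
- by move=> x _; rewrite !mule_ge0// lee_fin ?expR_ge0.
- apply: emeasurable_funM; last exact/measurable_EFinP.
  exact: emeasurable_funM.
- move=> x _; rewrite -muleA -[leRHS]mule1 lee_wpmul2l// -EFinM lee_fin.
  have := h0 x; rewrite le_eqVlt => /orP[/eqP <-|hx]; first by rewrite mulr0 ler01.
  by rewrite expRN lnK ?posrE// mulVf// gt_eqF.
Qed.

(** Cramer's lower bound. Let Y be the log-likelihood ratio \sum_i ln h (x_i), of
   Q-mean n * H. Integrating exp (c - Y) >= 1 + c - Y over S and
   exp (- Y) >= 1 - Y over its complement, and using that exp (- Y) turns Q into
   at most alpha, yields exp c * alpha(S) >= c * Q(S) - n * H. No law of large
   numbers for Y enters. *)
Lemma product_law_lower_bound n (S : set (n.-tuple T)) (c q : R) :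
  measurable S -> (product_law Q n (~` S) <= q%:E)%E ->
  n%:R * H + 1 <= c * (1 - q) -> 0 <= c ->
  ((expR (- c))%:E <= product_law alpha n S)%E.
Proof.
move=> mS qS hc c0.
have hfin : (entropy alpha h < +oo)%E by rewrite hH ltry.
have [mh h0 _] := dh; have [lni lnE] := entropy_ln dh hfin.
have mln : measurable_fun setT (fun x => ln (h x)).
  by apply: measurableT_comp => //; exact: measurable_ln.
have [Yi YE] := integrable_coordinate_sum (@product_law_coordinate _ _ _ Q n) mln lni.
set Y := fun x : n.-tuple T => \sum_(i < n) ln (h (tnth x i)) in Yi YE.
have YH : \int[product_law Q n]_x Y x = n%:R * H.
  by rewrite YE /Rintegral lnE hH.
have mY : measurable_fun setT Y by move/measurable_int : Yi => /measurable_EFinP.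
pose W x := expR (- Y x).
have WE x : W x = \prod_(i < n) expR (- ln (h (tnth x i))).
  by rewrite /W /Y -sumrN expR_sum.
have mW : measurable_fun setT W by apply: measurableT_comp => //; exact: measurableT_comp.
have W0 x : 0 <= W x by exact: expR_ge0.
have tilt A : measurable A ->
    (\int[product_law Q n]_x (\1_A x * W x)%:E <= product_law alpha n A)%E.
  move=> mA; rewrite (_ : product_law alpha n A = \int[product_law alpha n]_x (\1_A x)%:E)%E; last first.
    by rewrite integral_indic// setIT.
  have mw : measurable_fun setT (fun x => expR (- ln (h x))).
    by apply: measurableT_comp => //; exact: measurableT_comp.
  have m1 : measurable_fun setT (fun x : n.-tuple T => (\1_A x)%:E : \bar R).
    by apply/measurable_EFinP; exact: measurable_indic.
  have := le_integral_weight mw (fun x => expR_ge0 _) le_integral_inverse_density m1.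
  move=> h1; apply: le_trans (h1 _); last by move=> x; rewrite lee_fin.
  by rewrite le_eqVlt; apply/orP; left; apply/eqP; apply: eq_integral => x _; rewrite WE.
have Wi A : measurable A -> (product_law Q n).-integrable setT (fun x => (\1_A x * W x)%:E).
  move=> mA; apply/integrableP; split.
    by apply/measurable_EFinP; apply: measurable_funM => //; exact: measurable_indic.
  rewrite (eq_integral (fun x => (\1_A x * W x)%:E)).
    by apply: le_lt_trans (tilt A mA) _; rewrite ltey_eq fin_num_measure.
  by move=> x _; rewrite abse_EFin ger0_norm// mulr_ge0.
have tiltR A : measurable A ->
    \int[product_law Q n]_x (\1_A x * W x) <= fine (product_law alpha n A).
  move=> mA; rewrite -lee_fin probability_fineK// /Rintegral fineK; first exact: tilt.
  by apply: integrable_fin_num => //; exact: Wi.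
have mSC := measurableC mS.
have Ii A : measurable A -> (product_law Q n).-integrable setT (fun x => (\1_A x : R)%:E).
  move=> mA; apply: (@bounded_integrable _ _ _ _ _ 1); first exact: measurable_indic.
  by move=> x; exact: normr_indic_le1.
have i1 : (product_law Q n).-integrable setT (fun=> 1%:E : \bar R).
  exact: (@bounded_integrable _ _ _ _ (cst 1) `|1|).
have iY : (product_law Q n).-integrable setT (EFin \o (fun x => 1 - Y x)).
  exact: (integrableB measurableT i1 Yi).
have ic := integrableZl measurableT c (Ii _ mS).
have iW := integrableZl measurableT (expR c) (Wi _ mS).
have key : 1 - n%:R * H + c * fine (product_law Q n S) <=
    expR c * fine (product_law alpha n S) + 1.
  apply: (@le_trans _ _ (\int[product_law Q n]_x (expR c * (\1_S x * W x) + \1_(~` S) x * W x))).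
    have -> : 1 - n%:R * H + c * fine (product_law Q n S) =
        \int[product_law Q n]_x ((1 - Y x) + c * \1_S x).
      rewrite RintegralD// RintegralB//.
      by rewrite RintegralZl ?Rintegral_indic// ?Rintegral_cst1 ?YH//; exact: Ii.
    apply: le_Rintegral => //.
    - exact: (integrableD measurableT iY ic).
    - exact: (integrableD measurableT iW (Wi _ mSC)).
    move=> x _; rewrite !indicE in_setC; case: (_ \in _) => /=.
      rewrite mul0r addr0 mul1r mulr1 /W -expRD.
      by apply: le_trans (expR_ge1Dx _); lra.
    rewrite mul0r !mulr0 add0r mul1r addr0 /W.
    by apply: le_trans (expR_ge1Dx _); lra.
  rewrite RintegralD//; last exact: Wi.
  rewrite RintegralZl//; last exact: Wi.
  rewrite lerD ?ler_wpM2l ?expR_ge0 ?tiltR//.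
  exact: le_trans (tiltR _ mSC) (fine_probability_le1 _ mSC).
have QS : 1 - q <= fine (product_law Q n S).
  have := fine_probabilityC (product_law Q n) mS.
  have : fine (product_law Q n (~` S)) <= q by rewrite -lee_fin probability_fineK.
  lra.
rewrite -probability_fineK// lee_fin expRN -[leLHS]mul1r ler_pdivrMr ?expR_gt0//.
have := ler_wpM2l c0 QS; lra.
Qed.

End change_of_measure.

(** * The conditioned law and its barycenter *)

Section exchangeability.
Context d (T : measurableType d) (R : realType).

(** Equality of the terms, not only on Borel sets: the event is defined through an
   arbitrary set of probability measures. *)
Lemma empirical_subtuple n (s : nat -> nat) (x : n.-tuple T) :
  (forall i, (i < n)%N -> (s i < n)%N) ->
  (forall i j, (i < n)%N -> (j < n)%N -> s i = s j -> i = j) ->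
  empirical R (subtuple n s x) = empirical R x.
Proof.
move=> sn sI; rewrite /empirical.
suff -> : msum (fun i => \d_(nth point (subtuple n s x) i) : {measure set T -> \bar R}) n =
  msum (fun i => \d_(nth point x i)) n :> {measure set T -> \bar R} by [].
apply: eq_measure; apply/funext => A; rewrite /= /msum.
pose f (i : 'I_n) := Ordinal (sn i (ltn_ord i)).
have fI : injective f.
  by move=> i j [] /(sI _ _ (ltn_ord i) (ltn_ord j)) ?; exact: val_inj.
rewrite [RHS](reindex_inj fI)/=; apply: eq_bigr => i _.
by have := tnth_mktuple (fun i : 'I_n => nth point x (s i)) i; rewrite (tnth_nth point)/= => ->.
Qed.

Variables (alpha : probability T R) (n : nat) (S : set (n.-tuple T)) (p : R).
Hypothesis mS : measurable S.
Hypothesis pS : product_law alpha n S = p%:E.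
Hypothesis p_gt0 : 0 < p.

(** mu is the law of the sample given S, when p is the probability of S. *)
Definition conditioned (mu : probability (n.-tuple T) R) :=
  density (product_law alpha n) mu (fun x => p^-1 * \1_S x).

Lemma conditioned_exists : exists mu, conditioned mu.
Proof.
apply: probability_of_density.
- by apply: measurable_funM => //; exact: measurable_indic.
- by move=> x; rewrite mulr_ge0// invr_ge0 ltW.
- under eq_integral do rewrite EFinM.
  rewrite ge0_integralZl_EFin//; last 2 first.
  - by apply/measurable_EFinP; exact: measurable_indic.
  - by rewrite invr_ge0 ltW.
  rewrite (_ : \int[_]_x _ = p%:E)%E; first by rewrite -EFinM mulVf// gt_eqF.
  by rewrite integral_indic// setIT.
Qed.

Variable mu : probability (n.-tuple T) R.
Hypothesis cmu : conditioned mu.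

Lemma conditionedE A : measurable A ->
  (mu A = product_law alpha n (A `&` S) * (p^-1)%:E)%E.
Proof.
have [_ _ muE] := cmu; move=> mA; rewrite muE//.
under eq_integral do rewrite EFinM.
rewrite ge0_integralZl_EFin//; last 2 first.
- by apply/measurable_EFinP; apply: measurable_funTS; exact: measurable_indic.
- by rewrite invr_ge0 ltW.
by rewrite integral_indic// muleC setIC.
Qed.

Lemma conditioned_le (F : n.-tuple T -> \bar R) : measurable_fun setT F ->
  (forall x, 0 <= F x)%E ->
  (\int[mu]_x F x <= (p^-1)%:E * \int[product_law alpha n]_x F x)%E.
Proof.
move=> mF F0; rewrite (density_integral cmu)//.
have p1 : 0 <= p^-1 by rewrite invr_ge0 ltW.
rewrite -ge0_integralZl_EFin//; apply: ge0_le_integral => //.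
- by move=> x _; rewrite mule_ge0// lee_fin mulr_ge0.
- apply: emeasurable_funM => //; apply/measurable_EFinP.
  by apply: measurable_funM => //; exact: measurable_indic.
- exact: emeasurable_funM.
- move=> x _; rewrite muleC lee_wpmul2r// lee_fin -[leRHS]mulr1 ler_wpM2l//.
Qed.

Hypothesis invS : forall s x, (forall i, (i < n)%N -> (s i < n)%N) ->
  (forall i j, (i < n)%N -> (j < n)%N -> s i = s j -> i = j) ->
  S (subtuple n s x) = S x.

Lemma conditioned_subtuple s A : (forall i, (i < n)%N -> (s i < n)%N) ->
  (forall i j, (i < n)%N -> (j < n)%N -> s i = s j -> i = j) -> measurable A ->
  mu (@subtuple _ T n n s @^-1` A) = mu A.
Proof.
move=> sn sI mA; have mP : measurable (@subtuple _ T n n s @^-1` A).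
  by rewrite -[X in measurable X]setTI; exact: measurable_subtuple.
rewrite !conditionedE//; congr (_ * _)%E.
rewrite -[RHS](product_law_subtuple alpha sn sI); last exact: measurableI.
by congr (product_law alpha n _); apply/seteqP; split => x /= []; rewrite invS.
Qed.

(** The rotation by j * k preserves both alpha^n and the event, and moves block j to
   the front. *)
Lemma conditioned_block k j A : (j * k + k <= n)%N -> measurable A ->
  mu (@block _ T k n j @^-1` A) = mu (@block _ T k n 0 @^-1` A).
Proof.
move=> jk mA.
pose s i := ((i + j * k) %% n)%N.
have sn i : (i < n)%N -> (s i < n)%N by move=> h; rewrite ltn_mod (leq_ltn_trans _ h).
have sI i i' : (i < n)%N -> (i' < n)%N -> s i = s i' -> i = i'.
  by move=> lti lti' /eqP; rewrite eqn_modDr !modn_small// => /eqP.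
have mP : measurable (@block _ T k n 0 @^-1` A).
  by rewrite -[X in measurable X]setTI; exact: measurable_block.
rewrite -(conditioned_subtuple sn sI mP); congr (mu _).
apply/funext => x /=; congr (A _); apply: eq_from_tnth => i.
rewrite !tnth_mktuple mul0n add0n.
have ltin : (i < n)%N.
  by apply: leq_trans (ltn_ord i) _; apply: leq_trans jk; exact: leq_addl.
rewrite -[in RHS](_ : nat_of_ord (Ordinal ltin) = i)// -tnth_nth tnth_mktuple.
congr (nth point x _); rewrite /s modn_small addnC//=.
by apply: leq_trans jk; rewrite ltn_add2l.
Qed.

Lemma conditioned_coordinate i A : (i < n)%N -> measurable A ->
  mu [set x | A (nth point x i)] = mu [set x | A (nth point x 0%N)].
Proof.
move=> ni mA; pose B := [set t : 1.-tuple T | A (tnth t ord0)].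
have mB : measurable B by rewrite -[X in measurable X]setTI; exact: measurable_tnth.
have := @conditioned_block 1 i B; rewrite muln1 addn1 => /(_ ni mB).
have E j : @block _ T 1 n j @^-1` B = [set x | A (nth point x j)].
  by apply/funext => x; rewrite /B/= tnth_mktuple muln1 addn0.
by rewrite !E.
Qed.

End exchangeability.

Section conditioned_entropy.
Context d (T : measurableType d) (R : realType).
Variables (alpha : probability T R) (n : nat) (S : set (n.-tuple T)) (p : R).
Hypothesis mS : measurable S.
Hypothesis p_gt0 : 0 < p.
Variables (mu : probability (n.-tuple T) R) (nubar : probability T R).
Hypothesis cmu : conditioned alpha S p mu.
Hypothesis law : forall i A, (i < n)%N -> measurable A ->
  mu [set x | A (nth point x i)] = nubar A.
Hypothesis n_gt0 : (0 < n)%N.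

Lemma barycenter_le (F : T -> \bar R) : measurable_fun setT F ->
  (forall x, 0 <= F x)%E ->
  (\int[nubar]_x F x <= (p^-1)%:E * \int[alpha]_x F x)%E.
Proof.
move=> mF F0; have mn := @measurable_nth_tuple _ T n 0.
rewrite -(ge0_integral_law mn (fun A => law n_gt0) mF F0).
rewrite -(integral_nth alpha n_gt0 mF F0).
apply: (conditioned_le mS p_gt0 cmu (F := fun x => F (nth point x 0%N))) => //.
exact: measurableT_comp.
Qed.

Lemma barycenter_density : exists g, density alpha nubar g.
Proof.
apply: density_exists => A mA A0; apply/eqP; rewrite eq_le measure_ge0 andbT.
have Ii (P : probability T R) : (\int[P]_x (\1_A x)%:E = P A)%E.
  by rewrite integral_indic// setIT.
have := @barycenter_le (fun x => (\1_A x)%:E); rewrite !Ii A0 mule0; apply.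
- by apply/measurable_EFinP; exact: measurable_indic.
- by move=> x; rewrite lee_fin.
Qed.

(** The barycenter is bounded by alpha / p, and the positive part of ln g is at most
   g. *)
Lemma barycenter_entropy g : density alpha nubar g -> (entropy alpha g < +oo)%E.
Proof.
move=> dg; have [mg g0 _] := dg; apply: (entropy_lty dg).
have mln : measurable_fun setT (fun x => (ln (g x))%:E).
  by apply/measurable_EFinP; apply: measurableT_comp => //; exact: measurable_ln.
apply: (@le_lt_trans _ _ (p^-1)%:E); last exact: ltry.
apply: (@le_trans _ _ (\int[nubar]_x ((fun x => (ln (g x))%:E)^\+ x))%E).
  rewrite [leLHS]integralE -[leRHS]sube0 leeB//.
  exact: integral_ge0.
apply: le_trans (barycenter_le _ _) _ => //.
  exact: measurable_funepos.
rewrite -[leRHS]mule1 lee_wpmul2l ?lee_fin ?invr_ge0 ?(ltW p_gt0)//.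
rewrite -(density_mass dg); apply: ge0_le_integral => //.
- exact: measurable_funepos.
- exact/measurable_EFinP.
- move=> x _; rewrite funeposE ge_max !lee_fin g0 andbT.
  have := g0 x; rewrite le_eqVlt => /orP[/eqP <-|gx]; first by rewrite ln0.
  exact: ltW (ln_sublinear gx).
Qed.

Lemma barycenter_positive g : density alpha nubar g ->
  {ae mu, forall x, forall i : 'I_n, 0 < g (tnth x i)}.
Proof.
move=> dg; have [mg g0 _] := dg.
have m0 : measurable [set t | g t = 0].
  by rewrite -[X in measurable X]setTI; exact: (mg measurableT _ (measurable_set1 0)).
have mi i : measurable [set x : n.-tuple T | g (nth point x i) = 0].
  rewrite -[X in measurable X]setTI.
  exact: (@measurable_nth_tuple _ T n i measurableT _ m0).
exists (\big[setU/set0]_(i < n) [set x : n.-tuple T | g (nth point x i) = 0]); split.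
- by apply: bigsetU_measurable => i _; exact: mi.
- apply/eqP; rewrite eq_le measure_ge0 andbT.
  have := @content_subadditive _ _ _ mu
    (\big[setU/set0]_(i < n) [set x : n.-tuple T | g (nth point x i) = 0])
    (fun i => [set x : n.-tuple T | g (nth point x i) = 0]) n.
  move=> /(_ (fun i _ => mi i)); move=> /(_ _ (@subset_refl _ _))/le_trans; apply.
    by apply: bigsetU_measurable => i _; exact: mi.
  rewrite big1// => i _; apply: etrans (law (ltn_ord i) m0) _.
  exact: density_gt0 dg.
- move=> x /= /existsNP[i /negP]; rewrite -leNgt => gi.
  rewrite -(bigcup_mkord n (fun i => [set x : n.-tuple T | g (nth point x i) = 0])); exists i => //=.
  by apply/eqP; rewrite eq_le -tnth_nth gi g0.
Qed.

(** The Gibbs variational principle for Y = \sum_i ln g (x_i) + lam * N under mu,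
   where N counts the blocks that lie in D, applied in the form
   Y <= b - 1 + exp (Y - b). The factor exp (\sum_i ln g (x_i)) turns alpha into
   the barycenter, under which the blocks are independent, so the exponential
   moment under mu is at most exp b, the division by p costing exp c. With lam = 0 this
   bounds the entropy of the barycenter; with lam > 0 it bounds the conditional
   probability of D by its probability under the barycenter. *)
Lemma entropy_block_estimate g k m (D : set (k.-tuple T)) (v c lam : R) :
  density alpha nubar g -> measurable D -> (m * k <= n)%N ->
  (forall j, (j < m)%N -> mu (@block _ T k n j @^-1` D) = v%:E) ->
  expR (- c) <= p -> 0 <= lam <= 1 / 2 ->
  n%:R * fine (entropy alpha g) + m%:R * (lam * v) <=
    c + m%:R * ((lam + 2 * lam ^+ 2) * fine (product_law nubar k D)).
Proof.
move=> dg mD mkn vD pc lam01; have [mg g0 _] := dg.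
have gfin := barycenter_entropy dg.
have [lni lnE] := entropy_ln dg gfin.
have mln : measurable_fun setT (fun x => ln (g x)).
  by apply: measurableT_comp => //; exact: measurable_ln.
have [Li LE] := integrable_coordinate_sum law mln lni.
set L := fun x : n.-tuple T => \sum_(i < n) ln (g (tnth x i)) in Li LE.
have mdi j : measurable_fun setT (fun x : n.-tuple T => \1_D (block k j x) : R).
  have mI : measurable_fun setT (\1_D : k.-tuple T -> R) by exact: measurable_indic.
  by apply: (measurableT_comp mI); exact: measurable_block.
pose N (x : n.-tuple T) : R := \sum_(j < m) \1_D (block k j x).
have di (j : 'I_m) : mu.-integrable setT (fun x => (\1_D (block k j x))%:E).
  apply: (@bounded_integrable _ _ _ _ _ 1) => // x.
  exact: normr_indic_le1.
have Ni : mu.-integrable setT (fun x => (N x)%:E).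
  by rewrite /N; under eq_fun do rewrite -sumEFin; exact: integrable_sum.
have NE : \int[mu]_x N x = m%:R * v.
  rewrite Rintegral_fin_sum// (eq_bigr (fun=> v)) ?sumr_const ?card_ord ?mulr_natl// => j _.
  have mP : measurable (@block _ T k n j @^-1` D).
    by rewrite -[X in measurable X]setTI; exact: measurable_block.
  have -> : \int[mu]_x (\1_D (block k j x)) = \int[mu]_x \1_(@block _ T k n j @^-1` D) x by [].
  by rewrite Rintegral_indic// vD.
set w := fine (product_law nubar k D).
have w0 : 0 <= w by exact: fine_probability_ge0.
have lam0 : 0 <= lam by case/andP: lam01.
pose gam := (lam + 2 * lam ^+ 2) * w.
have gam0 : 0 <= gam by rewrite mulr_ge0// addr_ge0// mulr_ge0// sqr_ge0.
pose b := c + m%:R * gam.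
pose G (t : k.-tuple T) := expR (lam * \1_D t).
have mG : measurable_fun setT G.
  by apply: measurableT_comp => //; apply: measurable_funM => //; exact: measurable_indic.
have G0 t : 0 <= G t by exact: expR_ge0.
pose Z (x : n.-tuple T) := (\prod_(j < m) G (block k j x)) * \prod_(i < n) g (tnth x i).
have mGp : measurable_fun setT (fun x : n.-tuple T => \prod_(j < m) G (block k j x)).
  by apply: measurable_prod => j _; apply: (measurableT_comp mG); exact: measurable_block.
have mZ : measurable_fun setT Z.
  apply: measurable_funM => //; apply: measurable_prod => i _.
  by apply: (measurableT_comp mg); exact: measurable_tnth.
have Z0 x : 0 <= Z x by rewrite mulr_ge0// prodr_ge0.
have ZI : (\int[mu]_x (Z x)%:E <= (expR b)%:E)%E.
  have mZ' : measurable_fun setT (fun x => (Z x)%:E) by exact/measurable_EFinP.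
  apply: le_trans (conditioned_le mS p_gt0 cmu mZ' _) _; first by move=> x; rewrite lee_fin.
  apply: (@le_trans _ _ ((expR c)%:E * (expR (m%:R * gam))%:E)%E); last by rewrite -EFinM -expRD.
  apply: lee_pmul; first by rewrite lee_fin invr_ge0 ltW.
  - by apply: integral_ge0 => x _; rewrite lee_fin.
  - rewrite lee_fin -[c]opprK expRN lef_pV2//.
    by rewrite posrE expR_gt0.
  have F0 (x : n.-tuple T) : (0 <= (\prod_(j < m) G (block k j x))%:E)%E.
    by rewrite lee_fin prodr_ge0.
  have wle (F : T -> \bar R) : measurable_fun setT F -> (forall x, 0 <= F x)%E ->
      (\int[alpha]_x (F x * (g x)%:E) <= \int[nubar]_x F x)%E.
    by move=> mF Fge; rewrite (density_integral dg).
  have mGe : measurable_fun setT (fun x : n.-tuple T => (\prod_(j < m) G (block k j x))%:E).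
    exact/measurable_EFinP.
  have := le_integral_weight mg g0 wle mGe F0.
  move=> h1; apply: le_trans h1 _.
  apply: (@le_trans _ _ ((1 + gam) ^+ m)%:E).
    apply: integral_prod_block => //.
    apply: (@le_trans _ _ (\int[product_law nubar k]_x (1 + (lam + 2 * lam ^+ 2) * \1_D x)%:E)%E).
      apply: ge0_le_integral => //.
      + by move=> x _; rewrite lee_fin.
      + exact/measurable_EFinP.
      + apply/measurable_EFinP; apply: measurable_funD => //.
        by apply: measurable_funM => //; exact: measurable_indic.
      + move=> x _; rewrite lee_fin /G indicE; case: (_ \in _).
          by rewrite !mulr1; exact: expR_le1DxD2.
        by rewrite !mulr0 expR0 addr0.
    rewrite le_eqVlt; apply/orP; left; apply/eqP.
    have i1 : (product_law nubar k).-integrable setT (fun x => (1 + (lam + 2 * lam ^+ 2) * \1_D x)%:E).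
      apply: (@bounded_integrable _ _ _ _ _ (1 + (lam + 2 * lam ^+ 2))).
        apply: measurable_funD => //.
        by apply: measurable_funM => //; exact: measurable_indic.
      have l2 : 0 <= lam + 2 * lam ^+ 2 by rewrite addr_ge0// mulr_ge0// sqr_ge0.
      move=> x; rewrite ger0_norm ?lerD2l; last by rewrite addr_ge0// mulr_ge0.
      by rewrite ler_piMr// indicE; case: (_ \in _).
    rewrite -(fineK (integrable_fin_num measurableT i1)); congr (_%:E).
    rewrite -[LHS]/(\int[_]_x _); under eq_Rintegral do rewrite addrC.
    rewrite (@Rintegral_affine _ _ _ _ _ 1)//.
    - by rewrite Rintegral_indic// addrC.
    - exact: normr_indic_le1.
  rewrite lee_fin expRM_natl; apply: lerXn2r; rewrite ?nnegrE ?expR_ge0 ?addr_ge0//.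
  exact: expR_ge1Dx.
have Zi : mu.-integrable setT (fun x => (Z x)%:E).
  apply/integrableP; split; first exact/measurable_EFinP.
  rewrite (eq_integral (fun x => (Z x)%:E)); first exact: le_lt_trans ZI (ltry _).
  by move=> x _; rewrite abse_EFin ger0_norm.
have ZR : \int[mu]_x Z x <= expR b.
  by rewrite -lee_fin /Rintegral fineK//; exact: integrable_fin_num.
have i1 : mu.-integrable setT (fun=> (b - 1)%:E : \bar R).
  exact: (@bounded_integrable _ _ _ _ (cst (b - 1)) `|b - 1|).
have lN := integrableZl measurableT lam Ni.
have eZ := integrableZl measurableT (expR (- b)) Zi.
have : \int[mu]_x (L x + lam * N x) <= \int[mu]_x ((b - 1) + expR (- b) * Z x).
  have iLN := integrableD measurableT Li lN.
  have iZ := integrableD measurableT i1 eZ.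
  apply: ae_le_Rintegral => //; have := barycenter_positive dg; apply: filterS => x gx.
  have -> : Z x = expR (L x + lam * N x).
    rewrite expRD mulrC; congr (_ * _).
      by rewrite /N mulr_sumr expR_sum.
    by rewrite /L expR_sum; apply: eq_bigr => i _; rewrite lnK// posrE.
  by rewrite -expRD; apply: le_trans (_ : _ <= b - 1 + (1 + (- b + (L x + lam * N x)))) _;
    [lra | rewrite lerD2l expR_ge1Dx].
have -> : \int[mu]_x (L x + lam * N x) = n%:R * fine (entropy alpha g) + m%:R * (lam * v).
  by rewrite RintegralD// RintegralZl// LE NE /Rintegral lnE mulrCA.
have -> : \int[mu]_x (b - 1 + expR (- b) * Z x) = b - 1 + expR (- b) * \int[mu]_x Z x.
  by rewrite RintegralD// RintegralZl//; congr (_ + _); exact: Rintegral_cst1.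
move=> h1; apply: le_trans h1 _.
have := ler_wpM2l (expR_ge0 (- b)) ZR; rewrite -expRD addNr expR0.
rewrite /b /gam; lra.
Qed.

End conditioned_entropy.

(** * Total variation between product laws, and location of the barycenter *)

Section product_total_variation.
Context d (T : measurableType d) (R : realType).
Variables (alpha nu1 nu2 : probability T R) (g1 g2 : T -> R) (e : R).
Hypothesis d1 : density alpha nu1 g1.
Hypothesis d2 : density alpha nu2 g2.
Hypothesis e12 : (\int[alpha]_x `|g1 x - g2 x|%:E <= e%:E)%E.

(** Replace nu1 by nu2 one coordinate at a time; each replacement costs e. *)
Lemma product_law_density_test n (F : n.-tuple T -> R) : measurable_fun setT F ->
  (forall x, 0 <= F x <= 1) ->
  `|\int[product_law nu1 n]_x F x - \int[product_law nu2 n]_x F x| <= n%:R * e.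
Proof.
elim: n F => [|n IH] F mF F01.
  by rewrite /= subrr normr0 mul0r.
have Fn x : `|F x| <= 1 by have /andP[? ?] := F01 x; rewrite ger0_norm.
have mFx x : measurable_fun setT (fun t : n.-tuple T => F [tuple of x :: t]).
  by apply: (measurableT_comp mF); apply: measurable_cons => //; exact: measurable_cst.
pose G (P : probability T R) x := \int[product_law P n]_t F [tuple of x :: t].
have GE (P : probability T R) x :
    (\int[product_law P n]_t (F [tuple of x :: t])%:E = (G P x)%:E)%E.
  rewrite /G /Rintegral fineK//; apply: integrable_fin_num => //.
  by apply: (@bounded_integrable _ _ _ _ _ 1).
have mG P : measurable_fun setT (G P).
  apply/measurable_EFinP.
  rewrite (_ : EFin \o G P = fun x => (\int[product_law P n]_t (F [tuple of x :: t])%:E)%E).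
    apply: (@measurable_integral_cons _ _ _ P n (fun x => (F x)%:E)).
    - exact/measurable_EFinP.
    - by move=> x; rewrite lee_fin; case/andP: (F01 x).
  by apply/funext => x; rewrite GE.
have Gn P x : `|G P x| <= 1 by apply: Rintegral_le_bound.
have E (P : probability T R) : \int[product_law P n.+1]_x F x = \int[P]_x G P x.
  rewrite /Rintegral integral_product_lawS.
  - by congr fine; apply: eq_integral => x _; exact: GE.
  - exact/measurable_EFinP.
  - by move=> x; rewrite lee_fin; case/andP: (F01 x).
rewrite !E; apply: le_trans (ler_distD (\int[nu1]_x G nu2 x) _ _) _.
rewrite -natr1 mulrDl mul1r lerD//; last first.
  by rewrite -[e]mul1r; apply: (density_test d1 d2).
rewrite -RintegralB//; last 2 first.
- exact: (@bounded_integrable _ _ _ _ _ 1).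
- exact: (@bounded_integrable _ _ _ _ _ 1).
apply: Rintegral_le_bound; first exact: measurable_funB.
by move=> x; exact: IH.
Qed.

Lemma product_law_tv n D : measurable D ->
  `|fine (product_law nu1 n D) - fine (product_law nu2 n D)| <= n%:R * e.
Proof.
move=> mD; rewrite -!Rintegral_indic//; apply: product_law_density_test.
  exact: measurable_indic.
by move=> x; rewrite indicE; case: (_ \in _); rewrite /= ?lexx ?ler01.
Qed.

End product_total_variation.

Section barycenters.
Context (R : realType) (E : pointedMetricType R).
Hypothesis cE : compact [set: E].
Variables (C : set (M1 E)) (n : nat) (mu : probability (n.-tuple (borel E)) R).
Variables (nubar : M1 E) (S : set (n.-tuple (borel E))) (r : R).
Hypothesis convC : convex_measures C.
Hypothesis n_gt0 : (0 < n)%N.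
Hypothesis mS : measurable S.
Hypothesis muS : mu S = 1%E.
Hypothesis law : forall i A, (i < n)%N -> measurable A ->
  mu [set x | A (nth point x i)] = nubar A.
Hypothesis nearC : forall x, S x -> neighborhood C r (empirical R x).

Let Emp (f : borel E -> R) (x : n.-tuple (borel E)) : R :=
  n%:R^-1 * \sum_(i < n) f (tnth x i).

Lemma integral_barycenter f : fm_ball f ->
  mu.-integrable setT (fun x => (Emp f x)%:E) /\ \int[mu]_x Emp f x = \int[nubar]_x f x.
Proof.
move=> fb; have mf := fm_ball_measurable fb.
have fi : nubar.-integrable setT (fun x => (f x)%:E).
  by apply: (bounded_integrable nubar mf); exact: fm_ball_bound.
have [i1 E1] := integrable_coordinate_sum law mf fi.
split; first exact: (integrableZl measurableT n%:R^-1 i1).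
rewrite /Emp RintegralZl// E1 mulKf// pnatr_eq0.
by rewrite -lt0n.
Qed.

Lemma measurable_find_ball (s : seq E) rho i :
  measurable [set z : borel E | find (fun e => mdist e (z : E) < rho) s = i].
Proof.
elim: s i => [|e s IH] i.
  case: i => [|i]; first by rewrite (_ : [set z | _] = setT)//; apply/seteqP; split.
  by rewrite (_ : [set z | _] = set0)//; apply/seteqP; split.
have mb := measurable_mdist_ball e rho.
case: i => [|i].
  rewrite (_ : [set z | _] = [set z : borel E | mdist e (z : E) < rho])//.
  by apply/seteqP; split => z /=; case: ifP.
rewrite (_ : [set z | _] = ~` [set z : borel E | mdist e (z : E) < rho] `&`
    [set z : borel E | find (fun e => mdist e (z : E) < rho) s = i]).
  by apply: measurableI => //; exact: measurableC.
apply/seteqP; split => z /=; first by case: ifP => // /negbT h [].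
by move=> [/negP/negbTE -> ->].
Qed.

(** By exchangeability nubar is the mu-average of the empirical measures of points
   of S, each of which is close to C. To apply convexity of C to finitely many
   points only, E^n is cut into the cells of a net of mesh rho, and one point of S
   is kept per cell: two points of one cell have empirical measures within
   2 * rho. *)
Lemma barycenter_neighborhood (rho : R) : 0 < rho -> neighborhood C (r + 2 * rho) nubar.
Proof.
move=> rho0; have [s hs] := finite_net cE rho0.
have idx_ex (z : E) : (find (fun e => (mdist e z < rho)%R) s < size s)%N by rewrite -has_find.
pose Idx := n.-tuple 'I_(size s).
pose u (x : n.-tuple (borel E)) : Idx := [tuple Ordinal (idx_ex (tnth x i)) | i < n].
pose cell (t : Idx) : set (n.-tuple (borel E)) := [set x | u x = t].
have mcell t : measurable (cell t).
  rewrite (_ : cell t = \bigcap_(i in [set: 'I_n]) ((@tnth n (borel E))^~ i @^-1`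
      [set z : borel E | find (fun e => mdist e (z : E) < rho) s = tnth t i])).
    apply: fin_bigcap_measurable => // i _.
    by rewrite -[X in measurable X]setTI; apply: measurable_tnth => //; exact: measurable_find_ball.
  apply/seteqP; split => [x <- i _|x h]; first by rewrite /= tnth_mktuple.
  apply: eq_from_tnth => i; apply: val_inj; rewrite tnth_mktuple /=.
  exact: (h i I).
have close x y i : u x = u y -> mdist (tnth x i : E) (tnth y i) <= 2 * rho.
  move=> /(congr1 (fun t : Idx => val (tnth t i))); rewrite !tnth_mktuple /= => xy.
  have hx := nth_find (tnth x i : E) (hs (tnth x i)).
  have hy := nth_find (tnth x i : E) (hs (tnth y i)).
  rewrite -xy in hy; move: (nth _ s _) hx hy => e hx hy.
  apply: le_trans (metric_triangle _ e _) _; rewrite mulr_natl mulr2n lerD ?ltW//.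
  by rewrite metric_sym.
have [x0 Sx0] : exists x, S x.
  apply: contrapT => nS; have : mu S = 0%E.
    by rewrite (_ : S = set0) ?measure0//; apply/seteqP; split => // x Sx; apply: nS; exists x.
  by rewrite muS => /eqP; rewrite onee_eq0.
have [a0 Ca0 _] := nearC Sx0.
have rep_ex t : {c : M1 E | C c /\ forall x, S x -> u x = t ->
    exists y, [/\ S y, u y = t & fm_close r c (empirical R y)]}.
  apply: cid; have [[y [Sy uy]]|no] := pselect (exists y, S y /\ u y = t).
    have [c Cc cy] := nearC Sy; exists c; split => // x _ _.
    by exists y.
  by exists a0; split => // x Sx ux; exfalso; apply: no; exists x.
pose c t := proj1_sig (rep_ex t).
have Cc t : C (c t) by have [] := proj2_sig (rep_ex t).
have crep x : S x -> exists y, [/\ S y, u y = u x & fm_close r (c (u x)) (empirical R y)].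
  by move=> Sx; have [_ h] := proj2_sig (rep_ex (u x)); exact: h Sx erefl.
pose w t := fine (mu (cell t)).
have stepE (z : Idx -> R) : mu.-integrable setT (fun x => (z (u x))%:E) /\
    \int[mu]_x z (u x) = \sum_(t : Idx) w t * z t.
  have zE x : z (u x) = \sum_(t : Idx) z t * \1_(cell t) x.
    rewrite (bigD1 (u x))//= indicE mem_set//= mulr1 big1 ?addr0// => t tu.
    rewrite indicE memNset ?mulr0// /cell/= => ux; move: tu.
    by rewrite ux eqxx.
  have ci t : mu.-integrable setT (fun x => (\1_(cell t) x : R)%:E).
    apply: (@bounded_integrable _ _ _ _ _ 1); first exact: measurable_indic.
    exact: normr_indic_le1.
  have ii t : mu.-integrable setT (fun x => (z t * \1_(cell t) x)%:E).
    exact: (integrableZl measurableT (z t) (ci t)).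
  under eq_fun do rewrite zE; split.
    by under eq_fun do rewrite -sumEFin; exact: integrable_sum.
  under eq_Rintegral do rewrite zE.
  rewrite Rintegral_fin_sum//; apply: eq_bigr => t _.
  rewrite RintegralZl//; last exact: ci.
  by rewrite Rintegral_indic// mulrC.
have w1 : \sum_(t : Idx) w t = 1.
  have [_] := stepE (fun=> 1); rewrite Rintegral_cst1 => /esym.
  by under eq_bigr do rewrite mulr1.
have w0 t : 0 <= w t by exact: fine_probability_ge0.
have W0 : 0 < \sum_(t : Idx) w t by rewrite w1 ltr01.
have [a Ca aE] := finite_mixture convC w0 Cc W0.
exists a => // f fb; have mf := fm_ball_measurable fb; have f1 := fm_ball_bound fb.
have [Ei EE] := integral_barycenter fb.
pose z t := \int[c t]_y f y.
have [zi zE] := stepE z.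
have aE' : \int[a]_y f y = \int[mu]_x z (u x).
  by rewrite zE -(aE f 1 mf f1) w1 mul1r.
rewrite aE' -EE -RintegralB//.
have ptw x : S x -> `|z (u x) - Emp f x| <= r + 2 * rho.
  move=> Sx; have [y [Sy uy cy]] := crep x Sx.
  apply: le_trans (ler_distD (Emp f y) _ _) _; rewrite lerD//.
    by have := cy f fb; rewrite (Rintegral_empirical _ n_gt0 mf f1).
  have n1 : 0 < n%:R :> R by rewrite ltr0n.
  rewrite /Emp -mulrBr -sumrB normrM [`|n%:R^-1|]ger0_norm ?invr_ge0 ?ler0n//.
  rewrite ler_pdivrMl//.
  apply: le_trans (ler_norm_sum _ _ _) _.
  have [m [l [m0 l0 ml _ lf]]] := fb.
  apply: (@le_trans _ _ (\sum_(i < n) 2 * rho)); last first.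
    by rewrite sumr_const card_ord -[_ *+ n]mulr_natl.
  apply: ler_sum => i _; apply: le_trans (lipschitz_le_norm _ _ lf) _.
  apply: (@le_trans _ _ (1 * mdist (tnth y i : E) (tnth x i))); last by rewrite mul1r close.
  by rewrite ler_wpM2r ?mdist_ge0//; lra.
have di : mu.-integrable setT (fun x => (z (u x) - Emp f x)%:E).
  exact: (integrableB measurableT zi Ei).
have aeS (P : n.-tuple (borel E) -> Prop) : (forall x, S x -> P x) -> {ae mu, forall x, P x}.
  move=> SP; exists (~` S); split; first exact: measurableC.
    by rewrite probability_setC// muS subee.
  by move=> x /= nP Sx; apply: nP; exact: SP.
have cst_i (b : R) : mu.-integrable setT (fun=> b%:E : \bar R).
  exact: (@bounded_integrable _ _ _ _ (cst b) `|b|).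
rewrite ler_norml; apply/andP; split.
  rewrite -[leLHS](Rintegral_cst1 mu); apply: ae_le_Rintegral => //.
  by apply: aeS => x /ptw; rewrite ler_norml => /andP[].
rewrite -[leRHS](Rintegral_cst1 mu); apply: ae_le_Rintegral => //.
by apply: aeS => x /ptw; rewrite ler_norml => /andP[].
Qed.

End barycenters.

(** * Conditioning on the event *)

Section gibbs_conditioning.
Context (R : realType) (E : pointedMetricType R).
Hypothesis cE : compact [set: E].
Variables (alpha : M1 E) (C : set (M1 E)) (Q : M1 E) (h : borel E -> R) (H : R).
Hypothesis convC : convex_measures C.
Hypothesis closedC : closed C.
Hypothesis CQ : C Q.
Hypothesis dh : density alpha Q h.
Hypothesis hH : entropy alpha h = H%:E.
Hypothesis minH : forall nu g, C nu -> density alpha nu g -> (H%:E <= entropy alpha g)%E.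
Variables (dbar : M1 E -> M1 E -> R) (kappa : R).
Hypothesis good : good_distance dbar kappa.

Let event n e : set (n.-tuple (borel E)) :=
  @empirical_event _ (borel E) R n (enlargement dbar C e).

Lemma min_entropy_ge0 : 0 <= H.
Proof. by rewrite -lee_fin -hH (entropy_ge0 dh). Qed.

(** With q = eta / (2 * (1 + H + eta)), the loss q * n * (H + eta) of the lower
   bound is at most n * eta / 2, which leaves 1 as soon as n >= 2 / eta. *)
Lemma event_probability eta : 0 < eta -> exists2 q, 0 < q &
  \forall n \near \oo, forall S : set (n.-tuple (borel E)), measurable S ->
    (product_law Q n (~` S) <= q%:E)%E ->
    ((expR (- (n%:R * (H + eta))))%:E <= product_law alpha n S)%E.
Proof.
move=> eta0; have H0 := min_entropy_ge0.
have d0 : 0 < 2 * (1 + H + eta) by rewrite mulr_gt0// addr_gt0// ltr_pwDl.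
exists (eta / (2 * (1 + H + eta))); first by rewrite divr_gt0.
near=> n => S mS qS.
have n1 : 2 / eta <= n%:R by near: n; exact: nbhs_infty_ger.
have c0 : 0 <= n%:R * (H + eta) by rewrite mulr_ge0// addr_ge0// ltW.
apply: (product_law_lower_bound dh hH mS qS _ c0).
have n0 : 0 <= n%:R :> R by [].
have hn : 2 <= n%:R * eta by rewrite -ler_pdivrMr.
set q := eta / _.
have q0 : 0 <= q by rewrite divr_ge0// ltW.
have : q * (H + eta) <= eta / 2.
  apply: (@le_trans _ _ (q * (1 + H + eta))); first by rewrite ler_wpM2l//; lra.
  rewrite /q le_eqVlt; apply/orP; left; apply/eqP; field.
  by rewrite gt_eqF//; lra.
move=> /(ler_wpM2l n0); lra.
Unshelve. all: by end_near. Qed.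

Section one_step.
Variables (n k : nat) (e r tau lam eta : R).
Hypothesis k_gt0 : (0 < k)%N.
Hypothesis kn : (k <= n)%N.
Hypothesis lam0 : 0 < lam.
Hypothesis lam1 : lam <= 1 / 2.
Hypothesis eta0 : 0 < eta.
Hypothesis r0 : 0 < r.
Hypothesis event_close : forall a nu, dbar a nu <= e -> fm_close (r / 2) a nu.
Variable eps : R.
Hypothesis epse : eps < e.
Hypothesis ent_low : entropy_bound alpha C r (H - eta).
Hypothesis near_proj : forall nu g, neighborhood C r nu -> density alpha nu g ->
  (entropy alpha g <= (H + eta)%:E)%E ->
  (\int[alpha]_x `|g x - h x|%:E <= tau%:E)%E.
Hypothesis p_low : ((expR (- (n%:R * (H + eta))))%:E <= product_law alpha n (@event n eps))%E.

(** The heart of the argument. The lower bound p_low and the estimate with lam = 0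
   show that the barycenter has entropy at most H + eta, so its density is close
   to h; being close to C, it also has entropy at least H - eta. The estimate with
   lam > 0 then has an entropy defect of at most 2 * n * eta, to be shared among
   n %/ k >= n / (2 * k) blocks. *)
Lemma conditional_law_upper D : measurable D ->
  fine (conditional_law alpha n (enlargement dbar C eps) k D) <=
    fine (product_law Q k D) + k%:R * tau + 2 * lam + 4 * k%:R * eta / lam.
Proof.
have n_gt0 : (0 < n)%N by exact: leq_trans kn.
have mS : measurable (@event n eps) by exact: (measurable_empirical_event cE good C eps n_gt0).
have plow := p_low; set S := (@event n eps) in mS plow; set p := fine (product_law alpha n S).
have pS : product_law alpha n S = p%:E by rewrite probability_fineK.
have pc : expR (- (n%:R * (H + eta))) <= p by move: plow; rewrite pS lee_fin.
have p0 : 0 < p by apply: lt_le_trans pc; exact: expR_gt0.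
have [mu cmu] := conditioned_exists mS pS p0.
have invS s x : (forall i, (i < n)%N -> (s i < n)%N) ->
    (forall i j, (i < n)%N -> (j < n)%N -> s i = s j -> i = j) ->
    S (subtuple n s x) = S x.
  by move=> sn sI; rewrite /S /event /empirical_event /= empirical_subtuple.
have mX := @measurable_nth_tuple _ (borel E) n 0.
pose X : {mfun (n.-tuple (borel E)) >-> borel E} :=
  HB.pack (fun x : n.-tuple (borel E) => nth point x 0%N) (isMeasurableFun.Build _ _ _ _ _ mX).
pose nubar : M1 E := distribution mu X.
have law i A : (i < n)%N -> measurable A -> mu [set x | A (nth point x i)] = nubar A.
  by move=> ni mA; rewrite (conditioned_coordinate mS p0 cmu invS ni mA).
have muS : mu S = 1%E.
  by rewrite (conditionedE mS p0 cmu)// setIid pS -EFinM mulfV// gt_eqF.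
have nearS x : S x -> neighborhood C (r / 2) (empirical R x).
  move=> Sx; have : (dist_to dbar C (empirical R x) < e%:E)%E.
    by apply: le_lt_trans Sx _; rewrite lte_fin.
  move=> /ereal_inf_lt[_ [a Ca <-]]; rewrite lte_fin => /ltW ae.
  by exists a => //; exact: event_close.
have rho0 : 0 < r / 4 by rewrite divr_gt0.
have := barycenter_neighborhood cE convC n_gt0 mS muS law nearS rho0.
rewrite (_ : r / 2 + 2 * (r / 4) = r); last by field.
move=> nbar.
have [g dg] := barycenter_density mS p0 cmu law n_gt0.
have gfin := barycenter_entropy mS p0 cmu law n_gt0 dg.
have gE : ((fine (entropy alpha g))%:E = entropy alpha g)%E.
  by rewrite fineK// ge0_fin_numE// (entropy_ge0 dg).
have n1 : 0 < n%:R :> R by rewrite ltr0n.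
have entle : fine (entropy alpha g) <= H + eta.
  have := @entropy_block_estimate _ _ _ _ _ _ _ mS p0 _ _ cmu law n_gt0 g k 0 set0 0
    (n%:R * (H + eta)) 0 dg.
  rewrite !mul0r !addr0 => /(_ measurable0 (leq0n _)) est.
  rewrite -(ler_pM2l n1); apply: est => //.
  by rewrite lexx divr_ge0.
have gh : (\int[alpha]_x `|g x - h x|%:E <= tau%:E)%E.
  by apply: near_proj nbar dg _; rewrite -gE lee_fin.
have entge : H - eta <= fine (entropy alpha g).
  by rewrite -lee_fin gE; exact: ent_low nbar dg.
move=> mD; have mB : measurable (@block _ (borel E) k n 0 @^-1` D).
  by rewrite -[X in measurable X]setTI; exact: measurable_block.
have -> : conditional_law alpha n (enlargement dbar C eps) k D = mu (@block _ _ k n 0 @^-1` D).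
  by rewrite (conditionedE mS p0 cmu).
set P := fine _.
pose m := (n %/ k)%N.
have m_gt0 : (0 < m)%N by rewrite divn_gt0.
have mkn : (m * k <= n)%N by exact: leq_trunc_div.
have nm : n%:R <= 2 * k%:R * m%:R :> R.
  rewrite -!natrM ler_nat; apply: leq_trans (ltnW (ltn_ceil n k_gt0)) _.
  by rewrite -/m mulSn -mulnA [(k * m)%N]mulnC mul2n -addnn leq_add2r leq_pmull.
have vD j : (j < m)%N -> mu (@block _ _ k n j @^-1` D) = P%:E.
  move=> jm; rewrite /P probability_fineK//.
  apply: (conditioned_block mS p0 cmu invS _ mD).
  by rewrite -mulSnr; apply: leq_trans mkn; rewrite leq_mul2r jm orbT.
have lam01 : 0 <= lam <= 1 / 2 by rewrite ltW.
have := entropy_block_estimate mS p0 cmu law n_gt0 dg mD mkn vD pc lam01.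
set v := fine (product_law nubar k D) => est.
have vQ : v <= fine (product_law Q k D) + k%:R * tau.
  have := product_law_tv dg dh gh mD; rewrite ler_norml => /andP[_].
  by rewrite lerBlDl.
have v1 : v <= 1 by exact: fine_probability_le1.
have v0 : 0 <= v by exact: fine_probability_ge0.
have m1 : 0 < m%:R :> R by rewrite ltr0n.
have ml : 0 < m%:R * lam by rewrite mulr_gt0.
suff : P <= v + 2 * lam + 4 * k%:R * eta / lam by lra.
rewrite -(ler_pM2l ml).
have -> : m%:R * lam * (v + 2 * lam + 4 * k%:R * eta / lam) =
    m%:R * (lam * v) + m%:R * (2 * lam ^+ 2) + 2 * (2 * k%:R * m%:R) * eta.
  by field; rewrite gt_eqF.
have h1 : n%:R * (H - eta) <= n%:R * fine (entropy alpha g) by rewrite ler_wpM2l// ltW.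
have h2 : n%:R * eta <= (2 * k%:R * m%:R) * eta by rewrite ler_wpM2r// ltW.
have h3 : m%:R * ((2 * lam ^+ 2) * v) <= m%:R * (2 * lam ^+ 2).
  by rewrite (ler_wpM2l (ltW m1))// ler_piMr// mulr_ge0// sqr_ge0.
have : m%:R * ((lam + 2 * lam ^+ 2) * v) = m%:R * (lam * v) + m%:R * ((2 * lam ^+ 2) * v).
  by ring.
rewrite -!mulrA in est h1 h2 h3 *; lra.
Qed.

End one_step.

(** An upper bound for every measurable D gives a lower bound by passing to the
   complement. *)
Lemma conditional_law_cvg c (eps : R^nat) k : 0 <= kappa -> 2 * kappa ^+ 2 = c^-1 ->
  (forall n, 0 < eps n) -> eps n @[n --> \oo] --> 0 ->
  (covering_number dbar (eps n / 4) *
     (expR (- (n%:R * eps n ^+ 2 / c)))%:E)%E @[n --> \oo] --> 0%E ->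
  (0 < k)%N -> forall tau, 0 < tau -> \forall n \near \oo,
    (0 < product_law alpha n (@event n (eps n)))%E /\
    forall D, measurable D ->
      (`|conditional_law alpha n (enlargement dbar C (eps n)) k D
         - product_law Q k D| <= tau%:E)%E.
Proof.
move=> kap0 kc eps_gt0 eps0 cov k0 tau tau0.
have kR : 0 < k%:R :> R by rewrite ltr0n.
have [r1 [eta1 [r10 eta10 near_proj]]] :
    exists r eta : R, [/\ 0 < r, 0 < eta & forall nu g, neighborhood C r nu ->
    density alpha nu g -> (entropy alpha g <= (H + eta)%:E)%E ->
    (\int[alpha]_x `|g x - h x|%:E <= (tau / 2 / k%:R)%:E)%E].
  have t0 : 0 < tau / 2 / k%:R by rewrite !divr_gt0.
  exact: (near_projection_close cE convC closedC CQ dh hH minH t0).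
(* the three errors k * (tau / 2 / k), 2 * lam and 4 * k * eta / lam of
   conditional_law_upper are to add up to tau *)
pose lam := Num.min (1 / 2) (tau / 8).
have lam0 : 0 < lam by rewrite lt_min !divr_gt0.
have lam1 : lam <= 1 / 2 by rewrite ge_min lexx.
have lam2 : lam <= tau / 8 by rewrite ge_min lexx orbT.
pose eta := Num.min eta1 (lam * tau / (16 * k%:R)).
have eta0 : 0 < eta by rewrite lt_min eta10 !(divr_gt0, mulr_gt0).
have eta_1 : eta <= eta1 by rewrite ge_min lexx.
have eta_2 : 4 * k%:R * eta / lam <= tau / 4.
  have : eta <= lam * tau / (16 * k%:R) by rewrite ge_min lexx orbT.
  rewrite ler_pdivlMr ?mulr_gt0// ler_pdivrMr//; lra.
have [r2 r20 ent_low] : exists2 r : R, 0 < r & entropy_bound alpha C r (H - eta).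
  exact: (entropy_neighborhood cE convC closedC minH eta0).
pose r := Num.min r1 r2.
have r0 : 0 < r by rewrite lt_min r10.
have rr1 : r <= r1 by rewrite ge_min lexx.
have rr2 : r <= r2 by rewrite ge_min lexx orbT.
have [_ close _] := good.
have r20' : 0 < r / 2 by rewrite divr_gt0.
have [e e0 event_close] := close _ r20'.
have [q q0 lowq] := event_probability eta0.
have ent_low' : entropy_bound alpha C r (H - eta).
  move=> nu g nr; exact: ent_low (neighborhood_mono rr2 nr).
have near_proj' nu g : neighborhood C r nu -> density alpha nu g ->
    (entropy alpha g <= (H + eta)%:E)%E ->
    (\int[alpha]_x `|g x - h x|%:E <= (tau / 2 / k%:R)%:E)%E.
  move=> nr dg ge; apply: near_proj (neighborhood_mono rr1 nr) dg _.
  by apply: le_trans ge _; rewrite lee_fin lerD2l.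
near=> n.
have kn : (k <= n)%N by near: n; exact: nbhs_infty_ge.
have n0 : (0 < n)%N by exact: leq_trans kn.
have epse : eps n < e by near: n; exact: (cvgr_lt _ eps0).
have mS : measurable (@event n (eps n)) by exact: (measurable_empirical_event cE good C (eps n) n0).
have p_low : ((expR (- (n%:R * (H + eta))))%:E <= product_law alpha n (@event n (eps n)))%E.
  have whp : (product_law Q n (~` @event n (eps n)) <= q%:E)%E.
    near: n; exact: (empirical_event_whp cE good CQ kap0 kc eps_gt0 cov q0).
  suff : forall S : set (n.-tuple (borel E)), measurable S ->
      (product_law Q n (~` S) <= q%:E)%E ->
      ((expR (- (n%:R * (H + eta))))%:E <= product_law alpha n S)%E by exact.
  by near: n; exact: lowq.
have pos : (0 < product_law alpha n (@event n (eps n)))%E.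
  by apply: lt_le_trans p_low; rewrite lte_fin expR_gt0.
split=> // D mD.
have upper A : measurable A ->
    fine (conditional_law alpha n (enlargement dbar C (eps n)) k A) <=
      fine (product_law Q k A) + tau.
  move=> mA; apply: le_trans (conditional_law_upper k0 kn lam0 lam1 eta0 r0
    event_close epse ent_low' near_proj' p_low mA) _.
  rewrite -!addrA lerD2l.
  have -> : k%:R * (tau / 2 / k%:R) = tau / 2 by field; rewrite gt_eqF.
  lra.
set p := fine (product_law alpha n (@event n (eps n))).
have pS : product_law alpha n (@event n (eps n)) = p%:E by rewrite probability_fineK.
have p0 : 0 < p by rewrite -lte_fin -pS.
have [mu cmu] := conditioned_exists mS pS p0.
have condE A : measurable A -> conditional_law alpha n (enlargement dbar C (eps n)) k A =
    mu (@block _ _ k n 0 @^-1` A).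
  move=> mA; rewrite (conditionedE mS p0 cmu)//.
  by rewrite -[X in measurable X]setTI; exact: measurable_block.
have mB A : measurable A -> measurable (@block _ (borel E) k n 0 @^-1` A).
  by move=> mA; rewrite -[X in measurable X]setTI; exact: measurable_block.
have u1 := upper _ mD; have u2 := upper _ (measurableC mD).
rewrite condE// in u1; rewrite condE in u2; last exact: measurableC.
rewrite condE// -(probability_fineK mu (mB _ mD)) -(probability_fineK (product_law Q k) mD).
have {}u2 : 1 - fine (mu (@block _ _ k n 0 @^-1` D)) <= 1 - fine (product_law Q k D) + tau.
  by rewrite -(fine_probabilityC _ (mB _ mD)) -(fine_probabilityC _ mD).
move: (fine (mu _)) (fine (product_law Q k D)) u1 u2 => a b u1 u2.
rewrite -EFinB abse_EFin lee_fin ler_norml.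
by apply/andP; split; lra.
Unshelve. all: by end_near. Qed.

Lemma tv_distance_cvg c (eps : R^nat) k : 0 <= kappa -> 2 * kappa ^+ 2 = c^-1 ->
  (forall n, 0 < eps n) -> eps n @[n --> \oo] --> 0 ->
  (covering_number dbar (eps n / 4) *
     (expR (- (n%:R * eps n ^+ 2 / c)))%:E)%E @[n --> \oo] --> 0%E ->
  (0 < k)%N ->
  (\forall n \near \oo, (0 < product_law alpha n (@event n (eps n)))%E) /\
  tv_distance (conditional_law alpha n (enlargement dbar C (eps n)) k)
    (product_law Q k) @[n --> \oo] --> 0%E.
Proof.
move=> kap0 kc eps_gt0 eps0 cov k0.
have main := conditional_law_cvg kap0 kc eps_gt0 eps0 cov k0.
split; first by apply: filterS (main 1 ltr01) => n [].
have tv_le tau : 0 < tau -> \forall n \near \oo,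
    (0 <= tv_distance (conditional_law alpha n (enlargement dbar C (eps n)) k)
      (product_law Q k) <= tau%:E)%E.
  move=> /main; apply: filterS => n [_ hn]; apply/andP; split.
    apply: le_trans (abse_ge0 _) _.
    by apply: ereal_sup_ubound; exists set0; [exact: measurable0|reflexivity].
  by apply: ge_ereal_sup => _ [D mD <-]; exact: hn.
apply/fine_cvgP; split.
  apply: filterS (tv_le 1 ltr01) => n /andP[t0 t1].
  by rewrite ge0_fin_numE// (le_lt_trans t1)// ltry.
apply/cvgrPdist_le => tau tau0; apply: filterS (tv_le tau tau0) => n /andP[t0 t1].
have tf : tv_distance (conditional_law alpha n (enlargement dbar C (eps n)) k)
    (product_law Q k) \is a fin_num by rewrite ge0_fin_numE// (le_lt_trans t1)// ltry.
by rewrite sub0r normrN ger0_norm ?fine_ge0//= -lee_fin fineK.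
Qed.

End gibbs_conditioning.

Theorem theorem4p5 (R : realType) (E : pointedMetricType R)
  (cE : compact [set: E])
  (alpha : M1 E) (C : set (M1 E))
  (closedC : closed C) (convexC : convex_measures C)
  (finC : (set_entropy C alpha < +oo)%E)
  (alpha_star : M1 E) (projC : I_projection alpha C alpha_star)
  (dbar : M1 E -> M1 E -> R) (c : R)
  (dbarE : (dbar = fortet_mourier_dist /\ c = 8) \/
           (dbar = prohorov_dist /\ c = 2))
  (eps : R^nat) (eps_gt0 : forall n, 0 < eps n)
  (eps0 : eps n @[n --> \oo] --> 0)
  (cov0 : (covering_number dbar (eps n / 4) *
             (expR (- (n%:R * eps n ^+ 2 / c)))%:E)%E @[n --> \oo] --> 0%E)
  (k : nat) (k1 : (1 <= k)%N) :
  let Cn n := enlargement dbar C (eps n) in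
  (\forall n \near \oo, (0 < product_law alpha n (empirical_event (Cn n)))%E)
  /\
  tv_distance (conditional_law alpha n (Cn n) k)
    (product_law alpha_star k) @[n --> \oo] --> 0%E.
Proof.
move=> Cn; have [CQ QE] := projC.
have REfin : (relative_entropy alpha_star alpha < +oo)%E by rewrite QE.
have dom : alpha_star `<< alpha.
  by move: REfin; rewrite /relative_entropy; case: pselect => //=; rewrite ltxx.
have [h dh] : exists h, density alpha alpha_star h.
  by apply: density_exists => A mA; move/null_content_dominatesP: dom; exact.
have RE := relative_entropyE dh.
have hfin : (entropy alpha h < +oo)%E by apply: (entropy_lty dh); rewrite -RE.
have [_ lnE] := entropy_ln dh hfin.
have hH : entropy alpha h = (fine (entropy alpha h))%:E.
  by rewrite fineK// ge0_fin_numE// (entropy_ge0 dh).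
have minH nu g : C nu -> density alpha nu g ->
    ((fine (entropy alpha h))%:E <= entropy alpha g)%E.
  move=> Cnu dg; have [gfin|] := ltP (entropy alpha g) +oo%E; last first.
    by rewrite leye_eq => /eqP ->; rewrite leey.
  have [_ <-] := entropy_ln dg gfin.
  rewrite -hH -lnE -RE QE -(relative_entropyE dg).
  by apply: ereal_inf_lbound; exists nu.
have concl kappa : good_distance dbar kappa -> 0 <= kappa -> 2 * kappa ^+ 2 = c^-1 ->
    (\forall n \near \oo, (0 < product_law alpha n (empirical_event (Cn n)))%E) /\
    tv_distance (conditional_law alpha n (Cn n) k)
      (product_law alpha_star k) @[n --> \oo] --> 0%E.
  move=> good kap0 kc.
  exact: (tv_distance_cvg cE convexC closedC CQ dh hH minH good kap0 kc eps_gt0 eps0 cov0 k1).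
case: dbarE => -[dE cE8]; rewrite dE in concl.
  by apply: (concl (1 / 4)); rewrite ?cE8 ?divr_ge0//; [exact: fortet_mourier_good|field].
by apply: (concl (1 / 2)); rewrite ?cE8 ?divr_ge0//; [exact: prohorov_good|field].
Qed.
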